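(* Let $(X,\mathcal{B},\mu)$ be a standard probability space and let $f:X\to\mathbb{R}$ be a measurable function that is non-zero on a set of positive measure. Then: (1) The set of $T\in\mathcal{E}$ for which there exists a measurable $g:X\to\mathbb{R}$ with $f=g-g\circ T$ a.e. is of first category (meager) in $\mathcal{E}$. (2) There exist $T\in\mathcal{E}$ and a measurable $g:X\to\mathbb{R}$ with $f=g-g\circ T$ a.e. if and only if $\int_{\{f>0\}} f\,d\mu=-\int_{\{f<0\}} f\,d\mu$, where both sides are allowed to be finite or both equal to $\infty$.
   Context: A standard probability space here means one isomorphic to $[0,1]$ with Lebesgue measure. $\mathcal{E}$ is the family of ergodic invertible measure preserving transformations of $(X,\mathcal{B},\mu)$ (identified when equal a.e.), with the weak topology: $T_n\to T$ iff $\mu(T_nA\,\triangle\,TA)\to0$ for every $A\in\mathcal{B}$. *)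

(* Defs.v *)
From HB Require Import structures.
From mathcomp Require Import all_boot all_order all_algebra generic_quotient.
From mathcomp Require Import finmap.
From mathcomp Require Import all_classical all_reals all_analysis.

Set Implicit Arguments.
Unset Strict Implicit.
Unset Printing Implicit Defensive.

Import Order.TTheory GRing.Theory Num.Theory.
Import numFieldNormedType.Exports.

Local Open Scope classical_set_scope.
Local Open Scope ring_scope.

(* Isomorphism modulo null sets of the measure spaces (D1, m1) and (D2, m2):
   a bijection between conull subsets which respects measurability and measure
   in both directions. *)
Definition isomorphic_mod0 (R : realType)
    (d1 : measure_display) (T1 : measurableType d1)
    (m1 : {measure set T1 -> \bar R}) (D1 : set T1)
    (d2 : measure_display) (T2 : measurableType d2)
    (m2 : {measure set T2 -> \bar R}) (D2 : set T2) : Prop :=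
  exists (X1 : set T1) (X2 : set T2) (phi : T1 -> T2),
    [/\ [/\ measurable X1, X1 `<=` D1 & m1 (D1 `\` X1) = 0%E],
        [/\ measurable X2, X2 `<=` D2 & m2 (D2 `\` X2) = 0%E],
        set_bij X1 X2 phi,
        (forall A, A `<=` X1 -> measurable A <-> measurable (phi @` A))
      & (forall A, A `<=` X1 -> measurable A -> m2 (phi @` A) = m1 A)].

(* Lebesgue measure on [0, 1] may be taken on the Borel or on the Lebesgue
   measurable sets; both conventions are accepted. *)
Definition standard_probability (R : realType) (d : measure_display)
    (X : measurableType d) (mu : probability X R) : Prop :=
  isomorphic_mod0 mu setT (@lebesgue_measure R) `[0, 1] \/
  isomorphic_mod0 mu setT (@completed_lebesgue_measure R) `[0, 1].

(* A transformation invertible only modulo null sets agrees almost everywhere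
   with one of these: keep it on a conull invariant measurable set on which it
   is a bimeasurable bijection and take the identity elsewhere. *)
Record ergodic_invertible (R : realType) (d : measure_display)
    (X : measurableType d) (mu : probability X R) (T : X -> X) : Prop := {
  ei_bij : bijective T;
  ei_measurable : measurable_fun setT T;
  ei_image_measurable : forall A, measurable A -> measurable (T @` A);
  ei_preserving : forall A, measurable A -> mu (T @^-1` A) = mu A;
  ei_ergodic : forall A, measurable A -> T @^-1` A = A ->
    mu A = 0%E \/ mu A = 1%E }.

Section ergodic_transformations.
Context {R : realType} {d : measure_display} {X : measurableType d}.
Variable mu : probability X R.

Record ergodic_transf := ErgodicTransf {
  etfun :> X -> X;
  etfunP : ergodic_invertible mu etfun }.

HB.instance Definition _ := gen_eqMixin ergodic_transf.
HB.instance Definition _ := gen_choiceMixin ergodic_transf.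

Definition ae_equal (T S : ergodic_transf) : bool :=
  `[< {ae mu, forall x, T x = S x} >].

Lemma ae_equal_refl : reflexive ae_equal.
Proof. by move=> T; apply/asboolP; exact: aeW. Qed.

Lemma ae_equal_sym : symmetric ae_equal.
Proof.
by move=> T S; apply/asboolP/asboolP; apply: filterS => x ->.
Qed.

Lemma ae_equal_trans : transitive ae_equal.
Proof.
move=> T S U /asboolP ST /asboolP TU; apply/asboolP.
by apply: filterS2 ST TU => x -> ->.
Qed.

Canonical ae_equal_equiv :=
  EquivRel ae_equal ae_equal_refl ae_equal_sym ae_equal_trans.

Definition ergodic_class : Type := {eq_quot ae_equal}%qT.

HB.instance Definition _ := Choice.on ergodic_class.
HB.instance Definition _ := EqQuotient.on ergodic_class.

(* mu (TA \triangle SA), read on representatives: by [weak_dev_pi] this does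
   not depend on their choice. *)
Definition weak_dev (A : set X) (T S : ergodic_class) : \bar R :=
  mu ((repr T @` A) `+` (repr S @` A)).

(* [weak_cvgP] gives the sequential description of this topology. *)
HB.instance Definition _ := isSubBaseTopological.Build ergodic_class
  [set U | exists (T : ergodic_class) (A : set X) (e : R), [/\ measurable A, 0 < e &
     U = [set S | (weak_dev A S T < e%:E)%E]]] id.

Lemma measurable_image_transf (T : ergodic_transf) A :
  measurable A -> measurable (T @` A).
Proof. case: T => T /= [_ _ imT _ _]; exact: imT. Qed.

Lemma measure_image_transf (T : ergodic_transf) A :
  measurable A -> mu (T @` A) = mu A.
Proof.
case: T => T /= [/bij_inj iT _ imT pT _] mA.
rewrite -(pT _ (imT _ mA)); congr (mu _).
by apply/seteqP; split=> [x [y Ay /iT <-]//|x Ax]; exists x.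
Qed.

Lemma measure_setY_triangle A B C : measurable A -> measurable B ->
  measurable C -> (mu (A `+` C) <= mu (A `+` B) + mu (B `+` C))%E.
Proof.
move=> mA mB mC.
have mY (D E : set X) : measurable D -> measurable E -> measurable (D `+` E).
  by move=> mD mE; apply: measurableU; exact: measurableD.
apply: (@le_trans _ _ (mu ((A `+` B) `|` (B `+` C)))); last first.
  by apply: measureU2; exact: mY.
apply: le_measure; rewrite ?inE//; [exact: mY|apply: measurableU; exact: mY|].
move=> x; rewrite /setY/=; have [Bx|Bx] := pselect (B x); tauto.
Qed.

Lemma repr_pi_ae (T : ergodic_transf) :
  {ae mu, forall x, repr (\pi_ergodic_class T)%qT x = T x}.
Proof.
have /eqquotP/asboolP := reprK (\pi_ergodic_class T)%qT.
by [].
Qed.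

Lemma weak_dev_pi A (T S : ergodic_transf) : measurable A ->
  weak_dev A (\pi_ergodic_class T)%qT (\pi_ergodic_class S)%qT =
  mu ((T @` A) `+` (S @` A)).
Proof.
have dev0 (U V : ergodic_transf) : measurable A ->
    {ae mu, forall x, U x = V x} -> mu ((U @` A) `+` (V @` A)) = 0%E.
  move=> mA [N [mN N0 UV]].
  have mUN := measurable_image_transf U mN.
  have mVN := measurable_image_transf V mN.
  have mUA := measurable_image_transf U mA.
  have mVA := measurable_image_transf V mA.
  apply: (@subset_measure0 _ _ _ mu _ ((U @` N) `|` (V @` N))) => //.
  - by apply: measurableU; exact: measurableD.
  - exact: measurableU.
  - move=> _ [[[x Ax <-]] nVA|[[x Ax <-]] nUA]; [left|right]; exists x => //;
      apply: UV => /= E; [apply: nVA|apply: nUA]; exists x => //.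
  - apply/eqP; rewrite eq_le measure_ge0 andbT.
    have U2 : (mu ((U @` N) `|` (V @` N)) <= mu (U @` N) + mu (V @` N))%E.
      exact: measureU2.
    by rewrite (le_trans U2)// !measure_image_transf// [mu N]N0 adde0.
move=> mA; rewrite /weak_dev.
set T' := repr _; set S' := repr _.
have mim (U : ergodic_transf) := measurable_image_transf U mA.
have devC (U V : ergodic_transf) : mu ((U @` A) `+` (V @` A)) = mu ((V @` A) `+` (U @` A)).
  by rewrite setYC.
have TT : mu ((T' @` A) `+` (T @` A)) = 0%E by apply: dev0 => //; exact: repr_pi_ae.
have SS : mu ((S' @` A) `+` (S @` A)) = 0%E by apply: dev0 => //; exact: repr_pi_ae.
have tri (U V W Z : ergodic_transf) : mu ((U @` A) `+` (V @` A)) = 0%E ->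
    mu ((W @` A) `+` (Z @` A)) = 0%E ->
    (mu ((U @` A) `+` (W @` A)) <= mu ((V @` A) `+` (Z @` A)))%E.
  move=> UV WZ.
  apply: le_trans (measure_setY_triangle (mim U) (mim V) (mim W)) _.
  rewrite UV add0e.
  apply: le_trans (measure_setY_triangle (mim V) (mim Z) (mim W)) _.
  by rewrite (devC Z) WZ adde0.
by apply/eqP; rewrite eq_le !tri// devC.
Qed.

Lemma weak_dev_fin A (T S : ergodic_class) : measurable A ->
  weak_dev A T S \is a fin_num.
Proof.
move=> mA; apply: fin_num_measure.
by apply: measurableU; apply: measurableD; exact: measurable_image_transf.
Qed.

Lemma weak_cvgP (T_ : nat -> ergodic_class) (T : ergodic_class) :
  T_ @ \oo --> T <->
  forall A, measurable A -> weak_dev A (T_ n) T @[n --> \oo] --> 0%E.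
Proof.
have dev0P A : measurable A -> (weak_dev A (T_ n) T @[n --> \oo] --> 0%E) <->
    (forall e : R, 0 < e -> \forall n \near \oo,
      (weak_dev A (T_ n) T < e%:E)%E).
  move=> mA; have fin n := weak_dev_fin (T_ n) T mA.
  have normE n e : (`|fine (weak_dev A (T_ n) T)| < e) =
      (weak_dev A (T_ n) T < e%:E)%E.
    by rewrite ger0_norm ?fine_ge0 ?measure_ge0// -lte_fin fineK.
  split=> [/fine_cvgP[_ /cvgr0Pnorm_lt cv] e e0|cv].
    by move: (cv e e0); apply: filterS => n /=; rewrite normE.
  apply/fine_cvgP; split; first by near=> n; exact: fin.
  by apply/cvgr0Pnorm_lt => e e0; move: (cv e e0); apply: filterS => n /=; rewrite normE.
split=> [cv A mA|cv].
  apply/dev0P => // e e0.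
  have : nbhs T [set S | (weak_dev A S T < e%:E)%E]; last exact: cv.
  rewrite nbhsE; exists [set S | (weak_dev A S T < e%:E)%E] => //.
  split; last first.
    rewrite /= /weak_dev setYK measure0 lte_fin//.
  exists [set [set S | (weak_dev A S T < e%:E)%E]]; last by rewrite bigcup_set1.
  move=> _ ->; exists [fset [set S | (weak_dev A S T < e%:E)%E]]%fset.
    by move=> U /fset1P ->; rewrite inE; exists T, A, e.
  by apply/seteqP; split=> [S /(_ _ (fset11 _))//|S dS U /= /fset1P ->].
move=> B; rewrite nbhsE => -[_ [[C sC <-] [U CU UT]] CB].
rewrite nbhs_filterE; apply: filterS CB _.
apply: (@filterS _ _ _ U); first by move=> S US; exists U.
have /sC[D sD DU] := CU; rewrite -DU; apply: filter_bigI => V VD.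
have := sD _ VD; rewrite inE => -[S [A [e [mA e0 VE]]]].
have dT : (weak_dev A T S < e%:E)%E.
  by have := UT; rewrite -DU => /(_ _ VD); rewrite VE.
have finTS := weak_dev_fin T S mA.
have r0 : 0 < e - fine (weak_dev A T S).
  by rewrite subr_gt0 -lte_fin fineK.
rewrite VE /=; have := (dev0P _ mA).1 (cv _ mA) _ r0.
apply: filterS => n /=; rewrite EFinB fineK// => dn.
apply: le_lt_trans (_ : _ <= weak_dev A (T_ n) T + weak_dev A T S)%E _.
  by apply: measure_setY_triangle; exact: measurable_image_transf.
by rewrite -lteBrDr.
Unshelve. all: by end_near. Qed.

End ergodic_transformations.

Definition nowhere_dense (E : topologicalType) (A : set E) : Prop :=
  interior (closure A) = set0.

Definition meager (E : topologicalType) (A : set E) : Prop :=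
  exists F : nat -> set E,
    (forall n, nowhere_dense (F n)) /\ A `<=` \bigcup_n F n.

Definition coboundary (R : realType) (d : measure_display)
    (X : measurableType d) (mu : probability X R) (f : X -> R)
    (T : X -> X) : Prop :=
  exists g : X -> R, measurable_fun setT g /\
    {ae mu, forall x, f x = g x - g (T x)}.

Lemma coboundary_pi (R : realType) (d : measure_display)
    (X : measurableType d) (mu : probability X R) (f : X -> R)
    (T : ergodic_transf mu) :
  coboundary mu f (repr (\pi_(ergodic_class mu) T)%qT) <-> coboundary mu f T.
Proof.
by split=> -[g [mg fg]]; exists g; split=> //;
  apply: filterS2 fg (repr_pi_ae T) => x -> ->.
Qed.

(* Main.v *)
(** Fix an ergodic map [S] (an irrational rotation transported to [X]) and work
    with the maps that act along its orbits.

    (2) If [f = g - g \o T], truncating [g] shows that the positive and the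
    negative part of [f] have the same integral.  Conversely, when the integrals
    agree, [f] splits into bounded pieces of mean zero, and repeatedly swapping
    sets where [f] is positive with sets where it is negative groups almost all
    points into finite cycles on which the sums of [f] are as small as wanted.
    Refine this: join neighbouring base points of the cycles into longer cycles,
    make the new sums tiny, and reorder each cycle greedily so that its partial
    sums never exceed the previous bound.  The transfer functions then converge
    uniformly, the bases have summable measures so that the cyclic maps converge
    almost everywhere, and since [x] and [S x] eventually lie in one cycle the
    limit map is ergodic because [S] is.

    (1) The Birkhoff sums of a coboundary are tight uniformly in time, and
    tightness passes to weak limits up to constants.  If tightness held on an
    open set around [T], it would hold for [T] and for a conjugate [V T V] by a
    small involution [V] exchanging points with small values of [f] in an almost
    invariant set [G] with points with large values off [G].  But then the sums
    of [f \o V - f] drift along the orbits that stay in [G], or off [G]. *)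

Require Import Defs.
From mathcomp Require Import finmap.
From mathcomp Require Import all_boot all_order all_algebra generic_quotient.
From mathcomp Require Import all_classical all_reals all_analysis.
From mathcomp Require Import measurable_realfun.
From mathcomp Require Import ring lra zify.

Set Implicit Arguments.
Unset Strict Implicit.
Unset Printing Implicit Defensive.

Import Order.TTheory GRing.Theory Num.Theory.
Import numFieldNormedType.Exports.

Local Open Scope classical_set_scope.
Local Open Scope ring_scope.

(** * Countably valued functions and piecewise powers *)

(** Every map of part (2) is built inside the full group of [S]: a bijection that moves points along
    orbits of [S] by measurably chosen powers preserves [mu], and any exceptional null set can be
    enlarged to one invariant under all these maps at once.

    The obstacle is the size of the transfer functions. Reducing the sums over cycles gives no
    control of them, as the cycles become arbitrarily long. The reduction is therefore used only for
    its cycles and their totals, and its transfer function is thrown away; reordering needs nothing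
    but small terms and small totals, and supplies a new transfer function with the bound of the
    previous stage.

    The isomorphism with the interval also yields an atomless function [phi]. It slices functions at
    prescribed masses and produces sets of small positive measure.

    In part (1) the tail probabilities are 1/64 for a coboundary, 1/32 after passing to the closure
    and 1/16 for a difference of two sums, against a drift of probability more than 1/8. A constant
    [f] has no two levels to exchange and is treated apart. *)

Section discrete_measurability.
Context {d : measure_display} {X : measurableType d}.

(* Measurability into the discrete space [I]. *)
Definition dmeas (I : Type) (u : X -> I) := forall i, measurable (u @^-1` [set i]).

Lemma measurable_cases (I : countType) (u : X -> I) (P : I -> set X) :
  dmeas u -> (forall i, measurable (P i)) -> measurable [set x | P (u x) x].
Proof.
move=> mu mP.
have -> : [set x | P (u x) x] =
    \bigcup_n (if unpickle n is Some i then u @^-1` [set i] `&` P i else set0).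
  apply/seteqP; split=> x /=.
    by move=> Px; exists (pickle (u x)) => //; rewrite pickleK.
  by case=> n _; case: (unpickle n) => [i|//] [/= -> ].
apply: bigcupT_measurable => n.
by case: (unpickle n) => [i|//]; exact: measurableI.
Qed.

Lemma dmeas_preimage (I : countType) (u : X -> I) (A : set I) :
  dmeas u -> measurable (u @^-1` A).
Proof.
move=> mu; apply: (measurable_cases (P := fun i => [set _ : X | A i])) => // i.
have [Ai|Ai] := pselect (A i).
  by rewrite (_ : mkset _ = setT)//; apply/seteqP; split.
by rewrite (_ : mkset _ = set0)//; apply/seteqP; split.
Qed.

Lemma dmeas_cases (I J : countType) (u : X -> I) (v : I -> X -> J) :
  dmeas u -> (forall i, dmeas (v i)) -> dmeas (fun x => v (u x) x).
Proof. by move=> mu mv j; exact: (measurable_cases (P := fun i => v i @^-1` [set j]) mu (fun i => mv i j)). Qed.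

Lemma dmeas_cst (I : Type) (i : I) : dmeas (fun=> i).
Proof.
move=> j; have [<-|ij] := pselect (i = j).
  by rewrite (_ : _ @^-1` _ = setT)//; apply/seteqP; split.
by rewrite (_ : _ @^-1` _ = set0)//; apply/seteqP; split.
Qed.

Lemma dmeas_comp (I J : countType) (u : X -> I) (f : I -> J) :
  dmeas u -> dmeas (f \o u).
Proof. by move=> mu; exact: (@dmeas_cases I J u (fun i _ => f i) mu (fun i => dmeas_cst (f i))). Qed.

Lemma dmeas_comp2 (I J K : countType) (u : X -> I) (v : X -> J) (f : I -> J -> K) :
  dmeas u -> dmeas v -> dmeas (fun x => f (u x) (v x)).
Proof. by move=> mu mv; exact: (dmeas_cases (v := fun i x => f i (v x)) mu (fun i => dmeas_comp (f i) mv)). Qed.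

Lemma dmeas_bool (P : X -> Prop) : measurable [set x | P x] -> dmeas (fun x => `[< P x >]).
Proof.
move=> mP [].
  by rewrite (_ : _ @^-1` _ = [set x | P x])//; apply/seteqP; split => x /= /asboolP.
rewrite (_ : _ @^-1` _ = ~` [set x | P x]); first exact: measurableC.
by apply/seteqP; split => x /= H; [exact/asboolPn/negbT|exact/negbTE/asboolPn].
Qed.

Lemma measurable_fun_cases d' (Y : measurableType d') (I : countType) (u : X -> I)
    (F : I -> X -> Y) : dmeas u -> (forall i, measurable_fun setT (F i)) ->
  measurable_fun setT (fun x => F (u x) x).
Proof.
move=> mu mF _ B mB; rewrite setTI.
apply: (measurable_cases (P := fun i => F i @^-1` B)) => // i.
by rewrite -[X in measurable X]setTI; exact: mF.
Qed.

(* The value is 0 when no [k] satisfies [P k x]. *)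
Definition least (P : nat -> set X) (x : X) : nat :=
  if pselect (exists k, `[< P k x >]) is left e then ex_minn e else 0.

Lemma leastP (P : nat -> set X) x : (exists k, P k x) ->
  P (least P x) x /\ forall k, P k x -> (least P x <= k)%N.
Proof.
move=> [k Pk]; rewrite /least; case: pselect => [e|[]]; last by exists k; exact/asboolP.
by case: ex_minnP => m /asboolP Pm mP; split=> // j /asboolP; exact: mP.
Qed.

Lemma measurable_exists_nat (P : nat -> set X) :
  (forall k, measurable (P k)) -> measurable [set x | exists k, P k x].
Proof.
move=> mP; rewrite (_ : [set _ | _] = \bigcup_k P k); first exact: bigcupT_measurable.
by apply/seteqP; split=> [x [k Pk]|x [k _ Pk]]; exists k.
Qed.

Lemma measurable_forall_nat (P : nat -> set X) :
  (forall k, measurable (P k)) -> measurable [set x | forall k, P k x].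
Proof.
move=> mP; rewrite (_ : [set _ | _] = \bigcap_k P k); first exact: bigcapT_measurable.
by apply/seteqP; split=> [x Px k _|x Px k]; exact: Px.
Qed.

Lemma measurable_prop_and (p : Prop) (A : set X) :
  measurable A -> measurable [set x | p /\ A x].
Proof.
move=> mA; have [pp|np] := pselect p.
  by rewrite (_ : [set _ | _] = A)//; apply/seteqP; split=> x //= [].
by rewrite (_ : [set _ | _] = set0)//; apply/seteqP; split=> x //= [].
Qed.

Lemma measurable_prop_imp (p : Prop) (A : set X) :
  measurable A -> measurable [set x | p -> A x].
Proof.
move=> mA; have [pp|np] := pselect p.
  by rewrite (_ : [set _ | _] = A)//; apply/seteqP; split=> x //=; tauto.
by rewrite (_ : [set _ | _] = setT)//; apply/seteqP; split=> x //=; tauto.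
Qed.

Lemma dmeas_least (P : nat -> set X) :
  (forall k, measurable (P k)) -> dmeas (least P).
Proof.
move=> mP k.
rewrite (_ : _ @^-1` _ = ([set x | P k x] `&` [set x | forall j, (j < k)%N -> ~ P j x])
  `|` [set x | (k = 0)%N /\ ~ exists j, P j x]).
  apply: measurableU.
    apply: measurableI; first exact: mP.
    apply: (measurable_forall_nat (P := fun j => [set x | (j < k)%N -> ~ P j x])) => j.
    exact: (measurable_prop_imp (j < k)%N (measurableC (mP j))).
  exact: (measurable_prop_and _ (measurableC (measurable_exists_nat mP))).
apply/seteqP; split=> [x /= <-|x /= [[Pk mk]|[-> nP]]].
- have [e|e] := pselect (exists j, P j x).
    left; have [? mn] := leastP e; split=> // j.
    by rewrite ltnNge => /negP jk /mn.
  right; split=> //; rewrite /least; case: pselect => // e'; case: e.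
  by case: e' => j /asboolP Pj; exists j.
- have [Pl ml] := leastP (ex_intro _ k Pk).
  apply/eqP; rewrite eqn_leq ml//= leqNgt; apply/negP => /mk; exact.
- by rewrite /least; case: pselect => // e; case: nP; case: e => j /asboolP Pj; exists j.
Qed.

End discrete_measurability.

(** * Powers of an ergodic map and its full group *)

Section full_group.
Context {R : realType} {d : measure_display} {X : measurableType d}.
Variables (mu : probability X R) (S Sinv : X -> X).
Hypotheses (SK : cancel S Sinv) (SinvK : cancel Sinv S).
Hypothesis eS : ergodic_invertible mu S.

Lemma probability_setD A B : measurable A -> measurable B -> B `<=` A ->
  mu (A `\` B) = (mu A - mu B)%E.
Proof.
move=> mA mB BA; rewrite -[in RHS](setIidr BA); apply: measureD => //.
by rewrite ltey_eq fin_num_measure.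
Qed.

Lemma probability_setD0 A B : measurable A -> measurable B -> mu B = 0%E ->
  mu (A `\` B) = mu A.
Proof.
move=> mA mB B0; apply/eqP; rewrite eq_le; apply/andP; split.
  by apply: le_measure; rewrite ?inE//; exact: measurableD.
apply: le_trans (_ : _ <= mu ((A `\` B) `|` B))%E _.
  apply: le_measure; rewrite ?inE//; first by apply: measurableU => //; exact: measurableD.
  by move=> x Ax; have [Bx|Bx] := pselect (B x); [right|left].
by rewrite measureU0//; exact: measurableD.
Qed.

Lemma probability_setU0 A B : measurable A -> measurable B -> mu B = 0%E ->
  mu (A `|` B) = mu A.
Proof. exact: measureU0. Qed.

Lemma probability_le A B : measurable A -> measurable B -> A `<=` B -> (mu A <= mu B)%E.
Proof. by move=> mA mB; apply: le_measure; rewrite inE. Qed.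

Lemma probability_to0 (A : nat -> set X) (e : R) : (forall n, measurable (A n)) ->
  (forall n m, (n <= m)%N -> A m `<=` A n) -> mu (\bigcap_n A n) = 0%E -> 0 < e ->
  exists N, forall n, (N <= n)%N -> (mu (A n) <= e%:E)%E.
Proof.
move=> mA nA A0 e0.
have mAI : measurable (\bigcap_n A n) by exact: bigcapT_measurable.
have cv : mu (A n) @[n --> \oo] --> mu (\bigcap_n A n).
  apply: nonincreasing_cvg_mu => //; first by rewrite ltey_eq fin_num_measure.
  by move=> n m nm; apply/subsetPset; exact: nA.
move: cv; rewrite A0 => /fine_cvgP[_ /cvgrPdist_le /(_ e e0)[N _ H]].
exists N => n /H; rewrite /= sub0r normrN => {}H.
rewrite -[X in (X <= _)%E]fineK ?fin_num_measure//.
by rewrite lee_fin; apply: le_trans H; exact: ler_norm.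
Qed.

Definition zit (n : int) : X -> X :=
  match n with Posz k => iter k S | Negz k => iter k.+1 Sinv end.

Lemma zit0 x : zit 0 x = x. Proof. by []. Qed.

Lemma zit1 n x : zit (1 + n) x = S (zit n x).
Proof.
case: n => [n|[|n]].
- by [].
- by rewrite /= SinvK.
- by rewrite (_ : 1 + Negz n.+1 = Negz n) /= ?SinvK//; lia.
Qed.

Lemma zitN1 n x : zit (-1 + n) x = Sinv (zit n x).
Proof.
case: n => [[|n]|n].
- by [].
- by rewrite (_ : -1 + Posz n.+1 = Posz n) /= ?SK//; lia.
- by rewrite (_ : -1 + Negz n = Negz n.+1)//; lia.
Qed.

Lemma zitD m n x : zit (m + n) x = zit m (zit n x).
Proof.
elim/int_rec: m => [|m IH|m IH]; first by rewrite add0r.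
- by rewrite -addn1 PoszD (addrC (Posz m)) -addrA zit1 IH -zit1.
- by rewrite -addn1 PoszD opprD (addrC (- Posz m)) -addrA zitN1 IH -zitN1.
Qed.

Lemma zitK n : cancel (zit n) (zit (- n)).
Proof. by move=> x; rewrite -zitD addNr. Qed.

Lemma zitNK n : cancel (zit (- n)) (zit n).
Proof. by move=> x; rewrite -zitD addrN. Qed.

Lemma measurable_preimage_S A : measurable A -> measurable (S @^-1` A).
Proof. by move=> mA; rewrite -[X in measurable X]setTI; exact: (ei_measurable eS). Qed.

Lemma preimage_Sinv A : Sinv @^-1` A = S @` A.
Proof.
apply/seteqP; split=> [x /= Ax|_ [x Ax <-]]; last by rewrite /= SK.
by exists (Sinv x).
Qed.

Lemma measurable_preimage_Sinv A : measurable A -> measurable (Sinv @^-1` A).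
Proof. by rewrite preimage_Sinv; exact: (ei_image_measurable eS). Qed.

Lemma measure_preimage_Sinv A : measurable A -> mu (Sinv @^-1` A) = mu A.
Proof.
move=> mA; rewrite -(ei_preserving eS (measurable_preimage_Sinv mA)).
by congr (mu _); apply/seteqP; split=> x /=; rewrite SK.
Qed.

Lemma zit_preimage n A : measurable A ->
  measurable (zit n @^-1` A) /\ mu (zit n @^-1` A) = mu A.
Proof.
move=> mA; case: n => n /=.
  elim: n => [|n [mI I]]; first by split.
  rewrite (_ : iter n.+1 S @^-1` A = S @^-1` (iter n S @^-1` A)).
    by split; [exact: measurable_preimage_S|rewrite (ei_preserving eS)].
  by apply/seteqP; split=> x /=; rewrite -iterSr.
elim: n.+1 => [|m [mI I]]; first by split.
rewrite (_ : iter m.+1 Sinv @^-1` A = Sinv @^-1` (iter m Sinv @^-1` A)).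
  by split; [exact: measurable_preimage_Sinv|rewrite measure_preimage_Sinv].
by apply/seteqP; split=> x /=; rewrite -iterSr.
Qed.

Lemma zit_image n A : zit n @` A = zit (- n) @^-1` A.
Proof.
apply/seteqP; split=> [_ [x Ax <-]|x /= Ax]; first by rewrite /= zitK.
by exists (zit (- n) x) => //; rewrite zitNK.
Qed.

(* Maps acting along the orbits of [S]; the bijective ones form the full group. *)
Definition PW (u : X -> X) := exists n : X -> int, dmeas n /\ forall x, u x = zit (n x) x.

Lemma PW_zit n : PW (zit n).
Proof. by exists (fun=> n); split=> //; exact: dmeas_cst. Qed.

Lemma PW_id : PW id. Proof. exact: (PW_zit 0). Qed.

Lemma PW_preimage u A : PW u -> measurable A -> measurable (u @^-1` A).
Proof.
move=> [n [mn un]] mA; rewrite (_ : _ @^-1` _ = [set x | A (zit (n x) x)]).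
  by apply: (measurable_cases (P := fun k => zit k @^-1` A)) => // k; exact: (zit_preimage _ mA).1.
by apply/seteqP; split=> x /=; rewrite un.
Qed.

Lemma PW_fun u : PW u -> measurable_fun setT u.
Proof. by move=> Pu _ A mA; rewrite setTI; exact: PW_preimage. Qed.

Lemma PW_dmeas (I : Type) (v : X -> I) u : PW u -> dmeas v -> dmeas (v \o u).
Proof. by move=> Pu mv i; rewrite comp_preimage; exact: PW_preimage. Qed.

Lemma PW_comp u v : PW u -> PW v -> PW (u \o v).
Proof.
move=> [n [mn un]] Pv; have [m [mm vm]] := Pv.
exists (fun x => n (v x) + m x); split.
  exact: (dmeas_comp2 (fun i j : int => i + j) (PW_dmeas Pv mn) mm).
by move=> x /=; rewrite un vm zitD.
Qed.

Lemma PW_cases (I : countType) (j : X -> I) (u : I -> X -> X) :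
  dmeas j -> (forall i, PW (u i)) -> PW (fun x => u (j x) x).
Proof.
move=> mj /choice[n Pn]; exists (fun x => n (j x) x); split.
  by apply: (dmeas_cases mj) => i; have [] := Pn i.
by move=> x; have [_ ->] := Pn (j x).
Qed.

Lemma PW_iter k u : PW u -> PW (iter k u).
Proof. by move=> Pu; elim: k => [|k IH]; [exact: PW_id|exact: (PW_comp Pu IH)]. Qed.

(** Cut [A] by the value of the exponent: on each piece [u] is a single power of [S], and
    injectivity on [A] keeps the images of the pieces disjoint. *)
Lemma PW_image u A : PW u -> measurable A -> {in A &, injective u} ->
  measurable (u @` A) /\ mu (u @` A) = mu A.
Proof.
move=> [n [mn un]] mA ui.
pose B k := A `&` (pickle \o n) @^-1` [set k].
have mB k : measurable (B k).
  by apply: measurableI => //; apply: (dmeas_comp (J := nat)).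
have AB : A = \bigcup_k B k.
  by apply/seteqP; split=> [x Ax|x [k _ []]//]; exists (pickle (n x)).
have tB : trivIset setT B.
  by move=> i j _ _ [x [[_ /= <-] [_ /= <-]]].
pose z k : int := odflt 0 (unpickle k).
have uz k x : B k x -> u x = zit (z k) x.
  by move=> [_ /= <-]; rewrite un /z pickleK.
have uB k : u @` (B k) = zit (- z k) @^-1` B k.
  rewrite -zit_image; apply/seteqP; split=> [_ [x Bx <-]|_ [x Bx <-]]; exists x => //;
  by rewrite (uz k).
have uA : u @` A = \bigcup_k (u @` B k).
  by rewrite {1}AB image_bigcup.
have muB k : measurable (u @` B k) by rewrite uB; apply: (zit_preimage _ (mB k)).1.
split; first by rewrite uA; exact: bigcupT_measurable.
rewrite uA measure_bigcup//=; last first.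
  move=> i j _ _ [_ [[x Bx <-] [y By]]] /ui.
  rewrite !inE => E; have yx : y = x by apply: E; [case: By|case: Bx].
  by subst y; apply: tB => //; exists x.
rewrite [in RHS]AB measure_bigcup//=.
by apply: eq_eseriesr => k _; rewrite uB (zit_preimage _ (mB k)).2.
Qed.

Definition FG (V : X -> X) := bijective V /\ PW V.

Lemma FG_id : FG id. Proof. by split; [exists id|exact: PW_id]. Qed.

Lemma FG_comp V W : FG V -> FG W -> FG (V \o W).
Proof. by move=> [bV pV] [bW pW]; split; [exact: bij_comp|exact: PW_comp]. Qed.

Lemma FG_inv V V' : FG V -> cancel V V' -> cancel V' V -> FG V'.
Proof.
move=> [bV [n [mn Vn]]] K K'; split; first by exists V.
exists (fun x => - n (V' x)); split; last first.
  by move=> x; have := zitK (n (V' x)) (V' x); rewrite -Vn K'.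
(* The exponent of [V'] is defined through [V'], not yet known to be measurable; where it equals
   [k], however, [V'] is [zit k], which removes [V'] from the description of the level set. *)
move=> k; rewrite (_ : _ @^-1` _ = zit k @^-1` (n @^-1` [set - k])).
  exact: (zit_preimage _ (mn _)).1.
apply/seteqP; split=> x /= E.
  by rewrite -E -{2}(K' x) Vn zitK opprK.
rewrite -(_ : zit k x = V' x) ?E ?opprK//; apply: (can_inj K).
by rewrite Vn E zitK K'.
Qed.

Lemma FG_preimage V A : FG V -> measurable A ->
  measurable (V @^-1` A) /\ mu (V @^-1` A) = mu A.
Proof.
move=> [bV pV] mA; have mVA := PW_preimage pV mA; split=> //.
have [_ <-] := PW_image pV mVA (in2W (bij_inj bV)).
congr (mu _); apply/seteqP; split=> [_ [x Ax <-]//|x Ax].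
by case: bV => V' K K'; exists (V' x) => //=; rewrite K'.
Qed.

Lemma FG_image V A : FG V -> measurable A ->
  measurable (V @` A) /\ mu (V @` A) = mu A.
Proof. by move=> [bV pV] mA; exact: (PW_image pV mA (in2W (bij_inj bV))). Qed.

(** The union of the preimages under the countably many powers of [S] is still null. Off it, a
    property true almost everywhere holds along the whole orbit, hence also after any piecewise
    power. *)
Lemma null_invariant (N : set X) : mu.-negligible N ->
  exists M, [/\ measurable M, mu M = 0%E, N `<=` M & forall n x, M (zit n x) <-> M x].
Proof.
move=> [N' [mN' N'0 NN']].
pose M := [set x | exists k, N' (zit (odflt 0 (unpickle k : option int)) x)].
have ME x : M x <-> exists n : int, N' (zit n x).
  split=> [[k Nk]|[n Nn]]; first by eexists; exact: Nk.
  by exists (pickle n); rewrite pickleK.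
exists M; split.
- by apply: measurable_exists_nat => k; exact: (zit_preimage _ mN').1.
- apply/negligibleP; first by apply: measurable_exists_nat => k; exact: (zit_preimage _ mN').1.
  apply: (@negligibleS _ _ _ _ (\bigcup_k (zit (odflt 0 (unpickle k : option int)) @^-1` N'))).
    by move=> x [k Nk]; exists k.
  apply: negligible_bigcup => k; apply/negligibleP; first exact: (zit_preimage _ mN').1.
  by rewrite -N'0; exact: (zit_preimage _ mN').2.
- by move=> x /NN' N'x; apply/ME; exists 0.
- move=> n x; split=> /ME[m Nm]; apply/ME.
    by exists (m + n); rewrite zitD.
  by exists (m - n); rewrite zitD zitK.
Qed.

(** Ergodicity is stated for strictly invariant sets; removing an invariant null set turns
    invariance almost everywhere into strict invariance. *)
Lemma ergodic_ae A : measurable A -> {ae mu, forall x, A (S x) <-> A x} ->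
  mu A = 0%E \/ mu A = 1%E.
Proof.
move=> mA /null_invariant[M [mM M0 NM iM]].
have mB : measurable (A `\` M) by exact: measurableD.
rewrite -(probability_setD0 mA mM M0).
have iS x : M (S x) <-> M x := iM 1 x.
apply: (ei_ergodic eS mB); apply/seteqP; split=> x /= [Ax Mx].
  split; last by rewrite -iS.
  by apply: contrapT => nA; apply: Mx; apply/iS; apply: NM => /= E; apply: nA; exact/E.
split; last by rewrite iS.
by apply: contrapT => nA; apply: Mx; apply: NM => /= E; apply: nA; exact/E.
Qed.

(** The set [U] of points with a visit at a time in the direction [s] contains its own preimage
    under [zit s], of equal measure, so it is invariant almost everywhere; containing [A], it is
    conull. Invariance of [M] then allows an arbitrary starting time [k]. *)
Lemma ergodic_visit A : measurable A -> (0 < mu A)%E ->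
  exists M, [/\ measurable M, mu M = 0%E, (forall n x, M (zit n x) <-> M x) &
    forall x, ~ M x -> forall k : int,
      (exists n, A (zit (k + Posz n) x)) /\ (exists n, A (zit (k - Posz n) x))].
Proof.
move=> mA A0.
have key s : (s = 1 \/ s = -1 :> int) ->
    mu.-negligible [set x | ~ exists n : nat, A (zit (s * Posz n) x)].
  move=> s1.
  pose U := [set x | exists n : nat, A (zit (s * Posz n) x)].
  have mU : measurable U.
    by apply: measurable_exists_nat => n; exact: (zit_preimage _ mA).1.
  have subU : zit s @^-1` U `<=` U.
    by move=> x /= [n An]; exists n.+1; rewrite -addn1 PoszD mulrDr mulr1 zitD.
  have mV := zit_preimage s mU.
  have D0 : mu (U `\` zit s @^-1` U) = 0%E.
    by rewrite (probability_setD mU mV.1 subU) mV.2 subee// fin_num_measure.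
  have ae : {ae mu, forall x, U (S x) <-> U x}.
    case: s1 => s1.
      exists (U `\` zit s @^-1` U); split=> //; first by apply: measurableD => //; exact: mV.1.
      move=> x /= nE; subst s; apply: contrapT => nx; apply: nE; split=> Ux.
        exact: subU.
      by apply: contrapT => nU; apply: nx; split.
    have mW := zit_preimage 1 (measurableD mU mV.1).
    exists (zit 1 @^-1` (U `\` zit s @^-1` U)); split => //; first exact: mW.1.
      by rewrite mW.2.
    move=> x /= nE; subst s; apply: contrapT => nx; apply: nE; split=> Ux.
      by apply: contrapT => nU; apply: nx; split=> //=; rewrite SK.
    by apply: subU; rewrite /= SK.
  have [U0|U1] := ergodic_ae mU ae.
    have : (mu A <= mu U)%E.
      by apply: le_measure; rewrite ?inE// => x Ax; exists 0; rewrite mulr0.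
    by rewrite U0 leNgt A0.
  exists (~` U); split=> //; first exact: measurableC.
  by rewrite probability_setC// U1 subee.
have /null_invariant[M1 [mM1 M10 NM1 iM1]] := key 1 (or_introl erefl).
have /null_invariant[M2 [mM2 M20 NM2 iM2]] := key (-1) (or_intror erefl).
exists (M1 `|` M2); split.
- exact: measurableU.
- by rewrite measureU0.
- by move=> n x /=; rewrite iM1 iM2.
- move=> x /not_orP[n1 n2] k; split.
    have : ~ M1 (zit k x) by rewrite iM1.
    move=> nM; apply: contrapT => ne; apply: nM; apply: NM1 => -[n].
    by rewrite -zitD mul1r => An; apply: ne; exists n; rewrite addrC.
  have : ~ M2 (zit k x) by rewrite iM2.
  move=> nM; apply: contrapT => ne; apply: nM; apply: NM2 => -[n].
  by rewrite -zitD mulN1r => An; apply: ne; exists n; rewrite addrC.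
Qed.

(** * Balanced functions and coboundaries *)

Definition ipos (h : X -> R) : \bar R := \int[mu]_x (Num.max (h x) 0)%:E.

(** The integral condition of part (2): comparing two extended integrals instead of taking a
    difference admits the value [+oo] on both sides and makes the notion symmetric under a change of
    sign. *)
Definition balanced (h : X -> R) := ipos h = ipos (\- h).

Lemma max_pos_neg (a : R) : Num.max a 0 = Num.max (- a) 0 + a.
Proof. by rewrite /Num.max; do !case: ifPn => ?; lra. Qed.

Lemma integral_const (r : R) : (\int[mu]_x r%:E = r%:E)%E.
Proof.
have := @integral_cst _ _ _ mu setT measurableT r%:E.
by rewrite [X in (_ * X)%E](_ : _ = 1%E) ?mule1//; exact: probability_setT.
Qed.

Lemma measurable_pos (h : X -> R) : measurable_fun setT h ->
  measurable_fun setT (fun x => (Num.max (h x) 0)%:E).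
Proof. by move=> mh; apply/measurable_EFinP; apply: measurable_funrpos. Qed.

Lemma ipos_ge0 h : (0 <= ipos h)%E.
Proof. by apply: integral_ge0 => x _; rewrite lee_fin le_max lexx orbT. Qed.

Lemma ge0_integral_preserving (T : X -> X) (u : X -> \bar R) :
  measurable_fun setT T -> (forall A, measurable A -> mu (T @^-1` A) = mu A) ->
  measurable_fun setT u -> (forall x, 0 <= u x)%E ->
  (\int[mu]_x u (T x) = \int[mu]_x u x)%E.
Proof.
move=> mT pT mu0 u0.
have := @ge0_integral_pushforward _ _ _ _ R T mT mu setT u measurableT mu0.
rewrite preimage_setT => <-; last by move=> y _.
by apply: eq_measure_integral => A mA _; exact: pT.
Qed.

Definition clamp (a y : R) : R := Num.max (- a) (Num.min y a).

Lemma clampP (y a : R) : 0 <= a ->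
  [\/ y <= - a /\ clamp a y = - a, [/\ - a <= y, y <= a & clamp a y = y] |
      a <= y /\ clamp a y = a].
Proof.
move=> a0; rewrite /clamp.
have [ya|/ltW ay] := leP y a; last by constructor 3; split=> //; rewrite max_r//; lra.
by have [ay|/ltW ya'] := leP (- a) y; [constructor 2|constructor 1].
Qed.

Lemma clamp_homo (a u v : R) : 0 <= a -> v <= u -> clamp a v <= clamp a u.
Proof.
move=> a0 vu; move: (clampP u a0) (clampP v a0).
by do 2!case=> [[? ->]|[? ? ->]|[? ->]]; lra.
Qed.

Lemma clamp_sub (a b u v : R) : 0 <= a -> a <= b -> v <= u ->
  clamp a u - clamp a v <= clamp b u - clamp b v.
Proof.
move=> a0 ab vu; have b0 := le_trans a0 ab.
move: (clampP u a0) (clampP v a0) (clampP u b0) (clampP v b0).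
by do 4!case=> [[? ->]|[? ? ->]|[? ->]]; lra.
Qed.

(* Truncating the transfer function at height [k] makes both sides of the
   coboundary equation integrable, and the truncated increments of [c] grow
   with [k], so monotone convergence applies to both parts. *)
Lemma coboundary_balanced (T : X -> X) (c : X -> R) :
  measurable_fun setT T -> (forall A, measurable A -> mu (T @^-1` A) = mu A) ->
  measurable_fun setT c -> balanced (fun x => c x - c (T x)).
Proof.
move=> mT pT mc.
pose t (k : nat) := clamp k%:R.
have tb k y : - k%:R <= t k y <= k%:R.
  rewrite /t /clamp le_max lexx /= ge_max ge_min lexx orbT andbT.
  by rewrite (@le_trans _ _ 0)// oppr_le0.
have mtc k : measurable_fun setT (t k \o c).
  by apply: measurable_maxr => //; apply: measurable_minr.
have mtcT k : measurable_fun setT (t k \o c \o T) by apply: measurableT_comp.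
pose p k x := t k (c x) - t k (c (T x)).
have mp k : measurable_fun setT (p k) by exact: (measurable_funB (mtc k) (mtcT k)).
have mtk k : measurable_fun setT (fun x => t k (c x) + k%:R).
  exact: (measurable_funD (mtc k) (measurable_cst _)).
have mtTk k : measurable_fun setT (fun x => t k (c (T x)) + k%:R).
  exact: (measurable_funD (mtcT k) (measurable_cst _)).
(* Shifted by [k], the truncations of [c] and of [c \o T] are nonnegative and bounded with the same
   integral, because [T] preserves [mu]; they are added on both sides and cancelled. *)
have bal k : ipos (p k) = ipos (\- (p k)).
  have E : (ipos (p k) + \int[mu]_x (t k (c (T x)) + k%:R)%:E =
            ipos (\- (p k))%R + \int[mu]_x (t k (c x) + k%:R)%:E)%E.
    rewrite -!ge0_integralD//.
    - apply: eq_integral => x _; rewrite -!EFinD; congr EFin.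
      by have := max_pos_neg (p k x); rewrite /p /= => ->; ring.
    - by move=> x _; rewrite lee_fin le_max lexx orbT.
    - by apply: measurable_pos; apply: measurableT_comp.
    - by move=> x _; rewrite lee_fin -lerBlDr sub0r; case/andP: (tb k (c x)).
    - by apply/measurable_EFinP.
    - by move=> x _; rewrite lee_fin le_max lexx orbT.
    - exact: measurable_pos.
    - by move=> x _; rewrite lee_fin -lerBlDr sub0r; case/andP: (tb k (c (T x))).
    - by apply/measurable_EFinP.
  have fin : (\int[mu]_x (t k (c x) + k%:R)%:E \is a fin_num)%E.
    rewrite ge0_fin_numE; last first.
      by apply: integral_ge0 => x _; rewrite lee_fin -lerBlDr sub0r; case/andP: (tb k (c x)).
    apply: (@le_lt_trans _ _ (\int[mu]_x (k%:R + k%:R)%:E)%E).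
      apply: ge0_le_integral => //.
      - by move=> x _; rewrite lee_fin -lerBlDr sub0r; case/andP: (tb k (c x)).
      - by apply/measurable_EFinP.
      - by move=> x _; rewrite lee_fin lerD2r; case/andP: (tb k (c x)).
    by rewrite integral_const ltry.
  move: E; rewrite (ge0_integral_preserving (u := fun x => (t k (c x) + k%:R)%:E) mT pT).
  - by move=> /eqP; rewrite eq_le => /andP[]; rewrite !leeD2rE// => *; apply/eqP; rewrite eq_le; apply/andP.
  - by apply/measurable_EFinP.
  - by move=> x; rewrite lee_fin -lerBlDr sub0r; case/andP: (tb k (c x)).
have tlim y : exists N, forall k, (N <= k)%N -> t k y = y.
  exists (Num.truncn `|y|).+1 => k Nk.
  have : `|y| < k%:R.
    by apply: lt_le_trans (truncnS_gt _) _; rewrite ler_nat.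
  by rewrite ltr_norml /t /clamp => /andP[y1 y2]; rewrite min_l ?max_r// ltW.
have thomo (s : R) (y z : R) : s = 1 \/ s = -1 ->
    {homo (fun k => Num.max (s * (t k y - t k z)) 0) : n m / (n <= m)%N >-> n <= m}.
  move=> s1 n m nm; rewrite /t.
  have nm' : n%:R <= m%:R :> R by rewrite ler_nat.
  rewrite ge_max !le_max lexx orbT andbT.
  have [zy|/ltW yz] := leP z y; case: s1 => ->; rewrite ?mul1r ?mulN1r ?opprB.
  - by rewrite clamp_sub.
  - by rewrite [X in _ || X]subr_le0 clamp_homo ?orbT.
  - by rewrite [X in _ || X]subr_le0 clamp_homo ?orbT.
  - by rewrite clamp_sub.
(* The sign [s] treats the positive and the negative part at once. *)
have conv (s : R) : s = 1 \/ s = -1 ->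
    ipos (fun x => s * p k x) @[k --> \oo] --> ipos (fun x => s * (c x - c (T x))).
  move=> s1.
  have ms k : measurable_fun setT (fun x => s * p k x) by apply: measurable_funM.
  have := @cvg_monotone_convergence _ _ _ mu setT measurableT
    (fun k x => (Num.max (s * p k x) 0)%:E) (fun k => measurable_pos (ms k)).
  rewrite (_ : (\int[mu]_x limn _)%E = ipos (fun x => s * (c x - c (T x)))).
    apply; first by move=> n x _; rewrite lee_fin le_max lexx orbT.
    by move=> x _ n m nm; rewrite lee_fin; exact: thomo.
  apply: eq_integral => x _; apply/cvg_lim => //; apply: cvg_near_cst.
  have [N1 H1] := tlim (c x); have [N2 H2] := tlim (c (T x)).
  exists (maxn N1 N2) => // k /=; rewrite geq_max => /andP[k1 k2].
  by rewrite /p H1// H2.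
have C1 := conv 1 (or_introl erefl); have C2 := conv (-1) (or_intror erefl).
rewrite /balanced.
have -> : ipos (fun x => c x - c (T x)) = ipos (fun x => 1 * (c x - c (T x))).
  by congr ipos; apply/funext => x; rewrite mul1r.
have -> : ipos (\- (fun x => c x - c (T x))) = ipos (fun x => -1 * (c x - c (T x))).
  by congr ipos; apply/funext => x; rewrite mulN1r.
apply: cvg_unique C1 _ => //.
rewrite (_ : (fun k => _) = (fun k => ipos (fun x => -1 * p k x)))//.
apply/funext => k; rewrite (_ : (fun x => 1 * p k x) = p k); last by apply/funext => x; rewrite mul1r.
by rewrite bal; congr ipos; apply/funext => x; rewrite mulN1r.
Qed.

(** A greedy matching along orbits: at step [n] every unmatched point of [A] whose image under
    [zit n] is an unmatched point of [B] is paired with that image, and [V] exchanges the partners.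
    Ergodicity excludes that both remainders have positive measure. *)
Lemma swap_exists (A B : set X) : measurable A -> measurable B -> A `&` B = set0 ->
  exists V A' B', [/\ FG V, (forall x, V (V x) = x),
    [/\ measurable A', measurable B', A' `<=` A & B' `<=` B],
    [/\ forall x, A' x -> B' (V x), forall x, B' x -> A' (V x) &
        forall x, ~ A' x -> ~ B' x -> V x = x] &
    mu (A `\` A') = 0%E \/ mu (B `\` B') = 0%E].
Proof.
move=> mA mB AB0.
pose step n (C : set X * set X) :=
  let P := C.1 `&` zit (Posz n) @^-1` C.2 in (C.1 `\` P, C.2 `\` zit (Posz n) @` P).
pose C := fix C n := if n is m.+1 then step m (C m) else (A, B).
pose P n := (C n).1 `&` zit (Posz n) @^-1` (C n).2.
pose Q n := zit (Posz n) @` P n.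
have C1S n : (C n.+1).1 = (C n).1 `\` P n by [].
have C2S n : (C n.+1).2 = (C n).2 `\` Q n by [].
have mCP n : [/\ measurable (C n).1, measurable (C n).2, measurable (P n) & measurable (Q n)].
  elim: n => [|n [m1 m2 mP mQ]].
    have mP : measurable (P 0%N) by apply: measurableI => //; exact: (zit_preimage _ mB).1.
    by split=> //; rewrite /Q zit_image; exact: (zit_preimage _ mP).1.
  have m1' : measurable (C n.+1).1 by rewrite C1S; exact: measurableD.
  have m2' : measurable (C n.+1).2 by rewrite C2S; exact: measurableD.
  have mP' : measurable (P n.+1) by apply: measurableI => //; exact: (zit_preimage _ m2').1.
  by split=> //; rewrite /Q zit_image; exact: (zit_preimage _ mP').1.
have C1anti m n : (m <= n)%N -> (C n).1 `<=` (C m).1.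
  elim: n => [|n IH]; first by rewrite leqn0 => /eqP ->.
  by rewrite leq_eqVlt => /predU1P[->//|/IH H]; rewrite C1S => x [/H].
have C2anti m n : (m <= n)%N -> (C n).2 `<=` (C m).2.
  elim: n => [|n IH]; first by rewrite leqn0 => /eqP ->.
  by rewrite leq_eqVlt => /predU1P[->//|/IH H]; rewrite C2S => x [/H].
have PC n : P n `<=` (C n).1 by move=> x [].
have QC n : Q n `<=` (C n).2 by move=> _ [x [_ Cx] <-].
have tP m n x : P m x -> P n x -> m = n.
  wlog mn : m n / (m < n)%N.
    move=> H Pm Pn; have [mn|nm|//] := ltngtP m n; first exact: H.
    by apply/esym; exact: H.
  by move=> Pm /PC /(C1anti _ _ mn); rewrite C1S => -[].
have tQ m n x : Q m x -> Q n x -> m = n.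
  wlog mn : m n / (m < n)%N.
    move=> H Pm Pn; have [mn|nm|//] := ltngtP m n; first exact: H.
    by apply/esym; exact: H.
  by move=> Pm /QC /(C2anti _ _ mn); rewrite C2S => -[].
pose A' := [set x | exists n, P n x]; pose B' := [set x | exists n, Q n x].
have mA' : measurable A' by apply: measurable_exists_nat => n; case: (mCP n).
have mB' : measurable B' by apply: measurable_exists_nat => n; case: (mCP n).
have A'A : A' `<=` A by move=> x [n /PC /(C1anti 0%N)]; exact.
have B'B : B' `<=` B by move=> x [n /QC /(C2anti 0%N)]; exact.
have A'B' x : A' x -> ~ B' x.
  by move=> /A'A Ax /B'B Bx; rewrite -[False]/(set0 x) -AB0.
pose V x := if `[< A' x >] then zit (Posz (least P x)) x
  else if `[< B' x >] then zit (- Posz (least Q x)) x else x.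
have VP n x : P n x -> V x = zit (Posz n) x.
  move=> Pn; have Ax : A' x by exists n.
  rewrite /V asboolT//; congr (zit (Posz _) _).
  by apply: tP Pn; exact: (leastP Ax).1.
have VQ n x : Q n x -> V x = zit (- Posz n) x.
  move=> Qn; have Bx : B' x by exists n.
  rewrite /V asboolF; last by move/A'B'.
  rewrite asboolT//; congr (zit (- Posz _) _).
  by apply: tQ Qn; exact: (leastP Bx).1.
have Vid x : ~ A' x -> ~ B' x -> V x = x by move=> nA nB; rewrite /V !asboolF.
have VV x : V (V x) = x.
  have [[n Pn]|nA] := pselect (A' x).
    rewrite (VP _ _ Pn) (VQ n) ?zitK//; by exists x.
  have [[n Qn]|nB] := pselect (B' x); last by rewrite !Vid.
  have [y Py yx] := Qn; rewrite (VQ _ _ Qn) -yx zitK (VP _ _ Py)//.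
exists V, A', B'; split=> //.
- split; first by exists V.
  apply: (PW_cases (u := fun b x => if b then _ else _) (dmeas_bool mA')) => -[].
    apply: (PW_cases (u := fun n x => zit (Posz n) x)) => [|n]; last exact: PW_zit.
    by apply: dmeas_least => n; case: (mCP n).
  apply: (PW_cases (u := fun b x => if b then _ else _) (dmeas_bool mB')) => -[]; last exact: PW_id.
  apply: (PW_cases (u := fun n x => zit (- Posz n) x)) => [|n]; last exact: PW_zit.
  by apply: dmeas_least => n; case: (mCP n).
- split=> //.
  + by move=> x [n Pn]; rewrite (VP _ _ Pn); exists n, x.
  + by move=> x [n Qn]; rewrite (VQ _ _ Qn); exists n; case: Qn => y Py <-; rewrite zitK.
- have mAA : measurable (A `\` A') by exact: measurableD.
  have mBB : measurable (B `\` B') by exact: measurableD.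
  have [->|/eqP] := eqVneq (mu (A `\` A')) 0%E; first by left.
  move=> A0; have [->|] := eqVneq (mu (B `\` B')) 0%E; first by right.
  (* Almost every leftover point of [A] reaches the leftover part of [B] at some time [n]; both
     points were still free at step [n], so they would have been paired then. *)
  rewrite -measure_gt0 => B0; exfalso.
  have [M [mM M0 _ vis]] := ergodic_visit mBB B0.
  apply: A0; apply: (@subset_measure0 _ _ _ mu _ M) => // x [Ax nA'x].
  apply: contrapT => nM; have [[n [Bn nB'n]] _] := vis x nM 0.
  rewrite add0r in Bn nB'n.
  have inA m : (C m).1 x.
    by elim: m => [//|m IH]; rewrite C1S; split=> // Pm; apply: nA'x; exists m.
  have inB m : (C m).2 (zit (Posz n) x).
    by elim: m => [//|m IH]; rewrite C2S; split=> // Pm; apply: nB'n; exists m.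
  by apply: nA'x; exists n; split; [exact: inA|exact: inB].
Qed.

Lemma ipos_fin_sub (u v : X -> R) : measurable_fun setT u -> measurable_fun setT v ->
  (forall x, 0 <= u x) -> (forall x, 0 <= v x) ->
  (\int[mu]_x (u x)%:E = \int[mu]_x (v x)%:E)%E -> (\int[mu]_x (u x)%:E < +oo)%E ->
  balanced (fun x => u x - v x).
Proof.
move=> mU mv u0 v0 uv fin.
have mw : measurable_fun setT (fun x => u x - v x) by exact: measurable_funB.
have E : (ipos (fun x => u x - v x)%R + \int[mu]_x (v x)%:E =
          ipos (\- (fun x => u x - v x)%R)%R + \int[mu]_x (u x)%:E)%E.
  rewrite -!ge0_integralD//; first last.
  - exact/measurable_EFinP.
  - by move=> x _; rewrite lee_fin.
  - exact: measurable_pos.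
  - by move=> x _; rewrite lee_fin le_max lexx orbT.
  - exact/measurable_EFinP.
  - by move=> x _; rewrite lee_fin.
  - by apply: measurable_pos; apply: measurableT_comp.
  - by move=> x _; rewrite lee_fin le_max lexx orbT.
  apply: eq_integral => x _; rewrite -!EFinD; congr EFin.
  by have := max_pos_neg (u x - v x); rewrite /= => ->; ring.
have fin' : (\int[mu]_x (u x)%:E \is a fin_num)%E.
  by rewrite ge0_fin_numE//; apply: integral_ge0 => x _; rewrite lee_fin.
move: E; rewrite -uv => /eqP; rewrite eq_le => /andP[]; rewrite !leeD2rE// => *.
by apply/eqP; rewrite eq_le; apply/andP.
Qed.

Definition supported (V : X -> X) (Z : set X) := forall x, ~ Z x -> V x = x.

Lemma supportedS V Z Z' : Z `<=` Z' -> supported V Z -> supported V Z'.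
Proof. by move=> ZZ VZ x nx; apply: VZ => /ZZ. Qed.

Lemma supported_in V Z x : injective V -> supported V Z -> Z x -> Z (V x).
Proof. by move=> Vi VZ Zx; apply: contrapT => nV; have /Vi E := VZ _ nV; rewrite E in nV. Qed.

(* [V] permutes each fibre of [b] as one finite cycle, and [Y] contains exactly
   one point of each fibre, its value under [b]. *)
Record tiling (V : X -> X) (Y : set X) (b : X -> X) : Prop := {
  tl_FG : FG V;
  tl_PW : PW b;
  tl_meas : measurable Y;
  tl_base : forall x, Y (b x);
  tl_fix : forall x, Y x -> b x = x;
  tl_inv : forall x, b (V x) = b x;
  tl_reach : forall x, exists i, x = iter i V (b x) }.

Lemma tiling_id : tiling id setT id.
Proof. by split=> //; [exact: FG_id|exact: PW_id|move=> x; exists 0%N]. Qed.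

(** * Tilings by finite cycles and cohomologous reduction *)

Section tiling_theory.
Variables (V : X -> X) (Y : set X) (b : X -> X).
Hypothesis tV : tiling V Y b.

Let Vinj : injective V. Proof. by case: tV => -[/bij_inj]. Qed.

Lemma tl_iter i x : b (iter i V x) = b x.
Proof. by elim: i => //= i; rewrite (tl_inv tV). Qed.

Lemma tl_ret i z : Y z -> Y (iter i V z) -> iter i V z = z.
Proof. by move=> Yz /(tl_fix tV) <-; rewrite tl_iter (tl_fix tV Yz). Qed.

(** A fibre is a single cycle through its base point, so a fixed point is alone in its fibre. *)
Lemma tl_supported x : V x = x -> Y x.
Proof.
move=> Vx; have [i xi] := tl_reach tV x.
suff -> : x = b x by exact: (tl_base tV).
elim: i xi => [//|i IH /=]; rewrite -{1}Vx => /Vinj; exact: IH.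
Qed.

Lemma tl_cycle z : Y z -> exists h, iter h.+1 V z = z.
Proof.
move=> Yz; have [[V' K K'] _] := tl_FG tV.
have [i E] := tl_reach tV (V' z); exists i.
by rewrite /= -[in RHS](K' z) E; congr (V (iter i V _)); rewrite -(tl_inv tV) K' (tl_fix tV).
Qed.

(** [V2 \o V] climbs a column of [V] and, when [V] would return to the base, [V2] diverts it to the
    base of the next column. The columns over one cycle of [V2] are thus concatenated into one
    cycle. *)
Lemma tl_comp V2 Y2 b2 : tiling V2 Y2 b2 -> supported V2 Y ->
  tiling (V2 \o V) (Y `&` Y2) (b2 \o b).
Proof.
move=> t2 sV2.
have V2inj : injective V2 by case: (tl_FG t2) => /bij_inj.
have V2Y := supported_in V2inj sV2.
have iterV2Y i z : Y z -> Y (iter i V2 z).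
  by move=> Yz; elim: i => //= i; exact: V2Y.
have b2Y z : Y z -> Y (b2 z).
  move=> Yz; have [i E] := tl_reach t2 z.
  elim: i z Yz E => [|i IH] z Yz E; first by rewrite -[b2 z]/(iter 0 V2 (b2 z)) -E.
  have [V2' K K'] : bijective V2 by case: (tl_FG t2).
  have -> : b2 z = b2 (V2' z) by rewrite -[in LHS](K' z) (tl_inv t2).
  apply: IH; last by apply: V2inj; rewrite K' {1}E /= -(tl_inv t2 (V2' z)) K'.
  apply: contrapT => nY; have := sV2 _ nY; rewrite K' => E'; apply: nY; rewrite -E'//.
(* Between two visits to [Y] the map [V2] is the identity, so the composite just follows [V]. *)
have walk z m : Y z -> (forall k, (0 < k <= m)%N -> ~ Y (iter k V z)) ->
    iter m (V2 \o V) z = iter m V z.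
  move=> Yz; elim: m => [//|m IH] H; rewrite iterS IH; last first.
    by move=> k /andP[k0 km]; apply: H; rewrite k0 ltnW.
  by rewrite /= sV2//; apply: (H m.+1); rewrite ltnSn.
have one z : Y z -> exists k, iter k (V2 \o V) z = V2 z.
  move=> Yz; have [h0 Eh0] := tl_cycle Yz.
  have : exists h, `[< iter h.+1 V z = z >] by exists h0; exact/asboolP.
  move/ex_minnP => -[h /asboolP Eh hmin].
  exists h.+1; rewrite iterS walk//=; first by rewrite -iterS Eh.
  move=> k /andP[k0 kh] Yk; have := tl_ret Yz Yk.
  by case: k k0 kh {Yk} => // k _ kh /asboolP /hmin; rewrite leqNgt kh.
have many j z : Y z -> exists k, iter k (V2 \o V) z = iter j V2 z.
  move=> Yz; elim: j => [|j [k E]]; first by exists 0%N.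
  have [l El] := one _ (iterV2Y j z Yz).
  by exists (l + k)%N; rewrite iterD E El.
split.
- exact: FG_comp (tl_FG t2) (tl_FG tV).
- exact: PW_comp (tl_PW t2) (tl_PW tV).
- by apply: measurableI; [exact: tl_meas tV|exact: tl_meas t2].
- by move=> x; split; [exact/b2Y/(tl_base tV)|exact: (tl_base t2)].
- by move=> x [Yx Y2x] /=; rewrite (tl_fix tV)// (tl_fix t2).
- move=> x /=; have [YV|nYV] := pselect (Y (V x)).
    by rewrite (tl_fix tV (V2Y _ YV)) (tl_inv t2) -(tl_inv tV x) (tl_fix tV YV).
  by rewrite sV2// (tl_inv tV).
- move=> x /=; set z := b x; have Yz : Y z by exact: (tl_base tV).
  have [i0 Ei0] := tl_reach tV x.
  have : exists i, `[< x = iter i V z >] by exists i0; exact/asboolP.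
  move/ex_minnP => -[i /asboolP Ei imin].
  have [j Ej] := tl_reach t2 z.
  have [k Ek] := many j _ (b2Y _ Yz).
  exists (i + k)%N; rewrite iterD Ek -Ej walk//.
  move=> m /andP[m0 mi] /(tl_ret Yz) E.
  have : (i <= i - m)%N.
    by apply: imin; apply/asboolP; rewrite Ei -{1}(subnK mi) iterD E.
  by move: m0 mi; lia.
Qed.

Variables V' : X -> X.
Hypotheses (VK : cancel V V') (VK' : cancel V' V).

Let PWV' : PW V'. Proof. by case: (FG_inv (tl_FG tV) VK VK'). Qed.

(* The number of steps from the base point of its column up to [x]. *)
Definition lvl (x : X) : nat := least (fun k => iter k V' @^-1` Y) x.

Lemma lvl_dmeas : dmeas lvl.
Proof. by apply: dmeas_least => k; exact: (PW_preimage (PW_iter k PWV') (tl_meas tV)). Qed.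

Lemma iterVK k x : iter k V' (iter k V x) = x.
Proof. by elim: k x => // k IH x; rewrite iterSr /= VK IH. Qed.

Lemma iterVK' k x : iter k V (iter k V' x) = x.
Proof. by elim: k x => // k IH x; rewrite iterSr /= VK' IH. Qed.

Lemma lvlP x : iter (lvl x) V' x = b x /\ forall k, (k < lvl x)%N -> ~ Y (iter k V' x).
Proof.
have e : exists k, (iter k V' @^-1` Y) x.
  have [i Ei] := tl_reach tV x; exists i; rewrite /= [in X in iter i V' X]Ei iterVK.
  exact: (tl_base tV).
have [Yl ml] := leastP (P := fun k => iter k V' @^-1` Y) e; split; last by move=> k; rewrite ltnNge => /negP kl /ml.
by rewrite -[in RHS](iterVK' (lvl x) x) tl_iter (tl_fix tV).
Qed.

Lemma lvl_iter x : iter (lvl x) V (b x) = x.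
Proof. by have [<- _] := lvlP x; rewrite iterVK'. Qed.

Lemma lvl0 x : Y x -> lvl x = 0%N.
Proof. by move=> Yx; have [_ H] := lvlP x; case: (lvl x) H => // n /(_ 0%N (ltn0Sn _)). Qed.

Lemma lvlS x : ~ Y (V x) -> lvl (V x) = (lvl x).+1.
Proof.
move=> nY; have [E H] := lvlP x; have [E' H'] := lvlP (V x).
case: (lvl (V x)) E' H' => [/= E'|n E' H'].
  by case: nY; rewrite E'; exact: (tl_base tV).
have E2 : iter n V' x = b x by rewrite -(tl_inv tV x) -E' iterSr VK.
congr _.+1; apply/eqP; rewrite eqn_leq; apply/andP; split; rewrite leqNgt; apply/negP.
  by move=> ln; apply: (H' (lvl x).+1) => //; rewrite iterSr VK E; exact: (tl_base tV).
by move=> nl; apply: (H n nl); rewrite E2; exact: (tl_base tV).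
Qed.

(* The sum of [s] over the column of the base point [z], read backwards from
   its top [V' z]. *)
Definition tsum (s : X -> R) (z : X) : R :=
  if `[< Y z >] then \sum_(m < (lvl (V' z)).+1) s (iter m.+1 V' z) else 0.

(** The transfer function that moves the values of [s] in a column onto its base point; the sum is
    empty, hence zero, on the bases. *)
Definition psum (s : X -> R) (x : X) : R := - \sum_(m < lvl x) s (iter m.+1 V' x).

Lemma measurable_psum_gen (s : X -> R) (u : X -> nat) : measurable_fun setT s -> dmeas u ->
  measurable_fun setT (fun x => \sum_(m < u x) s (iter m.+1 V' x)).
Proof.
move=> ms mu'; apply: (measurable_fun_cases (F := fun k x => \sum_(m < k) s (iter m.+1 V' x)) mu').
move=> k; apply: measurable_sum => m.
exact: (measurableT_comp ms (PW_fun (PW_iter m.+1 PWV'))).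
Qed.

Lemma measurable_tsum s : measurable_fun setT s -> measurable_fun setT (tsum s).
Proof.
move=> ms; apply: (measurable_fun_cases (F := fun c z => if c then
  \sum_(m < (lvl (V' z)).+1) s (iter m.+1 V' z) else 0) (dmeas_bool (tl_meas tV))).
case => //; apply: measurable_psum_gen => //.
exact: (dmeas_comp succn (PW_dmeas PWV' lvl_dmeas)).
Qed.

Lemma measurable_psum s : measurable_fun setT s -> measurable_fun setT (psum s).
Proof.
by move=> ms; apply: measurableT_comp => //; apply: measurable_psum_gen => //; exact: lvl_dmeas.
Qed.

Lemma tsumE s x : s x = psum s x - psum s (V x) + tsum s (V x).
Proof.
have shift : \sum_(m < (lvl x).+1) s (iter m.+1 V' (V x)) =
    s x + \sum_(m < lvl x) s (iter m.+1 V' x).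
  rewrite big_ord_recl [iter _ _ _]/= VK; congr (_ + _).
  by apply: eq_bigr => m _; rewrite lift0 iterSr VK.
rewrite /tsum /psum; case: asboolP => YV.
  by rewrite (lvl0 YV) big_ord0 VK shift; ring.
by rewrite (lvlS YV) shift; ring.
Qed.

Lemma tsum_off s z : ~ Y z -> tsum s z = 0.
Proof. by move=> nY; rewrite /tsum asboolF. Qed.

(** By [tsumE] the function [s - tsum s \o V] is a coboundary, hence balanced. Integrability of
    [tsum s] is not known beforehand, but the positive part of this difference is at most [s], so
    its integral is finite and can be cancelled. *)
Lemma integral_tsum (s : X -> R) : measurable_fun setT s -> (forall x, 0 <= s x) ->
  (\int[mu]_x (s x)%:E < +oo)%E ->
  (\int[mu]_x (tsum s x)%:E = \int[mu]_x (s x)%:E)%E.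
Proof.
move=> ms s0 fin.
have mVf : measurable_fun setT V by exact: (PW_fun (tl_FG tV).2).
have pV A : measurable A -> mu (V @^-1` A) = mu A.
  by move=> mA; exact: (FG_preimage (tl_FG tV) mA).2.
have mt := measurable_tsum ms.
have mtV : measurable_fun setT (fun x => tsum s (V x)) by exact: (measurableT_comp mt mVf).
have t0 x : 0 <= tsum s x.
  by rewrite /tsum; case: ifP => // _; apply: sumr_ge0.
pose h x := s x - tsum s (V x).
have mh : measurable_fun setT h by exact: measurable_funB.
have bal : ipos h = ipos (\- h).
  rewrite -[RHS]/(ipos (\- h)).
  have := coboundary_balanced mVf pV (measurable_psum ms).
  by rewrite (_ : (fun x => _) = h)//; apply/funext => x; rewrite /h (tsumE s x); ring.
have E : (\int[mu]_x (s x)%:E + ipos (\- h)%R = \int[mu]_x (tsum s (V x))%:E + ipos h)%E.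
  rewrite -!ge0_integralD//; first last.
  - by apply: measurable_pos; apply: measurableT_comp.
  - by move=> x _; rewrite lee_fin le_max lexx orbT.
  - exact/measurable_EFinP.
  - by move=> x _; rewrite lee_fin.
  - exact: measurable_pos.
  - by move=> x _; rewrite lee_fin le_max lexx orbT.
  - exact/measurable_EFinP.
  - by move=> x _; rewrite lee_fin.
  apply: eq_integral => x _; rewrite -!EFinD; congr EFin.
  by have := max_pos_neg (h x); rewrite /h /= => ->; ring.
have hfin : ipos h \is a fin_num.
  rewrite ge0_fin_numE ?ipos_ge0//; apply: le_lt_trans fin.
  apply: ge0_le_integral => //.
  - by move=> x _; rewrite lee_fin le_max lexx orbT.
  - exact: measurable_pos.
  - exact/measurable_EFinP.
  - by move=> x _; rewrite lee_fin ge_max s0 andbT /h gerBl.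
move: E; rewrite -bal => /eqP; rewrite eq_le => /andP[]; rewrite !leeD2rE// => E1 E2.
rewrite -(ge0_integral_preserving (u := fun x => (tsum s x)%:E) mVf pV).
- by apply/eqP; rewrite eq_le E1 E2.
- exact/measurable_EFinP.
- by move=> x; rewrite lee_fin.
Qed.

Lemma tsum_balanced (s : X -> R) : measurable_fun setT s -> balanced s ->
  (ipos s < +oo)%E -> balanced (tsum s).
Proof.
move=> ms bal fin.
pose p x := Num.max (s x) 0; pose q x := Num.max (- s x) 0.
have mp : measurable_fun setT p by exact: measurable_funrpos.
have mq : measurable_fun setT q by apply: measurable_funrpos; exact: measurableT_comp.
have p0 x : 0 <= p x by rewrite le_max lexx orbT.
have q0 x : 0 <= q x by rewrite le_max lexx orbT.
have -> : tsum s = fun x => tsum p x - tsum q x.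
  apply/funext => x; rewrite /tsum; case: ifP => _; last by rewrite subrr.
  rewrite -sumrB; apply: eq_bigr => m _; rewrite /p /q max_pos_neg; ring.
have t0 r x : (forall x, 0 <= r x) -> 0 <= tsum r x.
  by move=> r0; rewrite /tsum; case: ifP => // _; apply: sumr_ge0.
have Ip : (\int[mu]_x (tsum p x)%:E = ipos s)%E by exact: integral_tsum.
have Iq : (\int[mu]_x (tsum q x)%:E = ipos (\- s)%R)%E.
  by apply: integral_tsum => //; move: bal fin; rewrite /balanced /ipos /q => <-.
apply: ipos_fin_sub; rewrite ?Ip ?Iq//.
- exact: measurable_tsum.
- exact: measurable_tsum.
- by move=> x; apply: t0.
- by move=> x; apply: t0.
Qed.

End tiling_theory.

Implicit Types (s u v h w : X -> R) (K : R) (Z : set X) (x y z : X).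

Lemma measurable_set_lt u v : measurable_fun setT u -> measurable_fun setT v ->
  measurable [set x | u x < v x].
Proof.
move=> mU mv; have := measurable_fun_ltr mU mv measurableT (Y := [set true]).
by rewrite setTI; apply.
Qed.

Lemma measurable_set_le u v : measurable_fun setT u -> measurable_fun setT v ->
  measurable [set x | u x <= v x].
Proof.
move=> mU mv; have := measurable_fun_ler mU mv measurableT (Y := [set true]).
by rewrite setTI; apply.
Qed.

Lemma ae_FG (V : X -> X) (P : X -> Prop) : FG V ->
  {ae mu, forall x, P x} -> {ae mu, forall x, P (V x)}.
Proof.
move=> FV [N [mN N0 PN]]; have [mVN VN0] := FG_preimage FV mN.
exists (V @^-1` N); split=> //; first by rewrite -N0; exact: VN0.
by move=> x /= nP; apply: PN.
Qed.

(* [s] on [Z] is cohomologous, along finite columns of points of [Z] with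
   bases in [Z'], to the column sums [s'] on [Z']. *)
Definition redby (V b : X -> X) (Z : set X) (s : X -> R) (Z' : set X) (s' : X -> R) : Prop :=
  exists c : X -> R, [/\ tiling V (Z' `|` ~` Z) b, supported V Z, Z' `<=` Z,
    [/\ measurable Z', measurable_fun setT s', measurable_fun setT c &
      forall x, ~ Z' x -> s' x = 0] &
    {ae mu, forall x, s x = c x - c (V x) + s' (V x)}].

Definition red Z s Z' s' := exists V b, redby V b Z s Z' s'.

Lemma red_refl Z s : measurable Z -> measurable_fun setT s ->
  (forall x, ~ Z x -> s x = 0) -> red Z s Z s.
Proof.
move=> mZ ms sZ; exists id, id, (fun=> 0); split=> //.
  by rewrite setUv; exact: tiling_id.
by apply: aeW => x; rewrite subrr add0r.
Qed.

Lemma redby_trans V1 b1 V2 b2 Z s Z1 s1 Z2 s2 :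
  redby V1 b1 Z s Z1 s1 -> redby V2 b2 Z1 s1 Z2 s2 ->
  redby (V2 \o V1) (b2 \o b1) Z s Z2 s2.
Proof.
move=> [c1' [t1 sV1 Z1Z [mZ1 ms1 mc1' s1Z1] E1']].
move=> [c2 [t2 sV2 Z2Z1 [mZ2 ms2 mc2 s2Z2] E2]].
pose Y1 := Z1 `|` ~` Z.
(* Subtracting a function that is constant on the cycles of [V1] keeps the equation and makes the
   transfer function vanish on the bases, which is where [V2] acts. *)
pose c1 x := c1' x - c1' (b1 x).
have mc1 : measurable_fun setT c1.
  apply: measurable_funB => //; exact: (measurableT_comp mc1' (PW_fun (tl_PW t1))).
have c10 x : Y1 x -> c1 x = 0 by move=> Yx; rewrite /c1 (tl_fix t1 Yx) subrr.
have sV2' : supported V2 Y1 by apply: supportedS sV2 => x; left.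
have V2i : injective V2 by case: (tl_FG t2) => /bij_inj.
exists (fun x => c1 x + c2 (b1 x)); split.
- rewrite (_ : Z2 `|` ~` Z = Y1 `&` (Z2 `|` ~` Z1)); first exact: tl_comp.
  apply/seteqP; split=> x.
    case=> [Z2x|nZx]; first by split; left=> //; exact: Z2Z1.
    by split; right=> // /Z1Z.
  by case=> -[Z1x|nZx] [Z2x|nZ1x]; [left|case: nZ1x|left|right].
- by move=> x nZ /=; rewrite sV1// sV2// => /Z1Z.
- exact: subset_trans Z2Z1 Z1Z.
- split=> //; apply: measurable_funD => //.
  exact: (measurableT_comp mc2 (PW_fun (tl_PW t1))).
- apply: filterS2 E1' (ae_FG (tl_FG t1) E2) => x /= E1 {}E2.
  have {}E1 : s x = c1 x - c1 (V1 x) + s1 (V1 x) by rewrite /c1 (tl_inv t1) E1; ring.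
  rewrite E1 E2; have [YV|nYV] := pselect (Y1 (V1 x)).
    have YVV := supported_in V2i sV2' YV.
    rewrite (c10 _ YV) (c10 _ YVV) (tl_fix t1 YVV).
    by rewrite -(tl_inv t1 x) (tl_fix t1 YV); ring.
  by rewrite sV2' // (tl_inv t1); ring.
Qed.

Lemma red_trans Z s Z1 s1 Z2 s2 : red Z s Z1 s1 -> red Z1 s1 Z2 s2 -> red Z s Z2 s2.
Proof.
move=> [V1 [b1 r1]] [V2 [b2 r2]].
by exists (V2 \o V1), (b2 \o b1); exact: redby_trans r1 r2.
Qed.

Lemma red_modify Z s Z' s' s'' : red Z s Z' s' -> measurable_fun setT s'' ->
  (forall x, ~ Z' x -> s'' x = 0) -> {ae mu, forall x, s' x = s'' x} -> red Z s Z' s''.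
Proof.
move=> [V [b [c [t sV ZZ [mZ ms mc sZ] E]]]] ms'' sZ'' ss.
exists V, b, c; split=> //.
by apply: filterS2 E (ae_FG (tl_FG t) ss) => x -> ->.
Qed.

Lemma red_opp Z s Z' s' : red Z s Z' s' -> red Z (\- s) Z' (\- s').
Proof.
move=> [V [b [c [t sV ZZ [mZ ms mc sZ] E]]]].
exists V, b, (\- c); split=> //; last by apply: filterS E => x /= ->; ring.
split=> //; try exact: measurableT_comp.
by move=> x nZ /=; rewrite sZ// oppr0.
Qed.

Lemma balancedN h : balanced h -> balanced (\- h).
Proof.
move=> bh; rewrite /balanced -[LHS]bh; congr ipos.
by apply/funext => x; rewrite /= opprK.
Qed.

Lemma ipos_ae u v : measurable_fun setT u -> measurable_fun setT v ->
  {ae mu, forall x, u x = v x} -> ipos u = ipos v.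
Proof.
move=> mU mv E; apply: ge0_ae_eq_integral => //.
- exact: measurable_pos.
- exact: measurable_pos.
- by move=> x _; rewrite lee_fin le_max lexx orbT.
- by move=> x _; rewrite lee_fin le_max lexx orbT.
- by apply: filterS E => x -> _.
Qed.

Lemma le_ipos (u : X -> R) (v : X -> R) : measurable_fun setT u -> measurable_fun setT v ->
  (forall x, u x <= v x) -> (ipos u <= ipos v)%E.
Proof.
move=> mU mv uv; apply: ge0_le_integral => //.
- by move=> x _; rewrite lee_fin le_max lexx orbT.
- exact: measurable_pos.
- exact: measurable_pos.
- by move=> x _; rewrite lee_fin ge_max !le_max uv lexx orbT.
Qed.

Lemma ipos_bounded u K : measurable_fun setT u -> (forall x, u x <= K) -> (ipos u < +oo)%E.
Proof.
move=> mU uK; apply: le_lt_trans (le_ipos mU (measurable_cst K) uK) _.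
have -> : ipos (cst K) = (Num.max K 0)%:E by rewrite -integral_const.
by rewrite ltry.
Qed.

Lemma balancedB u h : measurable_fun setT u -> measurable_fun setT h ->
  balanced u -> balanced h -> (ipos u < +oo)%E -> (ipos h < +oo)%E ->
  balanced (fun x => u x - h x).
Proof.
move=> mU mh bu bh fu fh; pose w x := u x - h x.
have mw : measurable_fun setT w by exact: measurable_funB.
have pos x (v : X -> R) : (0 <= (Num.max (v x) 0)%:E)%E by rewrite lee_fin le_max lexx orbT.
have mN (v : X -> R) : measurable_fun setT v -> measurable_fun setT (fun x => (Num.max ((\- v) x) 0)%:E).
  by move=> mv; apply: measurable_pos; exact: measurableT_comp.
have mp := measurable_pos.
have E : (ipos u + ipos (\- h)%R + ipos (\- w)%R = ipos (\- u)%R + ipos h + ipos w)%E.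
  rewrite -!ge0_integralD//; try exact: mp; try exact: mN; try by move=> x _; exact: pos.
  - apply: eq_integral => x _; rewrite -!EFinD; congr EFin.
    have := max_pos_neg (u x); have := max_pos_neg (h x); have := max_pos_neg (w x).
    by rewrite /w /= => -> -> ->; ring.
  - by move=> x _; apply: adde_ge0; exact: pos.
  - by apply: emeasurable_funD; [exact: mN|exact: mp].
  - by move=> x _; apply: adde_ge0; exact: pos.
  - by apply: emeasurable_funD; [exact: mp|exact: mN].
have ffu : ipos u \is a fin_num by rewrite ge0_fin_numE ?ipos_ge0.
have ffh : ipos h \is a fin_num by rewrite ge0_fin_numE ?ipos_ge0.
move: E; rewrite -bu -bh => /eqP; rewrite eq_le => /andP[].
have ff : (ipos u + ipos h)%E \is a fin_num by rewrite fin_numD ffu ffh.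
rewrite !(leeD2lE _ _ ff) => E1 E2.
by rewrite -[fun x => _]/w /balanced; apply/eqP; rewrite eq_le E1 E2.
Qed.

(** [s - s' \o V] equals a coboundary almost everywhere, so it is balanced. With all functions
    bounded, balance survives subtraction, and [V] preserves [mu]. *)
Lemma red_balanced Z s Z' s' K : red Z s Z' s' -> measurable_fun setT s ->
  (forall x, `|s x| <= K) -> (forall x, `|s' x| <= K) -> balanced s -> balanced s'.
Proof.
move=> [V [b [c [t sV ZZ [mZ ms' mc sZ] E]]]] ms sK s'K bs.
have mVf : measurable_fun setT V by exact: (PW_fun (tl_FG t).2).
have pV A : measurable A -> mu (V @^-1` A) = mu A.
  by move=> mA; exact: (FG_preimage (tl_FG t) mA).2.
have ms'V : measurable_fun setT (fun x => s' (V x)) by exact: measurableT_comp.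
pose h x := s x - s' (V x).
have mh : measurable_fun setT h by exact: measurable_funB.
have mcV : measurable_fun setT (fun x => c x - c (V x)).
  by apply: measurable_funB => //; exact: measurableT_comp.
have bh : balanced h.
  rewrite /balanced (ipos_ae mh mcV); last by apply: filterS E => x; rewrite /h => ->; ring.
  rewrite (coboundary_balanced mVf pV mc); apply: ipos_ae; try exact: measurableT_comp.
  by apply: filterS E => x /=; rewrite /h => ->; ring.
have bsV : balanced (fun x => s' (V x)).
  rewrite (_ : (fun x => _) = (fun x => s x - h x)); last first.
    by apply/funext => x; rewrite /h; ring.
  apply: balancedB => //; apply: (@ipos_bounded _ (K + K)) => // x.
    have := sK x; rewrite ler_norml => /andP[_ H].
    by apply: le_trans H _; rewrite lerDl (le_trans _ (sK x)).
  rewrite /h; have := sK x; have := s'K (V x); rewrite !ler_norml => /andP[? ?] /andP[? ?]; lra.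
move: bsV; rewrite /balanced /ipos.
rewrite (ge0_integral_preserving (u := fun x => (Num.max (s' x) 0)%:E) mVf pV).
- rewrite (ge0_integral_preserving (u := fun x => (Num.max (- s' x) 0)%:E) mVf pV)//.
    by apply: measurable_pos; exact: measurableT_comp.
  by move=> x; rewrite lee_fin le_max lexx orbT.
- exact: measurable_pos.
- by move=> x; rewrite lee_fin le_max lexx orbT.
Qed.

(** Each [x] in [A] becomes the base of a column of height two with top [V x] in [B]; all other
    points are columns of height one. *)
Lemma red_swap Z s V A B : measurable Z -> measurable_fun setT s ->
  (forall x, ~ Z x -> s x = 0) -> FG V -> (forall x, V (V x) = x) ->
  measurable A -> measurable B -> A `<=` Z -> B `<=` Z -> A `&` B = set0 ->
  (forall x, A x -> B (V x)) -> (forall x, B x -> A (V x)) ->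
  (forall x, ~ A x -> ~ B x -> V x = x) ->
  red Z s (Z `\` B) (fun x => if `[< A x >] then s x + s (V x) else if `[< B x >] then 0 else s x).
Proof.
move=> mZ ms sZ FV VV mA mB AZ BZ AB0 VA VB Vid.
have AnB x : A x -> ~ B x by move=> Ax Bx; rewrite -[False]/(set0 x) -AB0.
pose b x := if `[< B x >] then V x else x.
pose c x := if `[< B x >] then - s (V x) else 0.
have msV : measurable_fun setT (fun x => s (V x)).
  by exact: (measurableT_comp ms (PW_fun FV.2)).
exists V, b, c; split.
- split=> //.
  + apply: (PW_cases (u := fun k x => if k then V x else x) (dmeas_bool mB)) => -[].
      exact: FV.2.
    exact: PW_id.
  + by apply: measurableU; [exact: measurableD|exact: measurableC].
  + move=> x; rewrite /b; case: asboolP => Bx.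
      by left; split; [exact/AZ/VB|exact/AnB/VB].
    by have [Zx|nZ] := pselect (Z x); [left|right].
  + move=> x; rewrite /b => -[[_ nB]|nZ]; rewrite asboolF//.
    by move/BZ.
  + move=> x; rewrite /b; have [Ax|nA] := pselect (A x).
      by rewrite asboolT ?asboolF ?VV//; [exact: AnB|exact: VA].
    have [Bx|nB] := pselect (B x); last by rewrite (Vid x nA nB) asboolF.
    by rewrite asboolF ?asboolT//; apply: AnB; exact: VB.
  + move=> x; rewrite /b; case: asboolP => Bx; last by exists 0%N.
    by exists 1%N; rewrite /= VV.
- by move=> x nZ; apply: Vid => [/AZ|/BZ].
- exact: subDsetl.
- split.
  + exact: measurableD.
  + apply: (measurable_fun_cases (F := fun k x => if k then s x + s (V x) else
      if `[< B x >] then 0 else s x) (dmeas_bool mA)) => -[].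
      exact: measurable_funD.
    by apply: (measurable_fun_cases (F := fun k x => if k then 0 else s x) (dmeas_bool mB)) => -[].
  + apply: (measurable_fun_cases (F := fun k x => if k then - s (V x) else 0) (dmeas_bool mB)) => -[]//.
    exact: measurableT_comp.
  + move=> x nZB; have [Bx|nB] := pselect (B x).
      by rewrite asboolF ?asboolT//; move/AnB.
    have nZ : ~ Z x by move=> Zx; apply: nZB.
    by rewrite !asboolF ?sZ// => /AZ.
- apply: aeW => x; rewrite /c.
  have [Ax|nA] := pselect (A x).
    rewrite (asboolF (AnB _ Ax)) (asboolT (VA _ Ax)) asboolF; last by move/AnB; apply; exact: VA.
    by rewrite VV; ring.
  have [Bx|nB] := pselect (B x).
    rewrite (asboolT Bx) (asboolF (AnB _ (VB _ Bx))) (asboolT (VB _ Bx)) VV; ring.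
  by rewrite Vid// !asboolF//; ring.
Qed.

Lemma integral_indic2 (a e : R) (A B : set X) : measurable A -> measurable B ->
  0 <= a -> 0 <= e ->
  (\int[mu]_x (a * \1_A x + e * \1_B x)%:E = a%:E * mu A + e%:E * mu B)%E.
Proof.
move=> mA mB a0 e0.
under eq_integral do rewrite EFinD !EFinM.
rewrite ge0_integralD//; last 4 first.
- by move=> x _; rewrite -EFinM lee_fin mulr_ge0.
- by apply/measurable_EFinP; apply: measurable_funM.
- by move=> x _; rewrite -EFinM lee_fin mulr_ge0.
- by apply/measurable_EFinP; apply: measurable_funM.
rewrite !ge0_integralZl//; try by move=> x _; rewrite lee_fin.
- by rewrite !integral_indic// !setIT.
- exact/measurable_EFinP.
- exact/measurable_EFinP.
Qed.

(* The unmatched positive peaks [L0] absorb negative values in rounds.  Every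
   round lowers each active peak by [kap], so finitely many suffice, and a round
   cannot run out of negative values because [s] stays balanced. *)
Lemma red_peaks Z s K : measurable Z -> measurable_fun setT s ->
  (forall x, ~ Z x -> s x = 0) -> 0 < K -> balanced s ->
  (forall x, - (K / 2) <= s x <= K) ->
  exists Z' s', [/\ red Z s Z' s', balanced s' & forall x, `|s' x| <= 3 / 4 * K].
Proof.
move=> mZ ms sZ K0 bs sK.
pose L0 := [set x | 3 / 4 * K < s x].
have mL0 : measurable L0.
  exact: (measurable_set_lt (measurable_cst _) ms).
have L0Z : L0 `<=` Z by move=> x; rewrite /L0 /= => Lx; apply: contrapT => /sZ E; move: Lx; rewrite E; lra.
have [L00|/eqP L0n] := eqVneq (mu L0) 0%E.
  pose s' x := if `[< L0 x >] then 0 else s x.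
  have ms' : measurable_fun setT s'.
    by apply: (measurable_fun_cases (F := fun k x => if k then 0 else s x) (dmeas_bool mL0)) => -[].
  have s's : {ae mu, forall x, s x = s' x}.
    by exists L0; split=> // x /= E; apply: contrapT => nL; apply: E; rewrite /s' asboolF.
  have s'K x : `|s' x| <= 3 / 4 * K.
    rewrite /s'; case: asboolP => [_|/negP]; first by rewrite normr0; lra.
    by rewrite -leNgt ler_norml => H; have /andP[] := sK x; lra.
  have r : red Z s Z s'.
    apply: (red_modify (red_refl mZ ms sZ) ms' _ s's) => x nZ.
    by rewrite /s' asboolF ?sZ// => /L0Z.
  exists Z, s'; split=> //; apply: (red_balanced r ms (K := K)) => // x.
    by have := sK x; rewrite ler_norml; lra.
  by apply: le_trans (s'K x) _; lra.
pose m0 := fine (mu L0).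
have m0E : mu L0 = m0%:E by rewrite fineK// fin_num_measure.
have m00 : 0 < m0 by rewrite -lte_fin -m0E measure_gt0; exact/eqP.
(* Any positive value below [K / 4 * m0] would do: [K / 4 * m0] is the excess of positive mass found
   below if the negative values run out, and [kap] bounds the negative mass of values above
   [- kap]. *)
pose kap := K / 8 * m0.
have kap0 : 0 < kap by rewrite mulr_gt0// divr_gt0.
(* A peak is used only while it exceeds [3 / 4 * K] and absorbs at most [K / 2] in a round, so it
   stays above [K / 4]. It is finished once at most [3 / 4 * K]; otherwise it has lost [kap] in each
   of the [k] rounds. *)
have step k : exists Zk sk, [/\ red Z s Zk sk, balanced sk, L0 `<=` Zk &
    (forall x, L0 x -> K / 4 < sk x /\ (sk x <= 3 / 4 * K \/ sk x <= K - k%:R * kap)) /\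
    (forall x, ~ L0 x -> - (K / 2) <= sk x <= 3 / 4 * K)].
  elim: k => [|k [Zk [sk [rk bk LZ [H1 H2]]]]].
    exists Z, s; split=> //; first exact: red_refl.
    split=> x Lx; first by split; [move: Lx; rewrite /L0 /=; lra|right; rewrite mul0r; have := sK x; lra].
    by move: Lx; rewrite /L0 /= => /negP; rewrite -leNgt => ->; case/andP: (sK x) => ->.
  have [V0 [b0 [c0 [_ _ _ [mZk msk _ skZ] _]]]] := rk.
  pose L := L0 `&` [set x | 3 / 4 * K < sk x]; pose N := [set x | sk x <= - kap].
  have mL : measurable L.
    apply: measurableI => //.
    exact: (measurable_set_lt (measurable_cst _) msk).
  have mN : measurable N.
    exact: (measurable_set_le msk (measurable_cst _)).
  have NnL0 x : N x -> ~ L0 x by rewrite /N /= => Nx /H1[]; lra.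
  have NZ : N `<=` Zk by move=> x Nx; apply: contrapT => /skZ E; move: Nx; rewrite /N /= E; lra.
  have LN0 : L `&` N = set0 by apply/seteqP; split=> // x [[Lx _] /NnL0].
  have [V [A [B [FV VV [mA mB AL BN] [VA VB Vid] full]]]] := swap_exists mL mN LN0.
  have AB0 : A `&` B = set0 by apply/seteqP; split=> // x [/AL Lx /BN Nx]; rewrite -LN0.
  have AZ : A `<=` Zk by move=> x /AL[/LZ].
  have BZ : B `<=` Zk by move=> x /BN /NZ.
  have r1 := red_swap mZk msk skZ FV VV mA mB AZ BZ AB0 VA VB Vid.
  set s1 := fun x => if _ then _ else _ in r1.
  have r2 := red_trans rk r1.
  (* Were [N] exhausted instead, then [mu N <= mu L]. The positive mass is at least
     [K / 4 * m0 + K / 2 * mu L] and the negative mass at most [K / 2 * mu N + kap], against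
     balance. *)
  have LA0 : mu (L `\` A) = 0%E.
    case: full => // NB0; exfalso.
    have K4 : 0 <= K / 4 by lra.
    have K2 : 0 <= K / 2 by lra.
    have lo : ((K / 4)%:E * mu L0 + (K / 2)%:E * mu L <= ipos sk)%E.
      rewrite -integral_indic2//.
      apply: ge0_le_integral => //.
      - by move=> x _; rewrite lee_fin addr_ge0// mulr_ge0.
      - by apply/measurable_EFinP; apply: measurable_funD; apply: measurable_funM.
      - exact: measurable_pos.
      - move=> x _; rewrite lee_fin le_max; apply/orP; rewrite !indicE.
        have [Lx|nL] := pselect (L0 x); last first.
          by right; rewrite !memNset// ?mulr0 ?addr0// => -[].
        left; rewrite (mem_set Lx) mulr1; have [Lx'|nL] := pselect (L x).
          by rewrite (mem_set Lx') mulr1; case: Lx' => _ /=; lra.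
        by rewrite (memNset nL) mulr0 addr0; have [] := H1 _ Lx; lra.
    have up : (ipos (\- sk)%R <= (K / 2)%:E * mu N + kap%:E * mu setT)%E.
      rewrite -integral_indic2// ?(ltW kap0)//.
      apply: ge0_le_integral => //.
      - by move=> x _; rewrite lee_fin le_max lexx orbT.
      - by apply: measurable_pos; exact: measurableT_comp.
      - by apply/measurable_EFinP; apply: measurable_funD; apply: measurable_funM.
      - move=> x _; rewrite lee_fin !indicE (mem_set (I : setT x)) mulr1 /=; clear lo.
        have [Nx|nN] := pselect (N x).
          rewrite (mem_set Nx) mulr1 ge_max; have /andP[? ?] := H2 _ (NnL0 _ Nx); lra.
        rewrite (memNset nN) mulr0 add0r ge_max; move: nN; rewrite /N /= => /negP; lra.
    have NL : (mu N <= mu L)%E.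
      have BV : B = V @^-1` A.
        by apply/seteqP; split=> [x /VB//|x /= /VA]; rewrite VV.
      have [_ BA] := FG_preimage FV mA.
      apply: (@le_trans _ _ (mu (B `|` (N `\` B)))).
        apply: le_measure; rewrite ?inE//; first by apply: measurableU => //; exact: measurableD.
        by move=> x Nx; have [Bx|nB] := pselect (B x); [left|right].
      rewrite probability_setU0//; last exact: measurableD.
      by rewrite BV BA; exact: probability_le.
    have mT : mu setT = 1%E by exact: probability_setT.
    have fL : mu L = (fine (mu L))%:E by rewrite fineK// fin_num_measure.
    have fN : mu N = (fine (mu N))%:E by rewrite fineK// fin_num_measure.
    have := le_trans lo; rewrite bk => /(_ _ up); rewrite mT fL fN m0E -!EFinM -!EFinD lee_fin.
    move: NL; rewrite fL fN lee_fin => NL; rewrite /kap => H; clear lo up.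
    have : K / 2 * fine (mu N) <= K / 2 * fine (mu L) by rewrite ler_pM2l// divr_gt0.
    have : 0 < K * m0 by rewrite mulr_gt0.
    lra.
  (* The unmatched active peaks form a null set; a new value there makes the bounds hold at every
     point. *)
  pose s2 x := if `[< (L `\` A) x >] then 3 / 4 * K else s1 x.
  have mLA : measurable (L `\` A) by exact: measurableD.
  have [_ [_ [_ [_ _ _ [mZ1 ms1 _ s1Z] _]]]] := r1.
  have ms2 : measurable_fun setT s2.
    by apply: (measurable_fun_cases (F := fun k x => if k then 3 / 4 * K else s1 x) (dmeas_bool mLA)) => -[].
  have L0Z1 : L0 `<=` Zk `\` B.
    by move=> x Lx; split; [exact: LZ|move=> /BN /NnL0].
  have r3 : red Z s (Zk `\` B) s2.
    apply: (red_modify r2 ms2) => [x nZ|].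
      by rewrite /s2 asboolF ?s1Z// => -[[/L0Z1]].
    by exists (L `\` A); split=> // x /= E; apply: contrapT => nL; apply: E; rewrite /s2 asboolF.
  have P1 x : L0 x -> K / 4 < s2 x /\ (s2 x <= 3 / 4 * K \/ s2 x <= K - k.+1%:R * kap).
    move=> Lx; rewrite /s2; case: asboolP => LA; first by split; [lra|left].
    rewrite /s1; have [Ax|nA] := pselect (A x).
      rewrite asboolT//; have [_ Lx'] := AL _ Ax.
      have := BN _ (VA _ Ax); rewrite /N /= => sV.
      have := H2 _ (NnL0 _ (BN _ (VA _ Ax))); have [_] := H1 _ Lx; move: Lx'; rewrite /= => skx [?|]; first lra.
      move: (sk x) (sk (V x)) sV skx => a e sV skx.
      move=> sx /andP[? ?]; rewrite -[k.+1%:R]natr1; split; first lra.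
      by right; lra.
    rewrite asboolF// asboolF; last by move/BN/NnL0.
    have [? _] := H1 _ Lx; split=> //; left; apply: contrapT => /negP; rewrite -ltNge => sx.
    by apply: LA; split.
  have P2 x : ~ L0 x -> - (K / 2) <= s2 x <= 3 / 4 * K.
    move=> nL; rewrite /s2 asboolF; last by case=> -[].
    rewrite /s1 asboolF; last by move=> /AL[].
    by case: ifP => _; [lra|exact: H2].
  exists (Zk `\` B), s2; split=> //.
  apply: (red_balanced r3 ms (K := K)) => // x.
    by have := sK x; rewrite ler_norml; lra.
  have [Lx|/P2] := pselect (L0 x); last by rewrite ler_norml; lra.
  have [? _] := P1 _ Lx.
  rewrite ler_norml; have [_ [|]] := P1 _ Lx; first lra.
  have : 0 <= k.+1%:R * kap by rewrite mulr_ge0// ltW.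
  lra.
have [n nK] : exists n : nat, K <= n%:R * kap.
  exists (Num.truncn (K / kap)).+1; rewrite -ler_pdivrMr//.
  by apply: ltW; exact: truncnS_gt.
have [Zn [sn [rn bn _ [H1 H2]]]] := step n.
exists Zn, sn; split=> // x.
have [/H1[? [?|?]]|/H2] := pselect (L0 x); rewrite ler_norml; lra.
Qed.

Definition restr (s : X -> R) (A : set X) (x : X) : R := if `[< A x >] then s x else 0.

Lemma measurable_restr s (A : set X) : measurable_fun setT s -> measurable A ->
  measurable_fun setT (restr s A).
Proof.
move=> ms mA.
by apply: (measurable_fun_cases (F := fun k x => if k then s x else 0) (dmeas_bool mA)) => -[].
Qed.

(** Pairing values above [K / 2] with values below [- (K / 2)] gives sums of size at most [K / 2]
    and uses up one of the two sides. The large values left are then of one sign, the situation of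
    [red_peaks], possibly after changing the sign of the function. *)
Lemma red_step Z s K : measurable Z -> measurable_fun setT s ->
  (forall x, ~ Z x -> s x = 0) -> 0 < K -> balanced s -> (forall x, `|s x| <= K) ->
  exists Z' s', [/\ red Z s Z' s', balanced s' & forall x, `|s' x| <= 3 / 4 * K].
Proof.
move=> mZ ms sZ K0 bs sK.
have {}sK x : - K <= s x <= K by rewrite -ler_norml.
pose A0 := [set x | K / 2 < s x]; pose B0 := [set x | s x < - (K / 2)].
have mA0 : measurable A0 by exact: (measurable_set_lt (measurable_cst _) ms).
have mB0 : measurable B0 by exact: (measurable_set_lt ms (measurable_cst _)).
have A0Z : A0 `<=` Z by move=> x; rewrite /A0 /= => Ax; apply: contrapT => /sZ E; move: Ax; rewrite E; lra.
have B0Z : B0 `<=` Z by move=> x; rewrite /B0 /= => Ax; apply: contrapT => /sZ E; move: Ax; rewrite E; lra.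
have AB00 : A0 `&` B0 = set0 by apply/seteqP; split=> // x; rewrite /A0 /B0 /= => -[]; lra.
have [V [A [B [FV VV [mA mB AA BB] [VA VB Vid] full]]]] := swap_exists mA0 mB0 AB00.
have AB0 : A `&` B = set0 by apply/seteqP; split=> // x [/AA ? /BB ?]; rewrite -AB00.
have r1 := red_swap mZ ms sZ FV VV mA mB (subset_trans AA A0Z) (subset_trans BB B0Z) AB0 VA VB Vid.
set s1 := fun x => if _ then _ else _ in r1.
have [_ [_ [_ [_ _ _ [mZ1 ms1 _ s1Z] _]]]] := r1.
have fix0 (D : set X) : measurable D -> mu D = 0%E -> red Z s (Z `\` B) (restr s1 (~` D)).
  move=> mD D0; apply: (red_modify r1).
  - by apply: measurable_restr => //; exact: measurableC.
  - by move=> x /s1Z E; rewrite /restr E; case: ifP.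
  - by exists D; split=> // x /= E; apply: contrapT => nD; apply: E; rewrite /restr asboolT.
have AnB x : A x -> ~ B x by move=> Ax Bx; rewrite -[False]/(set0 x) -AB0.
have s1A x : A x -> - (K / 2) <= s1 x <= K / 2.
  move=> Ax; rewrite /s1 asboolT//; have := sK x; have := sK (V x).
  have := AA _ Ax; have := BB _ (VA _ Ax); rewrite /A0 /B0 /=; lra.
have s1B x : B x -> s1 x = 0 by move=> Bx; rewrite /s1 asboolF ?asboolT//; move/AnB.
have s1o x : ~ A x -> ~ B x -> s1 x = s x by move=> nA nB; rewrite /s1 !asboolF.
have bound (t : X -> R) : red Z s (Z `\` B) t -> (forall x, `|t x| <= K) -> balanced t.
  by move=> r tK; apply: (red_balanced r ms (K := K)) => // x; rewrite ler_norml.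
have mZB : measurable (Z `\` B) by exact: measurableD.
case: full => D0.
  have r2 := fix0 _ (measurableD mA0 mA) D0.
  set s2 := restr _ _ in r2.
  have s2K x : - K <= s2 x <= K / 2.
    rewrite /s2 /restr; case: asboolP => [H|_]; last by lra.
    have [/s1A|nA] := pselect (A x); first by lra.
    have [/s1B ->|nB] := pselect (B x); first by lra.
    rewrite s1o//; have /andP[-> _] := sK x; rewrite /= leNgt; apply/negP => sx.
    by apply: H; split.
  have b2 : balanced s2 by apply: bound => // x; have := s2K x; rewrite ler_norml; lra.
  have [_ [_ [_ [_ _ _ [_ ms2 _ s2Z] _]]]] := r2.
  have [|||||Z' [s' [r3 b3 s3]]] := @red_peaks (Z `\` B) (\- s2) K mZB.
  - exact: measurableT_comp.
  - by move=> x /s2Z /= ->; rewrite oppr0.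
  - by [].
  - exact: balancedN.
  - by move=> x /=; have := s2K x; lra.
  exists Z', (\- s'); split; last by move=> x /=; rewrite normrN.
    apply: red_trans r2 _; rewrite (_ : s2 = \- (\- s2)); first exact: red_opp.
    by apply/funext => x /=; rewrite opprK.
  exact: balancedN.
have r2 := fix0 _ (measurableD mB0 mB) D0.
set s2 := restr _ _ in r2.
have s2K x : - (K / 2) <= s2 x <= K.
  rewrite /s2 /restr; case: asboolP => [H|_]; last by lra.
  have [/s1A|nA] := pselect (A x); first by lra.
  have [/s1B ->|nB] := pselect (B x); first by lra.
  rewrite s1o//; have /andP[_ ->] := sK x; rewrite andbT leNgt; apply/negP => sx.
  by apply: H; split.
have b2 : balanced s2 by apply: bound => // x; have := s2K x; rewrite ler_norml; lra.
have [_ [_ [_ [_ _ _ [_ ms2 _ s2Z] _]]]] := r2.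
have [Z' [s' [r3 b3 s3]]] := red_peaks mZB ms2 s2Z K0 b2 s2K.
by exists Z', s'; split=> //; exact: red_trans r2 r3.
Qed.

Lemma red_bounded Z s K (e : R) : measurable Z -> measurable_fun setT s ->
  (forall x, ~ Z x -> s x = 0) -> balanced s -> (forall x, `|s x| <= K) -> 0 < e ->
  exists Z' s', [/\ red Z s Z' s', balanced s' & forall x, `|s' x| <= e].
Proof.
move=> mZ ms sZ bs sK e0.
wlog K0 : K sK / 0 < K.
  move=> H; apply: (H (Num.max K 1)); last by rewrite lt_max ltr01 orbT.
  by move=> x; rewrite le_max sK.
have step n : exists Z' s', [/\ red Z s Z' s', balanced s' & forall x, `|s' x| <= (3 / 4) ^+ n * K].
  elim: n => [|n [Z1 [s1 [r1 b1 s1K]]]].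
    by exists Z, s; split=> //; [exact: red_refl|move=> x; rewrite expr0 mul1r].
  have [_ [_ [_ [_ _ _ [mZ1 ms1 _ s1Z] _]]]] := r1.
  have Kn : 0 < (3 / 4) ^+ n * K by rewrite mulr_gt0// exprn_gt0//; lra.
  have [Z2 [s2 [r2 b2 s2K]]] := red_step mZ1 ms1 s1Z Kn b1 s1K.
  exists Z2, s2; split=> //; first exact: red_trans r1 r2.
  by move=> x; rewrite exprS -mulrA.
have [n nK] : exists n, (3 / 4) ^+ n * K <= e.
  have : (3 / 4 : R) ^+ n @[n --> \oo] --> 0.
    by apply: cvg_expr; rewrite ger0_norm; lra.
  move/cvgrPdist_le => /(_ (e / K)) [|N _ /(_ N (leqnn N))].
    by rewrite divr_gt0.
  rewrite /= sub0r normrN ger0_norm; last by apply: exprn_ge0; lra.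
  by exists N; rewrite -ler_pdivlMr.
have [Z' [s' [r' b' s'K]]] := step n.
by exists Z', s'; split=> // x; apply: le_trans nK.
Qed.

(** The index [j] of the piece is unchanged by the maps of that piece, so maps, bases and transfer
    functions can be chosen by [j]. Outside all pieces [j] takes the default value 0, harmless since
    [V 0] and [b 0] fix those points. *)
Lemma red_glue (Z : nat -> set X) s (Z' : nat -> set X) (s' : nat -> X -> R) :
  trivIset setT Z -> (forall k, measurable (Z k)) -> measurable_fun setT s ->
  (forall x, (forall k, ~ Z k x) -> s x = 0) ->
  (forall k, red (Z k) (restr s (Z k)) (Z' k) (s' k)) ->
  red (\bigcup_k Z k) s (\bigcup_k Z' k) (fun x => s' (least Z x) x).
Proof.
move=> tZ mZ ms sZ.
move=> /choice[V /choice[b /choice[c r]]].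
pose j := least Z.
have jZ k x : Z k x -> j x = k.
  move=> Zx; have [Zj _] := leastP (ex_intro (fun k => Z k x) k Zx).
  by apply: tZ => //; exists x.
have tk k : tiling (V k) (Z' k `|` ~` Z k) (b k) by case: (r k).
have sV k : supported (V k) (Z k) by case: (r k).
have ZZ k : Z' k `<=` Z k by case: (r k).
have Vi k : injective (V k) by case: (tl_FG (tk k)) => /bij_inj.
have out x : (forall k, ~ Z k x) \/ Z (j x) x.
  have [[k Zk]|nZ] := pselect (exists k, Z k x); first by right; rewrite (jZ _ _ Zk).
  by left=> k Zk; apply: nZ; exists k.
have Vout k x : (forall k, ~ Z k x) -> V k x = x by move=> nZ; apply: sV.
have bout k x : (forall k, ~ Z k x) -> b k x = x.
  by move=> nZ; apply: (tl_fix (tk k)); right; exact: nZ.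
have jV x : j (V (j x) x) = j x.
  have [nZ|Zx] := out x; first by rewrite Vout.
  by apply: jZ; exact: (supported_in (@Vi _) (@sV _) Zx).
have bZ k x : Z k x -> Z k (b k x).
  move=> Zx; have [i E] := tl_reach (tk k) x.
  apply: contrapT => nZ; have fixb m : iter m (V k) (b k x) = b k x.
    by elim: m => //= m ->; exact: sV.
  by apply: nZ; rewrite -(fixb i) -E.
have jb x : j (b (j x) x) = j x.
  have [nZ|Zx] := out x; first by rewrite bout.
  by apply: jZ; exact: bZ.
have mj : dmeas j by exact: dmeas_least.
have Yj x : (\bigcup_k Z' k `|` ~` \bigcup_k Z k) x <-> (Z' (j x) `|` ~` Z (j x)) x.
  split=> [[[k _ Zx]|nZ]|[Zx|nZ]].
  - by left; rewrite (jZ k)//; exact: ZZ.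
  - by right=> Zx; apply: nZ; exists (j x).
  - by left; exists (j x).
  - by right=> -[k _ Zx]; apply: nZ; rewrite (jZ _ _ Zx).
exists (fun x => V (j x) x), (fun x => b (j x) x), (fun x => c (j x) x); split.
- split.
  + split; last by apply: (PW_cases (u := V) mj) => k; exact: (tl_FG (tk k)).2.
    have /choice[V' V'P] k : exists V', cancel (V k) V' /\ cancel V' (V k).
      by have [[V' K1 K2] _] := tl_FG (tk k); exists V'.
    have sV' k : supported (V' k) (Z k).
      by move=> x nZ; have [K1 K2] := V'P k; rewrite -{1}(sV k x nZ) K1.
    have jV' x : j (V' (j x) x) = j x.
      have [nZ|Zx] := out x; first by rewrite sV'//; exact: nZ.
      by apply: jZ; exact: (supported_in (can_inj (V'P _).2) (@sV' _) Zx).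
    exists (fun x => V' (j x) x) => x; first by rewrite jV (V'P _).1.
    by rewrite jV' (V'P _).2.
  + by apply: (PW_cases (u := b) mj) => k; exact: (tl_PW (tk k)).
  + apply: measurableU; last by apply: measurableC; exact: bigcupT_measurable.
    by apply: bigcupT_measurable => k; case: (r k) => _ _ _ [].
  + by move=> x; apply/Yj; rewrite jb; exact: (tl_base (tk _)).
  + by move=> x /Yj; exact: (tl_fix (tk _)).
  + by move=> x; rewrite jV (tl_inv (tk _)).
  + move=> x; have [i E] := tl_reach (tk (j x)) x; exists i.
    rewrite {1}E; elim: i {E} => //= i ->.
    set y := iter i _ _; suff -> : j y = j x by [].
    by rewrite /y; elim: i {y} => [|i IH] /=; rewrite ?jb// jV.
- move=> x nZ; apply: sV => Zx; apply: nZ; by exists (j x).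
- by move=> x [k _ /ZZ Zx]; exists k.
- split.
  + by apply: bigcupT_measurable => k; case: (r k) => _ _ _ [].
  + by apply: (measurable_fun_cases (F := s') mj) => k; case: (r k) => _ _ _ [].
  + by apply: (measurable_fun_cases (F := c) mj) => k; case: (r k) => _ _ _ [].
  + move=> x nZ; have [_ _ _ [_ _ _ H] _] := r (j x); apply: H => Zx.
    by apply: nZ; exists (j x).
- have : {ae mu, forall x, forall k, restr s (Z k) x = c k x - c k (V k x) + s' k (V k x)}.
    by apply: ae_foralln => k; case: (r k).
  apply: filterS => x /(_ (j x)); rewrite -/(j _) jV => <-.
  rewrite /restr; case: asboolP => // nZ; apply: sZ => k Zx.
  by apply: nZ; rewrite (jZ _ _ Zx).
Qed.

(** * Slicing an unbounded balanced function into bounded balanced pieces *)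

Variables (phi : X -> R).
Hypotheses (mphi : measurable_fun setT phi) (phi01 : forall x, 0 <= phi x <= 1).
Hypothesis phi_atomless : forall t, mu (phi @^-1` [set t]) = 0%E.

Lemma inv_nat_le (r : R) : 0 < r -> exists n : nat, n.+1%:R^-1 <= r :> R.
Proof.
move=> r0; exists (Num.truncn r^-1); rewrite invf_ple ?posrE//.
by apply: ltW; exact: truncnS_gt.
Qed.

Section thresholds.
Variables (psi : X -> R).
Hypotheses (mpsi : measurable_fun setT psi).
Hypothesis psi_atomless : forall t, mu (psi @^-1` [set t]) = 0%E.

Definition lowset (t : R) := [set x | psi x <= t].
Definition midset (a e : R) := [set x | a < psi x /\ psi x <= e].
Definition band (t dl : R) := [set x | t - dl <= psi x /\ psi x <= t + dl].

Lemma measurable_psi_le (t : R) : measurable (lowset t).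
Proof. exact: (measurable_set_le mpsi (measurable_cst _)). Qed.

Lemma measurable_midset (a e : R) : measurable (midset a e).
Proof.
by apply: measurableI; [exact: (measurable_set_lt (measurable_cst _) mpsi)|exact: measurable_psi_le].
Qed.

Lemma measurable_band (t dl : R) : measurable (band t dl).
Proof.
by apply: measurableI; [exact: (measurable_set_le (measurable_cst _) mpsi)|exact: measurable_psi_le].
Qed.

Lemma level_small (t e : R) : 0 < e ->
  exists dl : R, 0 < dl /\ (mu (band t dl) <= e%:E)%E.
Proof.
move=> e0; pose A n := band t n.+1%:R^-1.
have mA n : measurable (A n) by exact: measurable_band.
have mAI : measurable (\bigcap_n A n) by exact: bigcapT_measurable.
have [] := @probability_to0 A e mA _ _ e0.
- move=> n m nm x [] /= h1 h2; rewrite /A /band /=.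
  have : m.+1%:R^-1 <= n.+1%:R^-1 :> R by rewrite lef_pV2 ?posrE// ler_nat.
  by move: m.+1%:R^-1 n.+1%:R^-1 h1 h2 => a c h1 h2 ac; split; lra.
- apply: (@subset_measure0 _ _ _ mu _ (psi @^-1` [set t])) (psi_atomless t) => //.
    by rewrite -[X in measurable X]setTI; exact: mpsi.
  move=> x Ax /=; apply/eqP; rewrite eq_le; apply/andP.
  split; apply/ler_addgt0Pr => r r0; have [n rn] := inv_nat_le r0;
    have [/= h1 h2] := Ax n I; move: n.+1%:R^-1 rn h1 h2 => a *; lra.
- move=> n /(_ n (leqnn n)) H; exists n.+1%:R^-1; split => //.
Qed.

Definition part (p : X -> R) (t : R) : \bar R := \int[mu]_x (restr p (lowset t) x)%:E.

Variable p : X -> R.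
Hypotheses (mp : measurable_fun setT p) (p0 : forall x, 0 <= p x).

Let mr (A : set X) : measurable A -> measurable_fun setT (fun x => (restr p A x)%:E).
Proof. by move=> mA; apply/measurable_EFinP; exact: measurable_restr. Qed.

Let r0 (A : set X) x : (0 <= (restr p A x)%:E)%E.
Proof. by rewrite lee_fin /restr; case: ifP. Qed.

Lemma partD (a b : R) : a <= b ->
  (part p b = part p a + \int[mu]_x (restr p (midset a b) x)%:E)%E.
Proof.
move=> ab; have mab := measurable_midset a b.
rewrite /part -ge0_integralD//; try by apply: mr => //; exact: measurable_psi_le.
apply: eq_integral => x _; rewrite -EFinD; congr EFin; rewrite /restr /=.
rewrite /lowset /midset /=.
case: (pselect (psi x <= a)) => [h|/negP].
  rewrite (asboolT h) (asboolT (le_trans h ab)) asboolF ?addr0// => -[].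
  by rewrite ltNge h.
rewrite -ltNge => h; rewrite [in X in _ = X + _]asboolF ?add0r; last by apply/negP; rewrite -ltNge.
by case: (pselect (psi x <= b)) => h'; [rewrite (asboolT h') asboolT|rewrite (asboolF h') asboolF// => -[]].
Qed.

Lemma part_homo a b : a <= b -> (part p a <= part p b)%E.
Proof. by move=> ab; rewrite (partD ab) leeDl//; apply: integral_ge0. Qed.

Lemma restr_le (K : R) (A : set X) : measurable A -> 0 <= K -> (forall x, A x -> p x <= K) ->
  (\int[mu]_x (restr p A x)%:E <= K%:E * mu A)%E.
Proof.
move=> mA K0 pK; have := @integral_indic2 K 0 A set0 mA measurable0 K0 (lexx _).
rewrite mul0e adde0 => <-; apply: ge0_le_integral => //.
- exact: mr.
- by apply/measurable_EFinP; apply: measurable_funD; apply: measurable_funM.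
- move=> x _; rewrite lee_fin mul0r addr0 indicE /restr.
  by case: asboolP => Ax; [rewrite mem_set// mulr1; exact: pK|rewrite memNset// mulr0].
Qed.

(** An intermediate value theorem for [t |-> part p t], continuous up to [b]: there [p] is at most
    [K], and narrow bands around a level have small measure because [psi] has no atoms. *)
Lemma part_ivt (a b K : R) (u : \bar R) : a <= b -> 0 <= K ->
  (forall x, psi x <= b -> p x <= K) -> (part p a <= u <= part p b)%E ->
  exists t, [/\ a <= t, t <= b & part p t = u].
Proof.
move=> ab K0 pK /andP[au ub].
have pos t : (0 <= part p t)%E by exact: integral_ge0.
have fin t : t <= b -> part p t \is a fin_num.
  move=> tb; rewrite ge0_fin_numE//.
  apply: (@le_lt_trans _ _ (K%:E * mu (lowset t))%E).
    apply: restr_le => // [|x /= xt]; first exact: measurable_psi_le.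
    by apply: pK; exact: le_trans tb.
  by rewrite ltey_eq fin_numM// fin_num_measure//; exact: measurable_psi_le.
have fu : u \is a fin_num.
  rewrite ge0_fin_numE; last exact: le_trans au.
  by apply: le_lt_trans ub _; rewrite ltey_eq fin.
pose g t := fine (part p t); pose v := fine u.
have gE t : t <= b -> part p t = (g t)%:E by move=> tb; rewrite fineK// fin.
have vE : u = v%:E by rewrite fineK.
have gh t1 t2 : t1 <= t2 -> t2 <= b -> g t1 <= g t2.
  by move=> tt tb; rewrite -lee_fin -!gE// ?part_homo//; exact: le_trans tb.
have C t e : 0 < e -> exists dl, 0 < dl /\ forall t1 t2, t - dl <= t1 -> t1 <= t2 ->
    t2 <= t + dl -> t2 <= b -> g t2 <= g t1 + e.
  move=> e0; have [|dl [dl0 sm]] := @level_small t (e / (K + 1)).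
    by rewrite divr_gt0//; lra.
  exists dl; split=> // t1 t2 h1 h2 h3 h4.
  rewrite -lee_fin EFinD -!gE//; last exact: le_trans h4.
  rewrite (partD h2) leeD2l//.
  have mB := measurable_midset t1 t2.
  apply: le_trans (restr_le mB K0 _) _.
    by move=> x [_ /= xt]; apply: pK; exact: le_trans h4.
  have mC := measurable_band t dl.
  apply: (@le_trans _ _ (K%:E * (e / (K + 1))%:E)%E).
    rewrite lee_wpmul2l ?lee_fin//; apply: le_trans sm.
    apply: probability_le => // x [/= x1 x2]; split.
      by apply: (le_trans h1); exact: ltW.
    exact: le_trans h3.
  rewrite -EFinM lee_fin mulrCA ler_piMr//; first exact: ltW.
  by rewrite ler_pdivrMr; lra.
move: au ub; rewrite vE !gE// !lee_fin => au ub.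
pose A := [set t | [/\ a <= t, t <= b & g t <= v]].
have Aa : A a by [].
have hA : has_sup A by split; [exists a|exists b => t []].
pose t := sup A.
have at_ : a <= t by apply: sup_upper_bound.
have tb : t <= b by apply: ge_sup; [exists a|move=> y []].
exists t; split=> //; rewrite gE//; congr EFin; apply/eqP; rewrite eq_le; apply/andP; split.
  apply/ler_addgt0Pr => e e0; have [dl [dl0 H]] := C t e e0.
  have [t1 [a1 b1 g1] tt1] := sup_adherent dl0 hA.
  have t1t : t1 <= t by apply: sup_upper_bound.
  have := H t1 t (ltW tt1) t1t _ tb; rewrite lerDl => /(_ (ltW dl0)); lra.
have [->//|tb'] := eqVneq t b.
apply/ler_addgt0Pr => e e0; have [dl [dl0 H]] := C t e e0.
pose t2 := Num.min b (t + dl).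
have t2b : t2 <= b by rewrite ge_min lexx.
have t2t : t < t2 by rewrite lt_min lt_neqAle tb' tb ltrDl.
have := H t t2; rewrite lerBlDr lerDl ge_min lexx orbT.
move=> /(_ (ltW dl0) (ltW t2t) isT t2b); apply: le_trans.
rewrite leNgt; apply/negP => gt.
have : t2 <= t by apply: sup_upper_bound => //; split=> //; [exact: ltW (le_lt_trans at_ t2t)|exact: ltW].
by rewrite leNgt t2t.
Qed.

Hypotheses (ppsi : forall x, p x <= psi x).

Lemma part0 : part p 0 = 0%E.
Proof.
rewrite /part (_ : (fun x => _) = cst 0%E); first exact: integral0.
apply/funext => x; congr EFin; rewrite /restr; case: asboolP => //= px.
by apply/eqP; rewrite eq_le p0 andbT; apply: le_trans px.
Qed.

Lemma part_sup (c : \bar R) : (forall k : nat, (part p k%:R <= c)%E) -> (\int[mu]_x (p x)%:E <= c)%E.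
Proof.
move=> H; have := @cvg_monotone_convergence _ _ _ mu setT measurableT
  (fun k x => (restr p (lowset k%:R) x)%:E) (fun k => mr (measurable_psi_le _))
  (fun k x _ => r0 _ x).
rewrite (_ : (\int[mu]_x limn _ = \int[mu]_x (p x)%:E)%E).
  move=> cv; rewrite -(cvg_lim (@ereal_hausdorff R) (cv _)).
    apply: lime_le; last by apply: nearW => k; exact: H.
    apply: cvgP; apply: cv.
    move=> x _ n m nm; rewrite lee_fin /restr; case: asboolP => /= h; last by case: ifP.
    by rewrite asboolT//; apply: le_trans h _; rewrite ler_nat.
  move=> x _ n m nm; rewrite lee_fin /restr; case: asboolP => /= h; last by case: ifP.
  by rewrite asboolT//; apply: le_trans h _; rewrite ler_nat.
apply: eq_integral => x _; apply/cvg_lim => //; apply: cvg_near_cst.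
exists (Num.truncn (psi x)).+1 => // k /= kx; rewrite /restr asboolT//=.
by apply: ltW; apply: lt_le_trans (truncnS_gt _) _; rewrite ler_nat.
Qed.

End thresholds.

(** The mass of [p] below [r k] is the smaller of the masses of [p] and [q] below level [k]. This
    target is symmetric in [p] and [q], so exchanging them gives a second sequence of thresholds
    with the same masses. *)
Lemma threshold_seq (psi p q : X -> R) : measurable_fun setT psi ->
  (forall t, mu (psi @^-1` [set t]) = 0%E) ->
  measurable_fun setT p -> measurable_fun setT q ->
  (forall x, 0 <= p x <= psi x) -> (forall x, 0 <= q x <= psi x) ->
  (\int[mu]_x (p x)%:E = \int[mu]_x (q x)%:E)%E ->
  exists r : nat -> R, [/\ r 0%N = 0, forall k, r k <= r k.+1, forall k, r k <= k%:R,
    forall k, part psi p (r k) = mine (part psi p k%:R) (part psi q k%:R) &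
    mu [set x | 0 < p x /\ forall k, r k < psi x] = 0%E].
Proof.
move=> mpsi psi0 mp mq pp qq pq.
have p0 x : 0 <= p x by case/andP: (pp x).
have q0 x : 0 <= q x by case/andP: (qq x).
have ppsi x : p x <= psi x by case/andP: (pp x).
have qpsi x : q x <= psi x by case/andP: (qq x).
pose u (k : nat) := mine (part psi p k%:R) (part psi q k%:R).
have natle m n : (m <= n)%N -> m%:R <= n%:R :> R by rewrite ler_nat.
have uh k : (u k <= u k.+1)%E.
  by rewrite /u le_min !ge_min !part_homo ?orbT// ?natle//.
(* A threshold exists in [[r k', k]], as the target lies between the masses of [p] below [r k'] and
   below [k]; the default 0 of [xget] is never taken. *)
pose r := fix r k := if k is k'.+1 then
  xget 0 [set t | [/\ r k' <= t, t <= k%:R & part psi p t = u k]] else 0.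
have next k : r k <= k%:R -> part psi p (r k) = u k ->
    [/\ r k <= r k.+1, r k.+1 <= k.+1%:R & part psi p (r k.+1) = u k.+1].
  move=> rk pr.
  have [||||t [t1 t2 t3]] := @part_ivt psi mpsi psi0 p mp p0 (r k) k.+1%:R k.+1%:R (u k.+1).
  - by apply: le_trans rk _; exact: natle.
  - by [].
  - by move=> x xk; exact: le_trans (ppsi x) xk.
  - by rewrite pr uh /= /u ge_min lexx.
  have : [set t | [/\ r k <= t, t <= k.+1%:R & part psi p t = u k.+1]] (r k.+1).
    by rewrite [r k.+1]/=; apply: xgetPex; exists t.
  by [].
have inv k : r k <= k%:R /\ part psi p (r k) = u k.
  elim: k => [|k [rk pr]]; last by have [] := next k rk pr.
  by split=> //; rewrite /u (part0 p0 ppsi) (part0 q0 qpsi) minxx.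
have rS k : r k <= r k.+1 by have [rk pr] := inv k; have [] := next k rk pr.
exists r; split=> //; try by move=> k; have [] := inv k.
set N := [set x | _].
have mN : measurable N.
  apply: measurableI; first exact: (measurable_set_lt (measurable_cst _) mp).
  apply: (measurable_forall_nat (P := fun k => [set x | r k < psi x])) => k.
  exact: (measurable_set_lt (measurable_cst _) mpsi).
(* A point [x0] above all thresholds makes the integrals finite: every [u k] is then at most the
   mass of [p] below [psi x0]. Finiteness permits the subtraction at the end. *)
have [[x0 Nx0]|N0] := pselect (exists x, N x); last first.
  have -> : N = set0 by apply/seteqP; split=> // x Nx; case: N0; exists x.
  exact: measure0.
(* If the masses of [p] are not all at most [c], then from some level on the minimum [u] can only be
   bounded by [c] through [q], whose integral is the same. *)
have lim (c : \bar R) : (forall k, u k <= c)%E -> (\int[mu]_x (p x)%:E <= c)%E.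
  move=> uc; have [H|/existsNP[k0 /negP]] := pselect (forall k : nat, (part psi p k%:R <= c)%E).
    exact: part_sup H.
  rewrite -ltNge => pk0; rewrite pq; apply: (part_sup mpsi mq q0) => k.
  have : (part psi q (maxn k k0)%:R <= c)%E.
    have := uc (maxn k k0); rewrite /u ge_min => /orP[|//].
    rewrite leNgt (lt_le_trans pk0)//; apply: part_homo => //.
    by apply: natle; rewrite leq_maxr.
  by apply: le_trans; apply: part_homo => //; apply: natle; rewrite leq_maxl.
pose g := part psi p (psi x0).
have gfin : (g < +oo)%E.
  have px0 : 0 <= psi x0 := le_trans (p0 x0) (ppsi x0).
  have mL : measurable (lowset psi (psi x0)) by exact: measurable_psi_le.
  apply: (@le_lt_trans _ _ ((psi x0)%:E * mu (lowset psi (psi x0)))%E).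
    by apply: restr_le => // x /= xt; exact: le_trans (ppsi x) xt.
  by rewrite ltey_eq fin_numM// fin_num_measure.
have Ig : (\int[mu]_x (p x)%:E <= g)%E.
  apply: lim => k; have [_ <-] := inv k; apply: part_homo => //.
  by apply: ltW; exact: (Nx0.2 k).
pose e := (\int[mu]_x (restr p N x)%:E)%E.
have r0 (A : set X) x : (0 <= (restr p A x)%:E)%E by rewrite lee_fin /restr; case: ifP.
have e0 : (0 <= e)%E by exact: integral_ge0.
have mr (A : set X) : measurable A -> measurable_fun setT (fun x => (restr p A x)%:E).
  by move=> mA; apply/measurable_EFinP; exact: measurable_restr.
have Ifin : (\int[mu]_x (p x)%:E)%E \is a fin_num.
  by rewrite ge0_fin_numE ?(le_lt_trans Ig)//; apply: integral_ge0 => x _; rewrite lee_fin.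
have ue k : (u k + e <= \int[mu]_x (p x)%:E)%E.
  have [_ <-] := inv k; rewrite /part -ge0_integralD//; try exact: mr.
    apply: ge0_le_integral => //.
    - by move=> x _; apply: adde_ge0.
    - by apply: emeasurable_funD; apply: mr => //; exact: measurable_psi_le.
    - exact/measurable_EFinP.
    - move=> x _; rewrite -EFinD lee_fin /restr; case: asboolP => [h1|_]; last first.
        by rewrite add0r; case: ifP.
      rewrite asboolF ?addr0//; move=> -[_ /(_ k)]; rewrite ltNge => /negP; apply; exact: h1.
  by apply: mr; exact: measurable_psi_le.
have efin : e \is a fin_num.
  rewrite ge0_fin_numE//; apply: (@le_lt_trans _ _ (\int[mu]_x (p x)%:E)%E).
    apply: le_trans (ue 0%N); rewrite leeDr//.
    have [_ <-] := inv 0%N; exact: integral_ge0.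
  by rewrite ltey_eq Ifin.
have e00 : e = 0%E.
  have : (\int[mu]_x (p x)%:E <= \int[mu]_x (p x)%:E - e)%E.
    by apply: lim => k; rewrite leeBrDr.
  rewrite leeBrDr// -[X in (_ <= X)%E]adde0 leeD2lE// => e_le0.
  by apply/eqP; rewrite eq_le e_le0.
have := (@ae_eq_integral_abs _ _ _ mu setT measurableT (fun x => (restr p N x)%:E) (mr _ mN)).1.
have -> : (\int[mu]_x `|(restr p N x)%:E| = 0)%E.
  by rewrite -e00; apply: eq_integral => x _; rewrite gee0_abs.
move=> /(_ erefl) H; apply/negligibleP => //.
apply: negligibleS H => x Nx /=; move/(_ I); rewrite /restr asboolT// => -[] E.
by have [] := Nx; rewrite E ltxx.
Qed.

(* A function with equal, possibly infinite, positive and negative integrals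
   splits into countably many bounded balanced pieces: sweep both parts at the
   same rate along the atomless level function [psi]. *)
Lemma bounded_pieces s : measurable_fun setT s -> balanced s ->
  exists Z : nat -> set X, [/\ trivIset setT Z, forall k, measurable (Z k),
    forall k x, Z k x -> s x != 0, {ae mu, forall x, (forall k, ~ Z k x) -> s x = 0} &
    forall k, balanced (restr s (Z k)) /\ exists K, forall x, `|restr s (Z k) x| <= K].
Proof.
move=> ms bs.
(* This dominates the absolute value of [s], so low levels have bounded values, and it has no atoms:
   a level set of [psi] is covered by countably many level sets of [phi]. *)
pose psi x := (Num.truncn `|s x|)%:R + 1 + phi x.
have dmt : dmeas (fun x => Num.truncn `|s x|).
  move=> n; have mabs : measurable_fun setT (fun x => `|s x|) by exact: measurableT_comp.
  rewrite (_ : _ @^-1` _ = [set x | n%:R <= `|s x|] `&` [set x | `|s x| < n.+1%:R]).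
    apply: measurableI; first exact: (measurable_set_le (measurable_cst _) mabs).
    exact: (measurable_set_lt mabs (measurable_cst _)).
  apply/seteqP; split=> x /=.
    by move=> <-; split; [rewrite truncn_le|exact: truncnS_gt].
  by move=> [h1 h2]; apply/truncn_def; rewrite h1.
have mpsi : measurable_fun setT psi.
  apply: measurable_funD => //.
  by apply: (measurable_fun_cases (F := fun n (_ : X) => (n%:R + 1 : R)) dmt).
have psi0 t : mu (psi @^-1` [set t]) = 0%E.
  have mt : measurable (psi @^-1` [set t]) by rewrite -[X in measurable X]setTI; exact: mpsi.
  apply/negligibleP => //.
  apply: (@negligibleS _ _ _ _ (\bigcup_n phi @^-1` [set t - 1 - n%:R])).
    by move=> x /= E; exists (Num.truncn `|s x|) => //=; rewrite -E /psi; ring.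
  apply: negligible_bigcup => n; apply/negligibleP; last exact: phi_atomless.
  by rewrite -[X in measurable X]setTI; exact: mphi.
have spsi x : `|s x| <= psi x.
  have /andP[ph _] := phi01 x; have := truncnS_gt `|s x|; rewrite /psi -natr1.
  by move: (Num.truncn _)%:R => a; lra.
pose p x := Num.max (s x) 0; pose q x := Num.max (- s x) 0.
have mp : measurable_fun setT p by exact: measurable_funrpos.
have mq : measurable_fun setT q by apply: measurable_funrpos; exact: measurableT_comp.
have pp x : 0 <= p x <= psi x.
  rewrite le_max lexx orbT /= ge_max (le_trans (ler_norm _) (spsi x)) /=.
  exact: le_trans (normr_ge0 _) (spsi x).
have qq x : 0 <= q x <= psi x.
  rewrite le_max lexx orbT /= ge_max (le_trans (normr_ge0 _) (spsi x)) andbT.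
  by apply: le_trans (spsi x); rewrite -normrN ler_norm.
have [r [r0 rS rk pr Np]] := threshold_seq mpsi psi0 mp mq pp qq bs.
have [r' [r'0 r'S r'k pr' Nq]] := threshold_seq mpsi psi0 mq mp qq pp (esym bs).
(* The [k]-th slice of the positive part joined with the [k]-th slice of the negative part; both
   carry the mass [u k.+1 - u k], where [u] is the common minimum in [pr] and [pr']. *)
pose Z k := [set x | (0 < p x /\ midset psi (r k) (r k.+1) x) \/
                     (0 < q x /\ midset psi (r' k) (r' k.+1) x)].
have pq x : 0 < p x -> 0 < q x -> False.
  by rewrite /p /q; case: (leP (s x) 0); case: (leP (- s x) 0); lra.
have homo (t : nat -> R) : (forall k, t k <= t k.+1) -> forall m n, (m <= n)%N -> t m <= t n.
  move=> tS m n; elim: n => [|n IH]; first by rewrite leqn0 => /eqP ->.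
  by rewrite leq_eqVlt => /predU1P[->//|/IH h]; exact: le_trans h (tS n).
have disj (t : nat -> R) : (forall k, t k <= t k.+1) -> forall m n x,
    midset psi (t m) (t m.+1) x -> midset psi (t n) (t n.+1) x -> m = n.
  move=> tS m n x [a1 a2] [b1 b2]; have [mn|nm|//] := ltngtP m n.
    by have := homo _ tS _ _ mn => h; have := le_trans a2 h; rewrite leNgt b1.
  by have := homo _ tS _ _ nm => h; have := le_trans b2 h; rewrite leNgt a1.
have mZ k : measurable (Z k).
  apply: measurableU; apply: measurableI; try exact: measurable_midset;
    exact: (measurable_set_lt (measurable_cst _)).
have found (t : nat -> R) x : (forall k, t k <= t k.+1) -> t 0%N < psi x ->
    (forall k, ~ midset psi (t k) (t k.+1) x) -> forall k, t k < psi x.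
  move=> tS t0 H; elim=> // k IH; rewrite ltNge; apply/negP => h.
  by apply: (H k).
exists Z; split=> //.
- move=> m n _ _ [x [[[px hm]|[qx hm]] [[px' hn]|[qx' hn]]]].
  + exact: (disj r rS m n x).
  + by case: (pq x).
  + by case: (pq x).
  + exact: (disj r' r'S m n x).
- move=> k x [[h _]|[h _]]; apply: contraTneq h => E; by rewrite /p /q E ?oppr0 maxxx ltxx.
- exists ([set x | 0 < p x /\ forall k, r k < psi x] `|` [set x | 0 < q x /\ forall k, r' k < psi x]).
  have mNp (t : nat -> R) (v : X -> R) : measurable_fun setT v ->
      measurable [set x | 0 < v x /\ forall k, t k < psi x].
    move=> mv; apply: measurableI; first exact: (measurable_set_lt (measurable_cst _) mv).
    apply: (measurable_forall_nat (P := fun k => [set x | t k < psi x])) => k.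
    exact: (measurable_set_lt (measurable_cst _) mpsi).
  split; [by apply: measurableU; exact: mNp|by rewrite probability_setU0 ?Np//; exact: mNp|].
  move=> x /= /not_implyP[nZ /eqP sx].
  have psi_gt : 0 < psi x by apply: lt_le_trans (spsi x); rewrite normr_gt0.
  have [s0|s0|s0] := ltgtP (s x) 0; last by rewrite s0 eqxx in sx.
    have qx : 0 < q x by rewrite /q lt_max; apply/orP; left; lra.
    right; split=> //; apply: found => //; rewrite ?r'0// => k h.
    by apply: (nZ k); right.
  have px : 0 < p x by rewrite /p lt_max s0.
  left; split=> //; apply: found => //; rewrite ?r0// => k h.
  by apply: (nZ k); left.
- move=> k; split; last first.
    exists (k.+1%:R) => x; rewrite /restr; case: asboolP => [|_]; last by rewrite normr0.
    by case=> -[_ [_ h]]; apply: le_trans (spsi x) (le_trans h _).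
  have mid (t : nat -> R) (v : X -> R) : (forall k, t k <= t k.+1) -> measurable_fun setT v ->
      (forall x, 0 <= v x <= psi x) -> (forall k, t k <= k%:R) ->
      (\int[mu]_x (restr v (midset psi (t k) (t k.+1)) x)%:E =
        part psi v (t k.+1) - part psi v (t k))%E.
    move=> tS mv vp tk.
    have v0 x : 0 <= v x by case/andP: (vp x).
    have vps x : v x <= psi x by case/andP: (vp x).
    rewrite (partD mpsi mv v0 (tS k)) addeAC subee ?add0e//.
    rewrite ge0_fin_numE; last by apply: integral_ge0 => x _; rewrite lee_fin /restr; case: ifP.
    have mL : measurable (lowset psi (t k)) by exact: measurable_psi_le.
    apply: (@le_lt_trans _ _ (k%:R%:E * mu (lowset psi (t k)))%E).
      apply: restr_le => // x /= xt; exact: le_trans (vps x) (le_trans xt (tk k)).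
    by rewrite ltey_eq fin_numM// fin_num_measure.
  rewrite /balanced (_ : ipos _ = \int[mu]_x (restr p (midset psi (r k) (r k.+1)) x)%:E)%E; last first.
    apply: eq_integral => x _; congr EFin; rewrite /restr.
    have [h|h] := pselect (midset psi (r k) (r k.+1) x).
      rewrite (asboolT h) /p; case: asboolP => // nZ.
      rewrite maxxx; apply/esym/max_idPr; rewrite leNgt; apply/negP => sx.
      by apply: nZ; left; split=> //; rewrite /p lt_max sx.
    rewrite (asboolF h); case: asboolP => [[[_ /h//]|[qx _]]|_]; last by rewrite maxxx.
    apply/max_idPr; rewrite leNgt; apply/negP => sx.
    by apply: (pq x) => //; rewrite /p lt_max sx.
  rewrite (_ : ipos _ = \int[mu]_x (restr q (midset psi (r' k) (r' k.+1)) x)%:E)%E; last first.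
    apply: eq_integral => x _; congr EFin; rewrite /restr /=.
    have [h|h] := pselect (midset psi (r' k) (r' k.+1) x).
      rewrite (asboolT h) /q; case: asboolP => // nZ.
      rewrite oppr0 maxxx; apply/esym/max_idPr; rewrite leNgt; apply/negP => sx.
      by apply: nZ; right; split=> //; rewrite /q lt_max sx.
    rewrite (asboolF h); case: asboolP => [[[px _]|[_ /h//]]|_]; last by rewrite oppr0 maxxx.
    apply/max_idPr; rewrite leNgt; apply/negP => sx.
    by apply: (pq x) => //; rewrite /q lt_max sx.
  by rewrite !mid// !pr !pr' minC [in X in (_ - X)%E]minC.
Qed.

(** The added points of [Z] become columns of height one with value zero. *)
Lemma red_extend Z1 s Z1' s' Z : red Z1 s Z1' s' -> measurable Z1 -> measurable Z -> Z1 `<=` Z ->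
  red Z s (Z1' `|` (Z `\` Z1)) s'.
Proof.
move=> [V [b [c [t sV ZZ [mZ' ms' mc s'Z] E]]]] mZ1 mZ Z1Z.
exists V, b, c; split=> //.
- rewrite (_ : _ `|` ~` Z = Z1' `|` ~` Z1)//; apply/seteqP; split=> x.
    by case=> [[|[]]|nZ]; [left|right|right=> /Z1Z].
  case=> [h|h]; first by left; left.
  by have [Zx|nZ] := pselect (Z x); [left; right|right].
- exact: supportedS sV.
- by move=> x [/ZZ/Z1Z|[]].
- split=> //; first by apply: measurableU => //; exact: measurableD.
  by move=> x nx; apply: s'Z => h; apply: nx; left.
Qed.

(** The bounded pieces are reduced separately, to the same bound [e], and glued. No bound on [s] is
    assumed, so [red_balanced] does not apply to the glued function; its balance is summed from that
    of the pieces. *)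
Lemma red_small Z s (e : R) : measurable Z -> measurable_fun setT s ->
  (forall x, ~ Z x -> s x = 0) -> balanced s -> 0 < e ->
  exists Z' s', [/\ red Z s Z' s', balanced s' & forall x, `|s' x| <= e].
Proof.
move=> mZ ms sZ bs e0.
have [P [tP mP Pn0 Pae Pb]] := bounded_pieces ms bs.
have /choice[Z' /choice[s' H]] k : exists Z' s',
    [/\ red (P k) (restr s (P k)) Z' s', balanced s' & forall x, `|s' x| <= e].
  have [bk [K sK]] := Pb k; apply: red_bounded sK e0 => //; first exact: measurable_restr.
  by move=> x nP; rewrite /restr asboolF.
pose U := \bigcup_k P k.
have mU : measurable U by exact: bigcupT_measurable.
pose s0 := restr s U; pose j := least P; pose s1 x := s' (j x) x.
have jP k x : P k x -> j x = k.
  move=> Px; have [Pj _] := leastP (ex_intro (fun k => P k x) k Px).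
  by apply: tP => //; exists x.
have r0 : red U s0 (\bigcup_k Z' k) s1.
  apply: red_glue => //; first exact: measurable_restr.
    by move=> x nP; rewrite /s0 /restr asboolF// => -[k _ /nP].
  move=> k; have [+ _ _] := H k; rewrite (_ : restr s0 (P k) = restr s (P k))//.
  apply/funext => x; rewrite /restr /s0; case: asboolP => // Px.
  by rewrite /restr asboolT//; exists k.
have UZ : U `<=` Z.
  by move=> x [k _ Px]; apply: contrapT => /sZ /eqP; apply/negP; exact: (Pn0 k).
have [V [b [c [t sV ZZ [mZ' ms1 mc s1Z] E]]]] := red_extend r0 mU mZ UZ.
exists ((\bigcup_k Z' k) `|` (Z `\` U)), s1; split.
- exists V, b, c; split=> //.
  apply: filterS2 E Pae => x <- H0; rewrite /s0 /restr; case: asboolP => // nU.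
  by apply: H0 => k Px; apply: nU; exists k.
- have sZ' k x : ~ P k x -> s' k x = 0.
    have [[V' [b' [c' [_ _ ZP [_ _ _ h] _]]]] _ _] := H k.
    by move=> nP; apply: h => /ZP.
  (* The pieces [P k] are disjoint and carry all of [s1]; the sign [sg] serves both parts. *)
  have split (sg : R) : measurable_fun setT (fun x => sg * s1 x) ->
      ipos (fun x => sg * s1 x) = (\sum_(0 <= k <oo) ipos (fun x => sg * s' k x)%R)%E.
    move=> msg; rewrite /ipos.
    transitivity (\int[mu]_(x in U) (Num.max (sg * s1 x) 0)%:E)%E.
      rewrite [RHS]integral_mkcond; apply: eq_integral => x _; rewrite patchE.
      case: ifPn => // /negP nU; rewrite /s1 sZ' ?mulr0 ?maxxx// => Px.
      by apply: nU; rewrite inE; exists (j x).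
    rewrite ge0_integral_bigcup//; last 2 first.
    - by apply: measurable_funTS; exact: measurable_pos.
    - by move=> x _; rewrite lee_fin le_max lexx orbT.
    apply: eq_eseriesr => k _; rewrite integral_mkcond; apply: eq_integral => x _.
    rewrite patchE; case: ifPn => [|/negP nP].
      by rewrite inE => Px; rewrite /s1 (jP _ _ Px).
    by rewrite sZ' ?mulr0 ?maxxx// => Px; apply: nP; rewrite inE.
  have E1 : s1 = fun x => 1 * s1 x by apply/funext => x; rewrite mul1r.
  have E2 : \- s1 = fun x => -1 * s1 x by apply/funext => x; rewrite mulN1r.
  rewrite /balanced E2 {1}E1 !split; last 2 first.
  + by rewrite -E2; exact: measurableT_comp.
  + by rewrite -E1.
  apply: eq_eseriesr => k _; have [_ + _] := H k; rewrite /balanced.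
  have -> : \- s' k = fun x => -1 * s' k x by apply/funext => x; rewrite mulN1r.
  by move=> <-; congr ipos; apply/funext => x; rewrite mul1r.
- by move=> x; rewrite /s1; have [_ _ ->] := H (j x).
Qed.

(** The inverse of the first return map [sg] is the first return map for backward time: no visit to
    [Z] lies strictly between a point and its return, so the two return times agree. *)
Lemma first_return (Z M : set X) : measurable Z -> measurable M ->
  (forall n x, M (zit n x) <-> M x) ->
  (forall x, ~ M x -> forall k : int,
      (exists n, Z (zit (k + Posz n) x)) /\ (exists n, Z (zit (k - Posz n) x))) ->
  exists sg sg', [/\ FG sg, cancel sg sg', cancel sg' sg, supported sg (Z `\` M) &
    forall x, Z x -> ~ M x -> exists r : nat, [/\ sg x = zit (Posz r.+1) x, Z (sg x) &
      forall i : nat, (0 < i <= r)%N -> ~ Z (zit (Posz i) x)]].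
Proof.
move=> mZ mM iM vis.
pose r := least (fun k => zit (Posz k.+1) @^-1` Z).
pose r' := least (fun k => zit (- Posz k.+1) @^-1` Z).
have mG : measurable (Z `\` M) by exact: measurableD.
pose sg x := if `[< (Z `\` M) x >] then zit (Posz (r x).+1) x else x.
pose sg' x := if `[< (Z `\` M) x >] then zit (- Posz (r' x).+1) x else x.
have rP x : ~ M x -> Z (zit (Posz (r x).+1) x) /\ forall k, Z (zit (Posz k.+1) x) -> (r x <= k)%N.
  move=> nM; have [[n Zn] _] := vis x nM 1.
  apply: (leastP (P := fun k => zit (Posz k.+1) @^-1` Z)); exists n.
  by rewrite /preimage [mkset _ _](_ : _ = Z (zit (1 + Posz n) x))//; congr (Z (zit _ _)); lia.
have r'P x : ~ M x -> Z (zit (- Posz (r' x).+1) x) /\ forall k, Z (zit (- Posz k.+1) x) -> (r' x <= k)%N.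
  move=> nM; have [_ [n Zn]] := vis x nM (-1).
  apply: (leastP (P := fun k => zit (- Posz k.+1) @^-1` Z)); exists n.
  by rewrite /preimage [mkset _ _](_ : _ = Z (zit (-1 - Posz n) x))//; congr (Z (zit _ _)); lia.
have K : cancel sg sg'.
  move=> x; rewrite /sg; case: asboolP => [[Zx nM]|nG]; last by rewrite /sg' asboolF.
  have [Zy my] := rP x nM; set y := zit _ x in Zy *.
  have nMy : ~ M y by rewrite iM.
  have [Zz mz] := r'P y nMy.
  rewrite /sg' asboolT//; suff -> : r' y = r x by rewrite /y zitK.
  have le1 : (r' y <= r x)%N by apply: mz; rewrite /y zitK.
  apply/eqP; rewrite eqn_leq le1 /= leqNgt; apply/negP => lt.
  have : (r x <= r x - (r' y).+1)%N; last by lia.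
  apply: my; move: Zz lt; rewrite /y -zitD => Zz lt.
  by move: Zz; congr (Z (zit _ _)); lia.
have K' : cancel sg' sg.
  move=> x; rewrite /sg'; case: asboolP => [[Zx nM]|nG]; last by rewrite /sg asboolF.
  have [Zy my] := r'P x nM; set y := zit _ x in Zy *.
  have nMy : ~ M y by rewrite iM.
  have [Zz mz] := rP y nMy.
  rewrite /sg asboolT//; suff -> : r y = r' x by rewrite /y zitNK.
  have le1 : (r y <= r' x)%N by apply: mz; rewrite /y zitNK.
  apply/eqP; rewrite eqn_leq le1 /= leqNgt; apply/negP => lt.
  have : (r' x <= r' x - (r y).+1)%N; last by lia.
  apply: my; move: Zz lt; rewrite /y -zitD => Zz lt.
  by move: Zz; congr (Z (zit _ _)); lia.
exists sg, sg'; split=> //.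
- split; first by exists sg'.
  apply: (PW_cases (u := fun k x => if k then zit (Posz (r x).+1) x else x) (dmeas_bool mG)) => -[].
    apply: (PW_cases (u := fun k x => zit (Posz k.+1) x)) => [|k]; last exact: PW_zit.
    by apply: dmeas_least => k; exact: (zit_preimage _ mZ).1.
  exact: PW_id.
- by move=> x nG; rewrite /sg asboolF.
- move=> x Zx nM; exists (r x); rewrite /sg asboolT//.
  have [Zr mr] := rP x nM; split=> //.
  by move=> [//|i] /= ir /mr; lia.
Qed.

(** * Refining the cycles *)

Section columns.
Variables (Z D M : set X).
Hypotheses (mZ : measurable Z) (mD : measurable D) (mM : measurable M) (DZ : D `<=` Z).
Hypothesis iM : forall n x, M (zit n x) <-> M x.
Hypothesis visD : forall x, ~ M x -> forall k : int,
  (exists n, D (zit (k + Posz n) x)) /\ (exists n, D (zit (k - Posz n) x)).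

(** The time elapsed since the last visit to [D]. *)
Let kD := least (fun k => zit (- Posz k) @^-1` D).

Let kDP x : ~ M x -> D (zit (- Posz (kD x)) x) /\
  forall k, D (zit (- Posz k) x) -> (kD x <= k)%N.
Proof.
move=> nM; have [_ [n Dn]] := visD nM 0; rewrite sub0r in Dn.
exact: (leastP (P := fun k => zit (- Posz k) @^-1` D) (ex_intro _ n Dn)).
Qed.

Let kD_unique x j : ~ M x -> D (zit (- Posz j) x) ->
  (forall i, (i < j)%N -> ~ D (zit (- Posz i) x)) -> kD x = j.
Proof.
move=> nM Dj ni; have [Dk mk] := kDP nM.
apply/eqP; rewrite eqn_leq mk//= leqNgt; apply/negP => kj; exact: (ni _ kj).
Qed.

Let kD_shift x (m : nat) : ~ M x -> (forall i : nat, (0 < i <= m)%N -> ~ D (zit (Posz i) x)) ->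
  kD (zit (Posz m) x) = (m + kD x)%N.
Proof.
move=> nM nD; have [Dk mk] := kDP nM.
have E (i : nat) : zit (- Posz i) (zit (Posz m) x) = zit (Posz m - Posz i) x.
  by rewrite -zitD; congr (zit _ _); lia.
apply: kD_unique; first by rewrite iM.
  by rewrite E; move: Dk; congr (D (zit _ _)); lia.
move=> i im; rewrite E; have [lt|le] := ltnP i m.
  rewrite (_ : Posz m - Posz i = Posz (m - i)%N); last by lia.
  by apply: nD; lia.
move=> Di; have : (kD x <= i - m)%N; last by lia.
by apply: mk; move: Di; congr (D (zit _ _)); lia.
Qed.

(** [V] makes a first return to [Z] and, if this lands in [D], goes back by the inverse first return
    to [D]. Its cycles are the stretches of [Z] between consecutive visits to [D], based at the last
    visit, so an orbit segment that avoids [D] stays in one cycle. *)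
Lemma columns : exists V b, [/\ tiling V (((D `\` M) `|` (Z `&` M)) `|` ~` Z) b, supported V Z &
  forall x (m : nat), Z x -> ~ M x -> Z (zit (Posz m) x) ->
    (forall i : nat, (0 < i <= m)%N -> ~ D (zit (Posz i) x)) -> b (zit (Posz m) x) = b x].
Proof.
have visZ x : ~ M x -> forall k : int,
    (exists n, Z (zit (k + Posz n) x)) /\ (exists n, Z (zit (k - Posz n) x)).
  by move=> nM k; have [[n /DZ ?] [m /DZ ?]] := visD nM k; split; [exists n|exists m].
have [sg [sg' [Fsg sK sK' ssg sgP]]] := first_return mZ mM iM visZ.
have [tu [tu' [Ftu tK tK' stu tuP]]] := first_return mD mM iM visD.
have mG : measurable (Z `\` M) by exact: measurableD.
have Ftu' : FG tu' by exact: FG_inv Ftu tK tK'.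
have tu'i : injective tu' := can_inj tK'.
have stu' : supported tu' (D `\` M) by move=> x nD; rewrite -{1}(stu _ nD) tK.
have DM : D `\` M `<=` Z `\` M by move=> x [/DZ].
pose b x := if `[< (Z `\` M) x >] then zit (- Posz (kD x)) x else x.
pose V := tu' \o sg.
have VG x : ~ (Z `\` M) x -> V x = x.
  by move=> nG; rewrite /V /= (ssg _ nG) stu'// => /DM.
have shift x (m : nat) : Z x -> ~ M x -> Z (zit (Posz m) x) ->
    (forall i : nat, (0 < i <= m)%N -> ~ D (zit (Posz i) x)) -> b (zit (Posz m) x) = b x.
  move=> Zx nM Zm nD; rewrite /b !asboolT//; last by split; rewrite ?iM.
  by rewrite kD_shift// -zitD; congr (zit _ _); lia.
have step x : Z x -> ~ M x -> ~ D (sg x) -> (V x = sg x /\ b (sg x) = b x) /\ (kD x < kD (sg x))%N.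
  move=> Zx nM nD; have [r [E Zs nZ]] := sgP x Zx nM.
  have nDi (i : nat) : (0 < i <= r.+1)%N -> ~ D (zit (Posz i) x).
    move=> /andP[i0]; rewrite leq_eqVlt => /predU1P[->|ir]; first by rewrite -E.
    by move/DZ; apply: nZ; rewrite i0.
  split; last by rewrite E (kD_shift nM nDi) addSn ltnS leq_addl.
  split; first by rewrite /V /= stu' // => -[].
  by rewrite E; apply: shift => //; rewrite -E.
have binv x : b (V x) = b x.
  have [[Zx nM]|nG] := pselect ((Z `\` M) x); last by rewrite VG.
  have [Dy|nD] := pselect (D (sg x)); last by have [[-> ->]] := step x Zx nM nD.
  have [r [E Zs nZ]] := sgP x Zx nM.
  have nMy : ~ M (sg x) by rewrite E iM.
  have Gy : (D `\` M) (sg x) by [].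
  have [Dw nMw] := supported_in tu'i stu' Gy.
  have [q [Eq _ nDq]] := tuP _ Dw nMw; rewrite tK' in Eq.
  change (b (tu' (sg x)) = b x); move: (tu' (sg x)) Dw nMw Eq nDq => w Dw nMw Eq nDq.
  (* [sg x] is reached [q.+1] steps after the previous point [w] of [D] and [r.+1] steps after [x],
     so [w] should be the base of [x]. *)
  have xw : x = zit (Posz q - Posz r) w.
    apply: (can_inj (zitK (Posz r.+1))); rewrite -zitD -E Eq; congr (zit _ _); lia.
  have wx : w = zit (Posz r - Posz q) x.
    by rewrite xw -zitD (_ : _ + _ = 0) ?zit0//; lia.
  have rq : (r <= q)%N.
    rewrite leqNgt; apply/negP => qr; apply: (nZ (r - q)%N); first by lia.
    move: (DZ Dw); rewrite {1}wx; congr (Z (zit _ _)); lia.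
  have kx : kD x = (q - r)%N.
    apply: kD_unique => //; first by move: Dw; rewrite {1}wx; congr (D (zit _ _)); lia.
    move=> i ir; rewrite xw -zitD => Di; apply: (nDq (q - r - i)%N); first by lia.
    by move: Di; congr (D (zit _ _)); lia.
  have kw : kD w = 0%N by apply: kD_unique => //; rewrite zit0.
  rewrite /b !asboolT//; last exact: DM.
  by rewrite kx kw oppr0 zit0 {1}wx; congr (zit _ _); lia.
have reach n : forall x, Z x -> ~ M x -> (kD x < n)%N -> exists i, x = iter i V (b x).
  elim: n => // n IH x Zx nM kn.
  have [Dx|nD] := pselect (D x).
    exists 0%N; rewrite /= /b asboolT// (_ : kD x = 0%N) ?oppr0 ?zit0//.
    by apply: kD_unique => //; rewrite oppr0 zit0.
  have ssg' : supported sg' (Z `\` M) by move=> y nG; rewrite -{1}(ssg _ nG) sK.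
  have [Zy nMy] := supported_in (can_inj sK') ssg' (conj Zx nM).
  have nDs : ~ D (sg (sg' x)) by rewrite sK'.
  have [[VE bE] kE] := step _ Zy nMy nDs; rewrite sK' in VE bE kE.
  have [i Ei] := IH (sg' x) Zy nMy (leq_trans kE kn).
  by exists i.+1; rewrite /= bE -Ei VE.
exists V, b; split=> //; last by move=> x nZ; apply: VG => -[].
split.
- exact: FG_comp.
- apply: (PW_cases (u := fun k x => if k then zit (- Posz (kD x)) x else x) (dmeas_bool mG)) => -[].
    apply: (PW_cases (u := fun k x => zit (- Posz k) x)) => [|k]; last exact: PW_zit.
    by apply: dmeas_least => k; exact: (zit_preimage _ mD).1.
  exact: PW_id.
- apply: measurableU; last exact: measurableC.
  by apply: measurableU; [exact: measurableD|exact: measurableI].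
- move=> x; rewrite /b; case: asboolP => [[Zx nM]|nG].
    by left; left; have [Dk _] := kDP nM; split=> //; rewrite iM.
  have [Zx|nZ] := pselect (Z x); last by right.
  by left; right; split=> //; apply: contrapT => nM; apply: nG.
- move=> x Yx; rewrite /b; case: asboolP => // -[Zx nM].
  case: Yx => [[[Dx _]|[_ /nM]]|/(_ Zx)]//.
  by rewrite (_ : kD x = 0%N) ?oppr0 ?zit0//; apply: kD_unique => //; rewrite oppr0 zit0.
- exact: binv.
- move=> x; have [[Zx nM]|nG] := pselect ((Z `\` M) x); first exact: (reach (kD x).+1).
  by exists 0%N; rewrite /b asboolF.
Qed.

End columns.

(* Near the least point where [phi] starts charging [Z]. *)
Lemma shrinking_sets Z : measurable Z -> (0 < mu Z)%E ->
  exists D : nat -> set X, [/\ forall n, measurable (D n), forall n, D n `<=` Z,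
    forall n, (0 < mu (D n))%E, forall m n, (m <= n)%N -> D n `<=` D m &
    forall x, exists n, ~ D n x].
Proof.
move=> mZ Z0.
pose L (t : R) := Z `&` [set x | phi x <= t].
have mL t : measurable (L t) by apply: measurableI => //; exact: measurable_psi_le.
pose E := [set t : R | mu (L t) = 0%E].
have E1 t : E t -> t <= 1.
  move=> Et; rewrite leNgt; apply/negP => t1; move: Z0; rewrite (_ : Z = L t).
    by rewrite [mu _]Et ltxx.
  apply/seteqP; split=> [x Zx|x []//]; split=> //=.
  by have /andP[_ p1] := phi01 x; exact: (le_trans p1 (ltW t1)).
have E0 : E 0.
  apply/eqP; rewrite eq_le measure_ge0 andbT -(phi_atomless 0).
  apply: probability_le => //; first by rewrite -[X in measurable X]setTI; exact: mphi.
  move=> x [_ /= p0]; have /andP[p0' _] := phi01 x.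
  by apply/eqP; rewrite eq_le p0 p0'.
have hE : has_sup E by split; [exists 0|exists 1 => t /E1].
pose t := sup E.
(* The supremum is attained because the level [t] of [phi] is null; hence every slice just above [t]
   has positive measure. *)
have Lt0 : mu.-negligible (L t).
  apply: (@negligibleS _ _ _ mu (phi @^-1` [set t] `|` \bigcup_n L (t - n.+1%:R^-1))).
    move=> x [Zx /= pt]; move: pt; rewrite le_eqVlt => /predU1P[->|lt]; first by left.
    right; have [n n0] := @inv_nat_le (t - phi x) ltac:(lra).
    by exists n => //; split=> //=; rewrite lerBrDr -lerBrDl.
  apply: negligibleU.
    apply/negligibleP; last exact: phi_atomless.
    by rewrite -[X in measurable X]setTI; exact: mphi.
  apply: negligible_bigcup => n; apply/negligibleP => //.
  have n0 : (0 : R) < n.+1%:R^-1 by rewrite invr_gt0.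
  have [u Eu ut] := sup_adherent n0 hE.
  apply/eqP; rewrite eq_le measure_ge0 andbT -[X in (_ <= X)%E]Eu.
  by apply: probability_le => // x [Zx /= px]; split=> //=; apply: le_trans px _; exact: ltW.
have mLt0 : mu (L t) = 0%E by apply/negligibleP.
exists (fun n => L (t + n.+1%:R^-1) `\` L t); split.
- by move=> n; exact: measurableD.
- by move=> n x [[]].
- move=> n; rewrite probability_setD0// lt_neqAle measure_ge0 andbT eq_sym; apply/eqP => En.
  have : t + n.+1%:R^-1 <= t by apply: (sup_ubound hE.2).
  by rewrite gerDl leNgt invr_gt0 ltr0Sn.
- move=> m n mn x [[Zx /= px] nL]; split=> //; split=> //=; apply: le_trans px _.
  by rewrite lerD2l lef_pV2 ?posrE// ler_nat.
- move=> x; have [lt|le] := leP (phi x) t.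
    by exists 0%N => -[[Zx _]]; apply.
  have p0 : 0 < phi x - t by lra.
  have [n n0] := @inv_nat_le ((phi x - t) / 2) ltac:(lra).
  exists n => -[[_ /= px] _]; move: p0 n0 px; clear; move: (_^-1) => q; lra.
Qed.

(* Greedy: as long as the total stays in [-e, e], some remaining term can be
   added without leaving [-e, e]. *)
Lemma bounded_reordering (I : eqType) (a : I -> R) (e : R) (n : nat) : forall (l : seq I) (t : R),
  (size l <= n)%N -> (forall x : I, x \in l -> `|a x| <= e) -> `|t| <= e -> `|t + \sum_(x <- l) a x| <= e ->
  exists p, perm_eq p l /\ forall i, `|t + \sum_(x <- take i p) a x| <= e.
Proof.
elim: n => [|n IH] l t; first by case: l => // _ _ t1 _; exists [::]; split=> // i; rewrite big_nil addr0.
case: l => [|x0 l] sz ae te tot; first by exists [::]; split=> // i; rewrite big_nil addr0.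
suff [x xl xe] : exists2 x : I, x \in x0 :: l & `|t + a x| <= e.
  have pl := perm_to_rem xl.
  have [] := IH (rem x (x0 :: l)) (t + a x) _ _ xe.
  - by rewrite size_rem.
  - by move=> y /mem_rem; exact: ae.
  - by move: tot; rewrite (perm_big _ pl) big_cons addrA.
  move=> p [pp pe]; exists (x :: p); split.
    by rewrite (perm_trans _ (_ : perm_eq (x :: rem x (x0 :: l)) _))// ?perm_cons// perm_sym.
  by case=> [|i] /=; [rewrite big_nil addr0|rewrite big_cons addrA].
(* If every remaining term overshoots, then all of them push away from zero on the side of [t], and
   so would the total. *)
apply: contrapT => none.
have bad (x : I) : x \in x0 :: l -> ~~ (`|t + a x| <= e).
  by move=> xl; apply/negP => xe; apply: none; exists x.
have [t0|t0] := leP 0 t.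
  have pos (x : I) : x \in x0 :: l -> e < t + a x.
    move=> xl; have := bad x xl; have := ae x xl; rewrite !ler_norml => /andP[h1 h2].
    by move: te; rewrite ler_norml => /andP[h3 h4]; rewrite negb_and -!ltNge => /orP[]; lra.
  have sum0 : 0 <= \sum_(x <- l) a x.
    rewrite big_seq; apply: sumr_ge0 => x xl.
    by have := pos x; rewrite inE xl orbT => /(_ isT); move: te; rewrite ler_norml => /andP[_]; lra.
  have := pos x0 (mem_head _ _); move: tot; rewrite big_cons ler_norml => /andP[_]; lra.
have neg (x : I) : x \in x0 :: l -> t + a x < - e.
  move=> xl; have := bad x xl; have := ae x xl; rewrite !ler_norml => /andP[h1 h2].
  by move: te; rewrite ler_norml => /andP[h3 h4]; rewrite negb_and -!ltNge => /orP[]; lra.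
have sum0 : \sum_(x <- l) a x <= 0.
  rewrite big_seq; apply: sumr_le0 => x xl.
  by have := neg x; rewrite inE xl orbT => /(_ isT); move: te; rewrite ler_norml => /andP[+ _]; lra.
have := neg x0 (mem_head _ _); move: tot; rewrite big_cons ler_norml => /andP[+ _]; lra.
Qed.

Section reordering.
Variables (W W' : X -> X) (Y : set X) (b : X -> X).
Hypotheses (tW : tiling W Y b) (WK : cancel W W') (WK' : cancel W' W).

Let l := lvl Y W'.
Definition height z := (l (W' z)).+1.

Let iterWK k x : iter k W' (iter k W x) = x := iterVK WK k x.

Let iter_sub i k x : (i <= k)%N -> iter i W' (iter k W x) = iter (k - i) W x.
Proof. by move=> ik; rewrite -{1}(subnKC ik) iterD iterWK. Qed.

Lemma iter_height z : Y z -> iter (height z) W z = z.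
Proof.
move=> Yz; have := lvl_iter tW WK WK' (W' z).
by rewrite -(tl_inv tW) WK' (tl_fix tW Yz) /height /= => ->; rewrite WK'.
Qed.

Lemma lvl_iterE z k : Y z -> (k < height z)%N -> l (iter k W z) = k.
Proof.
move=> Yz kh; have [] := lvlP tW WK WK' (iter k W z); rewrite -/l.
set j := l _ => Ey my.
have lk : (j <= k)%N by rewrite leqNgt; apply/negP => /my; rewrite iterWK.
apply/eqP; rewrite eqn_leq lk /= leqNgt; apply/negP => ly.
have : iter (k - j) W z = z.
  apply: (tl_ret tW Yz); rewrite -iter_sub// Ey; exact: (tl_base tW).
case E : (k - j)%N => [|i]; first by lia.
move=> /= Wz; have Ez : iter i W z = W' z by rewrite -[LHS]WK; congr W'.
have [_ /(_ i)] := lvlP tW WK WK' (W' z); rewrite -{2}Ez iterWK; apply=> //.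
by move: kh; rewrite /height -/l; lia.
Qed.

Lemma lvl_lt x : (l x < height (b x))%N.
Proof.
rewrite ltnNge; apply/negP => hl.
have Yb := tl_base tW x.
have [_ H] := lvlP tW WK WK' x; have := lvl_iter tW WK WK' x; rewrite -/l in H *.
rewrite -(subnK hl) iterD (iter_height Yb) => Ex.
apply: (H (l x - height (b x))%N); first by move: hl; rewrite /height; lia.
by rewrite (_ : iter _ W' x = b x)// -[RHS](iterWK (l x - height (b x))) Ex.
Qed.

Lemma tsum_iter s z : Y z -> tsum Y W' s z = \sum_(0 <= k < height z) s (iter k W z).
Proof.
move=> Yz; rewrite /tsum asboolT// big_mkord (reindex_inj rev_ord_inj) /=.
apply: eq_bigr => k _; congr s; rewrite -iterS subnSK ?ltn_ord//.
have kh : (k <= height z)%N by apply: ltnW; exact: ltn_ord.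
by rewrite -/l -/(height z) -{3}(iter_height Yz) iter_sub ?leq_subr// subKn.
Qed.

Variables (s : X -> R) (e : R) (M : set X).
Hypotheses (ms : measurable_fun setT s) (mM : measurable M) (e0 : 0 <= e) (se : forall x, `|s x| <= e).
Hypothesis iM : forall n x, M (zit n x) <-> M x.
Hypothesis te : forall z, ~ M z -> `|tsum Y W' s z| <= e.

(** An admissible order of the levels in the column over [z]. Level 0 comes first so that the base
    stays the same; on the null set [M], where totals are not controlled, every such order is
    accepted. *)
Let good (p : seq nat) : set X := [set z | perm_eq p (iota 0 (height z)) /\ nth 0%N p 0 = 0%N /\
  (~ M z -> forall i : nat, `|\sum_(k <- take i p) s (iter k W z)| <= e)].

Let dheight : dmeas height.
Proof.
apply: (dmeas_comp succn); apply: (PW_dmeas (u := W')); last exact: (lvl_dmeas tW WK WK').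
by have [] := FG_inv (tl_FG tW) WK WK'.
Qed.

Let mgood p : measurable (good p).
Proof.
apply: measurableI.
  exact: (dmeas_preimage [set h | perm_eq p (iota 0 h)] dheight).
apply: (@measurable_prop_and _ _ _ [set z | ~ M z -> forall i : nat,
  `|\sum_(k <- take i p) s (iter k W z)| <= e]).
rewrite (_ : mkset _ =
  M `|` [set z | forall i : nat, `|\sum_(k <- take i p) s (iter k W z)| <= e]).
  apply: measurableU => //.
  apply: (measurable_forall_nat (P := fun i => [set z | `|\sum_(k <- take i p) s (iter k W z)| <= e])) => i.
  apply: measurable_set_le => //; apply: measurableT_comp => //; apply: measurable_sum => k.
  exact: (measurableT_comp ms (PW_fun (PW_iter k (tl_FG tW).2))).
apply/seteqP; split=> [z H|z [Mz /(_ Mz)|H _]]//.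
by have [Mz|nM] := pselect (M z); [left|right; exact: H].
Qed.

Let order_exists z : Y z -> exists p, good p z.
Proof.
move=> Yz; have [Mz|nM] := pselect (M z).
  by exists (iota 0 (height z)).
have [||||p [pp pe]] := @bounded_reordering _ (fun k => s (iter k W z)) e (height z).-1 (iota 1 (height z).-1) (s z).
- by rewrite size_iota.
- by move=> x _; exact: se.
- exact: se.
- have := te nM; rewrite (tsum_iter _ Yz) big_ltn//.
  by rewrite /index_iota subn1.
exists (0%N :: p); split; first by rewrite /height -[iota _ _]/(0%N :: iota 1 _) perm_cons.
split=> // _ [|i]; first by rewrite big_nil normr0.
by rewrite /= big_cons; exact: pe.
Qed.

(** Measurable selection: finite sequences are countable, and the order with the least code is
    taken. *)
Let index_of := least (fun n => [set z | Y z -> if unpickle n is Some p then good p z else False]).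

Let order (z : X) : seq nat := odflt [::] (unpickle (index_of z)).

Let dorder : dmeas order.
Proof.
apply: (dmeas_comp (fun n => odflt [::] (unpickle n))); apply: dmeas_least => n.
rewrite (_ : mkset _ = ~` Y `|` (if unpickle n is Some p then good p else set0)).
  have mo (o : option (seq nat)) : measurable (if o is Some p then good p else set0).
    by case: o => // p; exact: mgood.
  have := measurableU _ _ (measurableC (tl_meas tW)) (mo (unpickle n)); exact.
apply/seteqP; split=> x /=.
  by move=> H; have [Yx|] := pselect (Y x); [right; move: (H Yx); case: unpickle|left].
by case=> // + _; case: unpickle.
Qed.

Let orderP z : Y z -> good (order z) z.
Proof.
move=> Yz; have [p gp] := order_exists Yz.
have [|+ _] := leastP (P := fun n => [set z | Y z -> if unpickle n is Some p then good p z else False]) (x := z).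
  exists (pickle p); change (Y z -> if unpickle (pickle p) is Some q then good q z else False).
  by rewrite pickleK.
move=> /(_ Yz); rewrite /order -/index_of.
by case: (unpickle (index_of z)).
Qed.

Let mem_order x : l x \in order (b x).
Proof.
have [/perm_mem -> _] := orderP (tl_base tW x).
by rewrite mem_iota /= add0n lvl_lt.
Qed.

Let uniq_order z : Y z -> uniq (order z).
Proof. by move=> Yz; have [/perm_uniq -> _] := orderP Yz; exact: iota_uniq. Qed.

(** A move within a column that changes only the level; [next] and [prev] along the chosen order
    give mutually inverse maps. *)
Let jump (f : seq nat -> nat -> nat) (x : X) := iter (f (order (b x)) (l x)) W (b x).

Let jumpP f x : f (order (b x)) (l x) \in order (b x) ->
  b (jump f x) = b x /\ l (jump f x) = f (order (b x)) (l x).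
Proof.
have Yb := tl_base tW x; have [/perm_mem pm _] := orderP Yb.
move=> fm; split; first by rewrite /jump (tl_iter tW) (tl_fix tW Yb).
by apply: lvl_iterE => //; move: fm; rewrite pm mem_iota.
Qed.

(** [V] runs through each column cyclically in its new order, and [- c x] is the sum of [s] over the
    points that precede [x], a partial sum of the reordered terms. Bases and column totals are those
    of [W]. *)
Lemma reordering : exists V c, [/\ tiling V Y b, (forall x, W x = x -> V x = x),
  measurable_fun setT (c : X -> R), (forall x, Y x -> c x = 0) &
  (forall x, s x = c x - c (V x) + tsum Y W' s (V x)) /\ forall x, ~ M x -> `|c x| <= e].
Proof.
pose V := jump (@next nat); pose V' := jump (@prev nat).
pose pre x := take (index (l x) (order (b x))) (order (b x)).
pose c x := - \sum_(k <- pre x) s (iter k W (b x)).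
have nextm x : next (order (b x)) (l x) \in order (b x) by rewrite mem_next mem_order.
have prevm x : prev (order (b x)) (l x) \in order (b x) by rewrite mem_prev mem_order.
have VK : cancel V V'.
  move=> x; have [bV lV] := jumpP (nextm x); rewrite {1}/V' /jump bV lV prev_next.
    exact: (lvl_iter tW WK WK').
  exact/uniq_order/(tl_base tW).
have VK' : cancel V' V.
  move=> x; have [bV lV] := jumpP (prevm x); rewrite {1}/V /jump bV lV next_prev.
    exact: (lvl_iter tW WK WK').
  exact/uniq_order/(tl_base tW).
have Pb := tl_PW tW.
have dl : dmeas l by exact: (lvl_dmeas tW WK WK').
have dob : dmeas (order \o b) by exact: (PW_dmeas Pb dorder).
have order0 z : Y z -> nth 0%N (order z) 0 = 0%N by move=> /orderP[_ []].
have order_sz z : Y z -> size (order z) = height z.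
  by move=> /orderP[/perm_size ->]; rewrite size_iota.
have order_nth z i : Y z -> (i.+1 < height z)%N ->
    next (order z) (nth 0%N (order z) i) = nth 0%N (order z) i.+1.
  move=> Yz ih; have sz := order_sz z Yz.
  rewrite next_nth mem_nth ?sz 1?ltnW// index_uniq ?sz 1?ltnW ?uniq_order//.
  by case: (order z) sz => [|y p]//= sz; apply: set_nth_default; lia.
have l0 x : Y x -> l x = 0%N by exact: (lvl0 tW WK WK').
have lY x : l x = 0%N -> Y x.
  by move=> lx; have := lvl_iter tW WK WK' x; rewrite -/l lx /= => <-; exact: (tl_base tW).
have idx0 z : Y z -> index 0%N (order z) = 0%N.
  by move=> Yz; have := order0 z Yz; have := order_sz z Yz; case: (order z) => //= a p _ ->; rewrite eqxx.
have c0 x : Y x -> c x = 0.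
  by move=> Yx; rewrite /c /pre (tl_fix tW Yx) (l0 _ Yx) idx0// take0 big_nil oppr0.
exists V, c; split=> //.
- split.
  + split; first by exists V'.
    apply: (PW_cases (j := fun x => next (order (b x)) (l x)) (u := fun k => iter k W \o b)).
      exact: (dmeas_comp2 (@next nat) dob dl).
    by move=> k; exact: (PW_comp (PW_iter k (tl_FG tW).2) Pb).
  + exact: Pb.
  + exact: (tl_meas tW).
  + exact: (tl_base tW).
  + exact: (tl_fix tW).
  + by move=> x; have [] := jumpP (nextm x).
  + move=> x; have Yb := tl_base tW x.
    have step i : (i < height (b x))%N -> iter i V (b x) = iter (nth 0%N (order (b x)) i) W (b x).
      elim: i => [|i IH] ih; first by rewrite order0.
      rewrite iterS IH 1?ltnW//; set y := iter _ W _.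
      have by_ : b y = b x by rewrite /y (tl_iter tW) (tl_fix tW Yb).
      rewrite /V /jump by_ lvl_iterE ?order_nth//.
      have [/perm_mem pm _] := orderP Yb.
      have : nth 0%N (order (b x)) i \in order (b x) by rewrite mem_nth ?order_sz 1?ltnW.
      by rewrite pm mem_iota.
    exists (index (l x) (order (b x))); rewrite step.
      by rewrite nth_index ?mem_order// (lvl_iter tW WK WK').
    by rewrite -order_sz// index_mem mem_order.
- move=> x Wx; have Yx := tl_supported tW Wx.
  have h1 : height x = 1%N by rewrite /height -{1}Wx WK l0.
  have [/perm_mem pm _] := orderP Yx.
  have := nextm x; rewrite /V /jump (tl_fix tW Yx) pm h1 mem_iota.
  by case: next.
- apply: measurableT_comp => //.
  apply: (measurable_fun_cases (u := pre) (F := fun q x => \sum_(k <- q) s (iter k W (b x)))).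
    exact: (dmeas_comp2 (fun (p : seq nat) i => take (index i p) p) dob dl).
  move=> q; apply: measurable_sum => k.
  exact: (measurableT_comp ms (PW_fun (PW_comp (PW_iter k (tl_FG tW).2) Pb))).
split; last first.
  move=> x nM; rewrite normrN; have [_ [_ H]] := orderP (tl_base tW x); apply: H.
  by have [n [_ ->]] := Pb; rewrite iM.
move=> x; have Yb := tl_base tW x.
have [bV lV] := jumpP (nextm x); rewrite -/V in bV lV.
set z := b x in Yb bV lV *; set i := index (l x) (order z).
have ix : (i < size (order z))%N by rewrite index_mem mem_order.
have lx : nth 0%N (order z) i = l x by rewrite nth_index ?mem_order.
have sx : s x = s (iter (nth 0%N (order z) i) W z).
  by rewrite lx (lvl_iter tW WK WK').
(* Either [x] has a successor in the order and one more term enters the partial sum, or [x] is last,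
   [V x] is the base, and the partial sum is completed to the column total. *)
have [lt|ge] := ltnP i.+1 (height z).
  have lV' : l (V x) = nth 0%N (order z) i.+1 by rewrite lV -lx order_nth.
  rewrite tsum_off; last first.
    move=> /l0; rewrite lV' => /eqP; rewrite -[X in _ == X](order0 z Yb).
    by rewrite nth_uniq ?order_sz ?uniq_order.
  rewrite {2}/c /pre bV lV' index_uniq ?order_sz ?uniq_order// (take_nth 0%N) //.
  by rewrite -cats1 big_cat big_seq1 /= -sx /c /pre -/z -/i; ring.
have Ei : i = (height z).-1 by move: ix ge; rewrite order_sz//; lia.
have lV0 : l (V x) = 0%N.
  rewrite lV next_nth mem_order -/i -(order0 z Yb).
  case: (order z) (order_sz z Yb) => [//|a p] /= sz; rewrite nth_default//.
  by rewrite Ei; lia.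
have YV := lY _ lV0; have VE : V x = z by rewrite -bV (tl_fix tW YV).
rewrite VE (c0 _ Yb) subr0 tsum_iter//.
have [pp _] := orderP Yb.
rewrite /index_iota subn0 -(perm_big _ pp) /= -[order z](cat_take_drop i) big_cat /=.
rewrite /c /pre -/z -/i [drop _ _](drop_nth 0%N)// drop_oversize ?order_sz//.
by rewrite big_seq1 -sx; ring.
Qed.

End reordering.

Lemma ae_off (M : set X) (P : X -> Prop) : measurable M -> mu M = 0%E ->
  (forall x, ~ M x -> P x) -> {ae mu, forall x, P x}.
Proof. by move=> mM M0 MP; exists M; split=> // x nP; apply: contrapT => /MP. Qed.

(** Along a column the transfer terms telescope around the cycle and [s'] vanishes before the return
    to the base. This recovers the column totals, the input of [reordering], from an equation whose
    transfer function is not controlled. *)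
Lemma redby_tsum W b Z s Z' s' (W' : X -> X) : redby W b Z s Z' s' -> cancel W W' -> cancel W' W ->
  {ae mu, forall x, tsum (Z' `|` ~` Z) W' s x = s' x}.
Proof.
move=> [c [tW sW ZZ [mZ' ms' mc s'Z'] E]] WK WK'; set Y := Z' `|` ~` Z in tW *.
have s'Y x : ~ Y x -> s' x = 0 by move=> nY; apply: s'Z' => Zx; apply: nY; left.
have [M [mM M0 NM iM]] := null_invariant E.
have PM x : ~ M x -> s x = c x - c (W x) + s' (W x).
  by move=> nM; apply: contrapT => h; exact/nM/NM.
apply: ae_off mM M0 _ => z nM.
have [Yz|nY] := pselect (Y z); last by rewrite tsum_off// s'Y.
have nMk k : ~ M (iter k W z).
  by have [n [_ ->]] := PW_iter k (tl_FG tW).2; rewrite iM.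
have part k : (k < height W' Y z)%N ->
    \sum_(0 <= i < k) s (iter i W z) = c z - c (iter k W z).
  elim: k => [|k IH] kh; first by rewrite big_geq// subrr.
  rewrite big_nat_recr//= IH 1?ltnW// (PM _ (nMk k)) s'Y; first by ring.
  by rewrite -iterS => /(lvl0 tW WK WK'); rewrite (lvl_iterE tW WK WK').
rewrite (tsum_iter tW WK WK')// {1}/height big_nat_recr//= part// (PM _ (nMk _)) -iterS.
by rewrite -/(height W' Y z) (iter_height tW WK WK' Yz); ring.
Qed.

(** The columns over a small set [D n] join neighbouring base points; their sums are reduced by
    [red_small], which only lengthens the cycles; and the final cycles are reordered to get a
    transfer function bounded by [e]. A small base gives the bound [eta], a rarely visited one the
    agreement of [x] and [S x]. *)
Lemma refine_stage Z s (b : X -> X) (e e' eta : R) :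
  measurable Z -> (0 < mu Z)%E -> measurable_fun setT s -> (forall x, ~ Z x -> s x = 0) ->
  balanced s -> (forall x, `|s x| <= e) -> PW b -> (forall x, Z (b x)) -> 0 < e -> 0 < e' -> 0 < eta ->
  exists (V beta : X -> X) (c : X -> R) Z' s',
  [/\ tiling V (Z' `|` ~` Z) beta, supported V Z,
    [/\ measurable Z', Z' `<=` Z, (mu Z' <= eta%:E)%E & exists N, [/\ measurable N,
        (mu N <= eta%:E)%E & forall x, ~ N x -> beta (b x) = beta (b (S x))]],
    [/\ measurable_fun setT s', forall x, ~ Z' x -> s' x = 0, balanced s' & forall x, `|s' x| <= e'] &
    [/\ measurable_fun setT c, forall x, Z' x -> c x = 0, {ae mu, forall x, `|c x| <= e} &
      {ae mu, forall x, s x = c x - c (V x) + s' (V x)}]].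
Proof.
move=> mZ Z0 ms sZ bs se Pb Zb e0 e'0 eta0.
have [D [mD DZ D0 Dd Dcap]] := shrinking_sets mZ Z0.
have [nb [mnb bE]] := Pb.
(* The power of [S] that leads from [b x] to [b (S x)]. *)
pose m x : int := nb (S x) + 1 - nb x.
have bSE x : b (S x) = zit (m x) (b x).
  rewrite !bE -zitD (_ : m x + nb x = nb (S x) + 1) ?zitD//; rewrite /m; lia.
have dm : dmeas m.
  have dS := PW_dmeas (PW_zit 1) mnb.
  exact: (dmeas_comp2 (fun i j : int => i + 1 - j) dS mnb).
(* The orbit of [b x] meets [D n] within the distance to [b (S x)]; both directions are included as
   [m x] has either sign. For a given [x] finitely many points matter, and each of them leaves the
   sets [D n], so these sets shrink to the empty set. *)
pose bad n := [set x | exists k : nat, (k <= `|m x|%N)%N /\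
  (D n (zit (Posz k) (b x)) \/ D n (zit (- Posz k) (b x)))].
have mbad n : measurable (bad n).
  apply: (measurable_exists_nat (P := fun k => [set x | (k <= `|m x|%N)%N /\
    (D n (zit (Posz k) (b x)) \/ D n (zit (- Posz k) (b x)))])) => k.
  apply: measurableI.
    exact: (dmeas_preimage [set i : int | (k <= `|i|%N)%N] dm).
  apply: measurableU; first exact: (PW_preimage (PW_comp (PW_zit (Posz k)) Pb) (mD n)).
  exact: (PW_preimage (PW_comp (PW_zit (- Posz k)) Pb) (mD n)).
have [N1 bN1] : exists N, forall n, (N <= n)%N -> (mu (bad n) <= eta%:E)%E.
  apply: probability_to0 => //.
    by move=> i j ij x [k [km H]]; exists k; split=> //; case: H => /(Dd _ _ ij); [left|right].
  rewrite (_ : \bigcap_n bad n = set0) ?measure0//; apply/seteqP; split=> // x Hx.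
  have /choice[q Hq] k : exists n, ~ D n (zit (Posz k) (b x)) /\ ~ D n (zit (- Posz k) (b x)).
    have [n1 H1] := Dcap (zit (Posz k) (b x)); have [n2 H2] := Dcap (zit (- Posz k) (b x)).
    by exists (maxn n1 n2); split=> /Dd; [move/(_ n1)|move/(_ n2)]; rewrite leq_max leqnn ?orbT => /(_ isT).
  have [k [km H]] := Hx (\max_(k < `|m x|%N.+1) q k) I.
  have qk : (q k <= \max_(k < `|m x|%N.+1) q k)%N.
    exact: (leq_bigmax (F := fun k : 'I_(`|m x|%N.+1) => q k) (Ordinal (km : (k < `|m x|%N.+1)%N))).
  by have [H1 H2] := Hq k; case: H => /(Dd _ _ qk).
have [N2 bN2] : exists N, forall n, (N <= n)%N -> (mu (D n) <= eta%:E)%E.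
  apply: probability_to0 => //; rewrite (_ : \bigcap_n D n = set0) ?measure0//.
  by apply/seteqP; split=> // x Hx; have [n] := Dcap x; apply; exact: Hx.
pose n := maxn N1 N2.
have badn : (mu (bad n) <= eta%:E)%E by apply: bN1; exact: leq_maxl.
have Dn : (mu (D n) <= eta%:E)%E by apply: bN2; exact: leq_maxr.
have [M [mM M0 iM vis]] := ergodic_visit (mD n) (D0 n).
have [V1 [b1 [t1 sV1 shift]]] := columns mZ (mD n) mM (DZ n) iM vis.
set D' := (D n `\` M) `|` (Z `&` M) in t1.
have mD' : measurable D' by apply: measurableU; [exact: measurableD|exact: measurableI].
have D'Z : D' `<=` Z by move=> x [[/DZ]|[]].
set Y1 := D' `|` ~` Z in t1.
have [[V1' V1K V1K'] _] := tl_FG t1.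
pose s1 := tsum Y1 V1' s.
have ms1 : measurable_fun setT s1 by exact: (measurable_tsum t1 V1K V1K').
have s1D x : ~ D' x -> s1 x = 0.
  move=> nD; have [Zx|nZ] := pselect (Z x); first by apply: tsum_off => -[].
  have Yx : Y1 x by right.
  have V1x : V1' x = x by rewrite -{1}(sV1 x nZ) V1K.
  rewrite /s1 (tsum_iter t1 V1K V1K' s Yx) /height V1x (lvl0 t1 V1K V1K' Yx).
  by rewrite big_nat1 /= sZ.
have r1 : redby V1 b1 Z s D' s1.
  exists (psum Y1 V1' s); split=> //; first by split=> //; exact: (measurable_psum t1 V1K V1K').
  by apply: aeW => x; exact: (tsumE t1 V1K V1K').
have bs1 : balanced s1.
  apply: (tsum_balanced t1 V1K V1K') => //; apply: (ipos_bounded (K := e)) => // x.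
  exact: le_trans (ler_norm _) (se x).
(* The bound [e'] is for the next residue; the bound [e] on the totals is what the reordering
   requires. *)
have ee0 : 0 < Num.min e e' by rewrite lt_min e0.
have [Z2 [s2 [[V2 [b2 r2]] bs2 s2e]]] := red_small mD' ms1 s1D bs1 ee0.
have r := redby_trans r1 r2.
have [c0 [tW sW Z2Z [mZ2 ms2 _ s2Z] _]] := r.
have Z2D : Z2 `<=` D' by case: r2 => c2 [].
set W := V2 \o V1 in r tW sW; set beta := b2 \o b1 in r tW.
have [[W' WK WK'] _] := tl_FG tW.
have ts := redby_tsum r WK WK'.
have [M2 [mM2 M20 NM2 iM2]] := null_invariant ts.
have te z : ~ M2 z -> `|tsum (Z2 `|` ~` Z) W' s z| <= e.
  move=> nM; have -> : tsum (Z2 `|` ~` Z) W' s z = s2 z.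
    by apply: contrapT => h; exact/nM/NM2.
  by apply: le_trans (s2e z) _; rewrite ge_min lexx.
have [V [c [tV VW mc cY [cE ce]]]] := reordering tW WK WK' ms mM2 (ltW e0) se iM2 te.
exists V, beta, c, Z2, s2; split=> //.
- by move=> x nZ; apply: VW; exact: sW.
- split=> //.
    apply: (@le_trans _ _ (mu (D n))) Dn => //.
    rewrite -(probability_setU0 (mD n) mM M0); apply: probability_le => //.
      exact: measurableU.
    by move=> x /Z2D[[Dx _]|[_ Mx]]; [left|right].
  exists (bad n `|` M); split; first exact: measurableU.
    by rewrite probability_setU0.
  move=> x nN; rewrite /beta /=; congr b2.
  have nbad : ~ bad n x by move=> h; apply: nN; left.
  have nM : ~ M x by move=> h; apply: nN; right.
  have nMb : ~ M (b x) by rewrite bE iM.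
  have nMb' : ~ M (b (S x)) by rewrite bSE iM.
  have Zbx := Zb x; have ZbS := Zb (S x).
  case Em : (m x) => [k|k].
    rewrite bSE Em; apply/esym/shift => //; first by rewrite -Em -bSE.
    by move=> i ik Di; apply: nbad; exists i; rewrite Em absz_nat; split; [lia|left].
  have bx : b x = zit (Posz k.+1) (b (S x)).
    by rewrite bSE Em -zitD (_ : _ + _ = 0) ?zit0//; lia.
  rewrite {1}bx; apply: shift => //; first by rewrite -bx.
  move=> i ik Di; apply: nbad; exists (k.+1 - i)%N; rewrite Em; split; first by lia.
  right; move: Di; rewrite bSE Em -zitD; congr (D n (zit _ _)); lia.
- by split=> // x; apply: le_trans (s2e x) _; rewrite ge_min lexx orbT.
- split=> //.
  + by move=> x Zx; apply: cY; left.
  + exact: ae_off mM2 M20 ce.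
  + apply: filterS (ae_FG (tl_FG tV) ts) => x /= E; by rewrite {1}cE E.
Qed.

Lemma ae_PW (b : X -> X) (P : X -> Prop) : PW b ->
  {ae mu, forall x, P x} -> {ae mu, forall x, P (b x)}.
Proof.
move=> [n [_ bE]] /null_invariant[M [mM M0 PM iM]].
apply: ae_off mM M0 _ => x nM; apply: contrapT => nP; apply: nM.
by rewrite -(iM (n x)) -bE; exact: PM.
Qed.

(** [b] maps every point into [Z] along its orbit, so an invariant null set containing a null [Z]
    would be the whole space. *)
Lemma tiling_pos (V : X -> X) Z (b : X -> X) : tiling V Z b -> (0 < mu Z)%E.
Proof.
move=> t; rewrite lt_neqAle measure_ge0 andbT eq_sym; apply/eqP => Z0.
have [M [mM M0 ZM iM]] : exists M, [/\ measurable M, mu M = 0%E, Z `<=` M &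
    forall n x, M (zit n x) <-> M x].
  by apply: null_invariant; exists Z; split=> //; exact: (tl_meas t).
have MT : M = setT.
  apply/seteqP; split=> // x _; have [n [_ bE]] := tl_PW t.
  by rewrite -(iM (n x)) -bE; exact/ZM/(tl_base t).
by move: M0; rewrite MT probability_setT => /eqP; rewrite onee_eq0.
Qed.

(** The Borel-Cantelli lemma for the weights used in the construction. *)
Lemma rarely_often (F : nat -> set X) : (forall n, measurable (F n)) ->
  (forall n, mu (F n) <= (1 / (2 ^ n.+1)%:R)%:E)%E ->
  {ae mu, forall x, exists k, forall n, (k <= n)%N -> ~ F n x}.
Proof.
move=> mF Fe.
have mL : measurable (lim_sup_set F).
  by apply: bigcap_measurable => // k _; exact: bigcup_measurable.
apply: ae_off mL _ _ => [|x nL]; last first.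
  apply: contrapT => H; apply: nL => k _; apply: contrapT => nk; apply: H; exists k => n kn Fx.
  by apply: nk; exists n.
apply: lim_sup_set_cvg0 => //.
apply: (@le_lt_trans _ _ 1%E); last exact: ltry.
apply: le_trans (epsilon_trick0 xpredT ler01).
by apply: lee_nneseries => n _; [rewrite measure_ge0|exact: Fe].
Qed.

Lemma ae_and (P Q : X -> Prop) : {ae mu, forall x, P x} -> {ae mu, forall x, Q x} ->
  {ae mu, forall x, P x /\ Q x}.
Proof. by apply: filterS2 => x Px Qx; split. Qed.

Lemma fast_cauchy (u : nat -> R) : (forall n, `|u n.+1 - u n| <= 2^-1 ^+ n) -> cvgn u.
Proof.
move=> ue; pose v n := u n.+1 - u n.
have uE : u = fun n => u 0%N + series v n.
  by apply/funext => n; rewrite seriesEnat /= /v telescope_sumr// addrC subrK.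
rewrite uE; apply: is_cvgD; first exact: is_cvg_cst.
apply: normed_cvg; apply: (series_le_cvg (v_ := geometric 1 2^-1)) => [n|n|n|].
- exact: normr_ge0.
- by rewrite /= mul1r exprn_ge0.
- by rewrite /= mul1r; exact: ue.
- by apply: is_cvg_geometric_series; rewrite ger0_norm// invf_lt1// ltr1n.
Qed.

(** * The limit of the cyclic maps and of the transfer functions *)

Section construction.
Variable f : X -> R.
Hypotheses (mf : measurable_fun setT f) (bf : balanced f).

(** [st_g] solves the coboundary equation for the cyclic map [st_T] up to the error [st_s], which is
    carried by the set [st_Z] of base points. *)
Record stage := Stage {
  st_T : X -> X;
  st_b : X -> X;
  st_g : X -> R;
  st_Z : set X;
  st_s : X -> R }.

Record stage_ok (n : nat) (t : stage) : Prop := {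
  ok_tiling : tiling (st_T t) (st_Z t) (st_b t);
  ok_g : measurable_fun setT (st_g t);
  ok_g0 : forall x, st_Z t x -> st_g t x = 0;
  ok_s : measurable_fun setT (st_s t);
  ok_s0 : forall x, ~ st_Z t x -> st_s t x = 0;
  ok_balanced : balanced (st_s t);
  ok_small : forall x, `|st_s t x| <= 2^-1 ^+ n;
  ok_f : {ae mu, forall x, f x = st_g t x - st_g t (st_T t x) + st_s t (st_T t x)} }.

(** [rf_T] and [rf_mu] make the maps converge almost everywhere, [rf_g] makes the transfer functions
    converge, and [rf_b] transfers the ergodicity of [S]. *)
Record refines (n : nat) (t t' : stage) : Prop := {
  rf_T : exists V, [/\ FG V, supported V (st_Z t) & st_T t' = V \o st_T t];
  rf_Z : st_Z t' `<=` st_Z t;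
  rf_mu : (mu (st_Z t') <= (1 / (2 ^ n.+1)%:R)%:E)%E;
  rf_g : {ae mu, forall x, `|st_g t' x - st_g t x| <= 2^-1 ^+ n};
  rf_b : exists N, [/\ measurable N, (mu N <= (1 / (2 ^ n.+1)%:R)%:E)%E &
    forall x, ~ N x -> st_b t' x = st_b t' (S x)] }.

Lemma first_stage : exists t, stage_ok 0 t.
Proof.
have [Z [s [[V [b [c [t _ _ [mZ ms mc sZ] E]]]] bs se]]] :=
  red_small measurableT mf (fun x => False_ind _ \o (@^~ I)) bf ltr01.
rewrite setCT setU0 in t.
(* The subtraction makes the transfer function vanish on the bases; no bound on it is needed at the
   first stage. *)
exists (Stage V b (fun x => c x - c (b x)) Z s); split=> //=.
- apply: measurable_funB => //; exact: (measurableT_comp mc (PW_fun (tl_PW t))).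
- by move=> x Zx; rewrite (tl_fix t Zx) subrr.
- by apply: filterS E => x ->; rewrite (tl_inv t); ring.
Qed.

Lemma next_stage n t : stage_ok n t -> exists t', stage_ok n.+1 t' /\ refines n t t'.
Proof.
case: t => T b g Z s [/= tT mg g0 ms s0 bs se fE].
have h0 k : (0 : R) < 2^-1 ^+ k by rewrite exprn_gt0.
have eta0 : (0 : R) < 1 / (2 ^ n.+1)%:R by rewrite divr_gt0// ltr0n expn_gt0.
have [V [be [c [Z' [s' [tV sV [mZ' Z'Z muZ' [N [mN muN Nb]]] [ms' s0' bs' se'] [mc c0 ce sE]]]]]]] :=
  refine_stage (tl_meas tT) (tiling_pos tT) ms s0 bs se (tl_PW tT) (tl_base tT) (h0 n) (h0 n.+1) eta0.
have Vi : injective V by case: (tl_FG tV) => /bij_inj.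
exists (Stage (V \o T) (be \o b) (fun x => g x + c (b x)) Z' s'); split; split=> //=.
- rewrite (_ : Z' = Z `&` (Z' `|` ~` Z)); first exact: tl_comp.
  apply/seteqP; split=> [x Zx|x [Zx [|/(_ Zx)]]//].
  by split; [exact: Z'Z|left].
- apply: measurable_funD => //; exact: (measurableT_comp mc (PW_fun (tl_PW tT))).
- by move=> x Zx; rewrite g0 ?add0r; [rewrite (tl_fix tT) ?c0//|]; exact: Z'Z.
- apply: filterS2 fE (ae_FG (tl_FG tT) sE) => x -> /= ->.
  have [ZT|nZT] := pselect (Z (T x)).
    have ZVT := supported_in Vi sV ZT.
    rewrite (g0 _ ZT) (g0 _ ZVT) (tl_fix tT ZVT) -(tl_inv tT x) (tl_fix tT ZT); ring.
  by rewrite (sV _ nZT) (tl_inv tT); ring.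
- by exists V; split=> //; exact: (tl_FG tV).
- by apply: filterS (ae_PW (tl_PW tT) ce) => x; rewrite addrAC subrr add0r.
- by exists N.
Qed.

Lemma stages : exists t : nat -> stage,
  forall n, stage_ok n (t n) /\ refines n (t n) (t n.+1).
Proof.
have [t0 ok0] := first_stage.
have /choice[F HF] (p : nat * stage) : exists t', stage_ok p.1 p.2 ->
    stage_ok p.1.+1 t' /\ refines p.1 p.2 t'.
  have [/next_stage[t' Ht]|nok] := pselect (stage_ok p.1 p.2); first by exists t'.
  by exists t0 => /nok.
pose t := fix t n := if n is m.+1 then F (m, t m) else t0.
have ok n : stage_ok n (t n) by elim: n => [//|n IH]; case: (HF (n, t n) IH).
by exists t => n; split=> //; case: (HF (n, t n) (ok n)).
Qed.

Lemma balanced_coboundary : exists T, ergodic_invertible mu T /\ coboundary mu f T.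
Proof.
have [t Ht] := stages.
(* The shift by one drops the first stage, whose base has no bound on its measure. *)
pose T n := st_T (t n.+1); pose Z n := st_Z (t n.+1); pose b n := st_b (t n.+1).
pose g n := st_g (t n.+1); pose s n := st_s (t n.+1).
have ok n : stage_ok n.+1 (t n.+1) by case: (Ht n.+1).
have rf n : refines n.+1 (t n.+1) (t n.+2) by case: (Ht n.+1).
have rf0 n : refines n (t n) (t n.+1) by case: (Ht n).
have tT n : tiling (T n) (Z n) (b n) by exact: ok_tiling (ok n).
have FT n : FG (T n) by exact: tl_FG (tT n).
have mZ n : measurable (Z n) by exact: tl_meas (tT n).
have muZ n : (mu (Z n) <= (1 / (2 ^ n.+1)%:R)%:E)%E by exact: rf_mu (rf0 n).
have /choice[V HV] n := rf_T (rf n).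
have VS n : supported (V n) (Z n) by have [_ + _] := HV n; exact.
have TS n x : T n.+1 x = V n (T n x) by have [_ _ E] := HV n; rewrite /T E.
have Zmono n m : (n <= m)%N -> Z m `<=` Z n.
  move=> /subnKC <-; elim: (m - n)%N => [|k IH]; rewrite ?addn0// addnS.
  by apply: subset_trans IH; exact: rf_Z (rf _).
have /choice[N HN] n := rf_b (rf0 n).
have /choice[T' HT'] n : exists T', cancel (T n) T' /\ cancel T' (T n).
  by have [[T' K K'] _] := FT n; exists T'.
have TK n : cancel (T n) (T' n) by case: (HT' n).
have TK' n : cancel (T' n) (T n) by case: (HT' n).
have FT' n : FG (T' n) by exact: FG_inv (FT n) (TK n) (TK' n).
(* One invariant null set collects all exceptions; the limit map is the identity on it, so that it
   is a bijection of the whole space. *)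
have [M [mM M0 QM iM]] : exists M, [/\ measurable M, mu M = 0%E,
    (forall x, ~ M x -> [/\ exists k, forall n, (k <= n)%N -> ~ Z n (T n x),
      exists k, forall n, (k <= n)%N -> ~ Z n x, exists k, forall n, (k <= n)%N -> ~ N n x,
      forall n, `|g n.+1 x - g n x| <= 2^-1 ^+ n &
      forall n, f x = g n x - g n (T n x) + s n (T n x)]) &
    forall n x, M (zit n x) <-> M x].
  have E1 : {ae mu, forall x, exists k, forall n, (k <= n)%N -> ~ Z n (T n x)}.
    apply: rarely_often => n; first by exact: (FG_preimage (FT n) (mZ n)).1.
    by have [_ ->] := FG_preimage (FT n) (mZ n).
  have E2 : {ae mu, forall x, exists k, forall n, (k <= n)%N -> ~ Z n x} by exact: rarely_often.
  have E3 : {ae mu, forall x, exists k, forall n, (k <= n)%N -> ~ N n x}.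
    by apply: rarely_often => n; have [] := HN n.
  have E4 : {ae mu, forall x, forall n, `|g n.+1 x - g n x| <= 2^-1 ^+ n}.
    apply: ae_foralln => n; apply: filterS (rf_g (rf n)) => x /le_trans; apply.
    by rewrite exprS ler_piMl ?exprn_ge0// invf_le1// ler1n.
  have E5 : {ae mu, forall x, forall n, f x = g n x - g n (T n x) + s n (T n x)}.
    by apply: ae_foralln => n; exact: ok_f (ok n).
  have EQ := ae_and (ae_and (ae_and E1 E2) (ae_and E3 E4)) E5.
  have [M [mM M0 QM iM]] := null_invariant EQ; exists M; split=> // x nM.
  have [[[? ?] [? ?]] ?] : (((exists k, forall n, (k <= n)%N -> ~ Z n (T n x)) /\
     exists k, forall n, (k <= n)%N -> ~ Z n x) /\ ((exists k, forall n, (k <= n)%N -> ~ N n x) /\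
     forall n, `|g n.+1 x - g n x| <= 2^-1 ^+ n)) /\
     forall n, f x = g n x - g n (T n x) + s n (T n x).
    by apply: contrapT => h; exact/nM/QM.
  by split.
have iMPW (u : X -> X) x : PW u -> M (u x) <-> M x by move=> [k [_ ->]].
have stab x k : (forall n, (k <= n)%N -> ~ Z n (T n x)) -> forall n, (k <= n)%N -> T n x = T k x.
  move=> H n /subnKC <-; elim: (n - k)%N => [|j IH]; first by rewrite addn0.
  by rewrite addnS TS (VS _ _ (H _ (leq_addr _ _))).
have stab' x k : (forall n, (k <= n)%N -> ~ Z n x) -> forall n, (k <= n)%N -> T' n x = T' k x.
  move=> H n /subnKC <-; elim: (n - k)%N => [|j IH]; first by rewrite addn0.
  rewrite addnS -IH -[RHS](TK (k + j).+1); congr (T' _ _).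
  by rewrite TS TK' (VS _ _ (H _ (leq_addr _ _))).
pose P k := [set x | forall n, (k <= n)%N -> ~ Z n (T n x)].
pose P' k := [set x | forall n, (k <= n)%N -> ~ Z n x].
have mP k : measurable (P k).
  apply: (measurable_forall_nat (P := fun n => [set x | (k <= n)%N -> ~ Z n (T n x)])) => n.
  exact: measurable_prop_imp (measurableC (FG_preimage (FT n) (mZ n)).1).
have mP' k : measurable (P' k).
  apply: (measurable_forall_nat (P := fun n => [set x | (k <= n)%N -> ~ Z n x])) => n.
  exact: measurable_prop_imp (measurableC (mZ n)).
pose Tl x := if `[< M x >] then x else T (least P x) x.
pose Tl' x := if `[< M x >] then x else T' (least P' x) x.
have TlM x : M x -> Tl x = x by move=> Mx; rewrite /Tl asboolT.
have TlM' x : M x -> Tl' x = x by move=> Mx; rewrite /Tl' asboolT.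
have TlE x : ~ M x -> exists k, forall n, (k <= n)%N -> T n x = Tl x.
  move=> nM; have [ex _ _ _ _] := QM x nM; exists (least P x); rewrite /Tl asboolF//.
  by apply: stab; have [] := leastP (P := P) ex.
have TlE' x : ~ M x -> exists k, forall n, (k <= n)%N -> T' n x = Tl' x.
  move=> nM; have [_ ex _ _ _] := QM x nM; exists (least P' x); rewrite /Tl' asboolF//.
  by apply: stab'; have [] := leastP (P := P') ex.
have PWT : PW Tl.
  apply: (PW_cases (u := fun k x => if k then x else T (least P x) x) (dmeas_bool mM)) => -[]; first exact: PW_id.
  by apply: (PW_cases (u := T) (dmeas_least mP)) => k; exact: (FT k).2.
have PWT' : PW Tl'.
  apply: (PW_cases (u := fun k x => if k then x else T' (least P' x) x) (dmeas_bool mM)) => -[]; first exact: PW_id.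
  by apply: (PW_cases (u := T') (dmeas_least mP')) => k; exact: (FT' k).2.
have TlK : cancel Tl Tl'.
  move=> x; have [Mx|nM] := pselect (M x); first by rewrite TlM// TlM'.
  have nMT : ~ M (Tl x) by rewrite iMPW.
  have [k Hk] := TlE x nM; have [k' Hk'] := TlE' _ nMT.
  by rewrite -(Hk' (maxn k k')) ?leq_maxr// -(Hk (maxn k k')) ?leq_maxl// TK.
have TlK' : cancel Tl' Tl.
  move=> x; have [Mx|nM] := pselect (M x); first by rewrite TlM'// TlM.
  have nMT : ~ M (Tl' x) by rewrite iMPW.
  have [k Hk] := TlE' x nM; have [k' Hk'] := TlE _ nMT.
  by rewrite -(Hk' (maxn k k')) ?leq_maxr// -(Hk (maxn k k')) ?leq_maxl// TK'.
have FTl : FG Tl by split=> //; exists Tl'.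
(* Later maps differ from [T n] only at points sent into [Z n], and the sets [Z n] decrease. *)
have Tl_off n y : ~ M y -> ~ Z n (T n y) -> Tl y = T n y.
  move=> nM nZ; have E j : T (n + j)%N y = T n y.
    elim: j => [|j IH]; first by rewrite addn0.
    by rewrite addnS TS IH VS// => /(Zmono n) - /(_ (leq_addr _ _)).
  have [k Hk] := TlE y nM; rewrite -(Hk (n + k)%N) ?E//; exact: leq_addl.
exists Tl; split.
  split.
  - exact: FTl.1.
  - exact: PW_fun.
  - by move=> A mA; have [] := FG_image FTl mA.
  - by move=> A mA; have [] := FG_preimage FTl mA.
  move=> A mA TA.
  have AT x : A (Tl x) <-> A x by rewrite -{2}TA.
  (* Climbing a cycle of [T n] from its base, every step that does not land in [Z n] is also a step
     of [Tl]; one that does land there is back at the base point. *)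
  have Ab n x : ~ M x -> A x <-> A (b n x).
    move=> nM; have [i Ei] := tl_reach (tT n) x.
    have nMb : ~ M (b n x) by rewrite iMPW//; exact: tl_PW (tT n).
    rewrite {1}Ei; elim: i {Ei} => [//|i IH] /=.
    have nMi : ~ M (iter i (T n) (b n x)) by rewrite iMPW//; exact: PW_iter (FT n).2.
    have [Zi|nZ] := pselect (Z n (T n (iter i (T n) (b n x)))).
      by rewrite -iterS (tl_ret (i := i.+1) (tT n) (tl_base (tT n) x) Zi).
    by rewrite -(Tl_off _ _ nMi nZ) AT.
  (* For some stage [k], the points [x] and [S x] have the same base point, so [A] is invariant
     under [S]. *)
  apply: ergodic_ae mA _; apply: ae_off mM M0 _ => x nM.
  have [_ _ [k Hk] _ _] := QM x nM; have [_ _ Hb] := HN k.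
  rewrite (Ab k x nM) (Ab k (S x)) ?(iM 1 x)// (_ : b k x = b k (S x))//.
  exact: Hb (Hk k (leqnn k)).
(* The value 0 on [M] gives convergence at every point, whence the measurability of the limit. *)
pose h n x := if `[< M x >] then 0 else g n x.
pose G x := lim (h n x @[n --> \oo]).
have hcv x : cvg (h n x @[n --> \oo]).
  apply: fast_cauchy => n; rewrite /h; case: asboolP => nM.
    by rewrite subrr normr0 exprn_ge0.
  by have [] := QM x nM.
exists G; split.
  apply: (measurable_fun_cvg (h := h)) => [n|x _]; last exact: hcv.
  apply: (measurable_fun_cases (F := fun k x => if k then 0 else g n x) (dmeas_bool mM)) => -[]//.
  exact: ok_g (ok n).
apply: ae_off mM M0 _ => x nM; have [_ _ _ _ Ef] := QM x nM.
have nMT : ~ M (Tl x) by rewrite iMPW.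
have [k Hk] := TlE x nM.
have hM n y : ~ M y -> h n y = g n y by move=> nMy; rewrite /h asboolF.
have cv : (h n x - h n (Tl x)) @[n --> \oo] --> G x - G (Tl x) by apply: cvgB; exact: hcv.
have cv' : (h n x - h n (Tl x)) @[n --> \oo] --> f x.
  have half0 : (2^-1 ^+ n : R) @[n --> \oo] --> 0.
    by apply: cvg_expr; rewrite ger0_norm// invf_lt1// ltr1n.
  apply: (squeeze_cvgr (f := fun n => f x - 2^-1 ^+ n) (h := fun n => f x + 2^-1 ^+ n)).
  - exists k => // n /= kn; rewrite !hM// (Ef n) (Hk n kn) -ler_distl opprD addrA subrr add0r normrN.
    apply: le_trans (ok_small (ok n) _) _.
    by rewrite exprS ler_piMl ?exprn_ge0// invf_le1// ler1n.
  - by rewrite -[X in _ --> X]subr0; apply: cvgB => //; exact: cvg_cst.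
  - by rewrite -[X in _ --> X]addr0; apply: cvgD => //; exact: cvg_cst.
exact: cvg_unique cv' cv.
Qed.

End construction.

(** * Almost invariant sets and drifting sums *)

Definition prob (A : set X) : R := fine (mu A).

Lemma probE (A : set X) : measurable A -> (prob A)%:E = mu A.
Proof. by move=> mA; rewrite /prob fineK// fin_num_measure. Qed.

Lemma prob_le (A B : set X) : measurable A -> measurable B -> A `<=` B -> prob A <= prob B.
Proof. by move=> mA mB AB; rewrite -lee_fin !probE//; exact: probability_le. Qed.

Lemma prob_ge0 (A : set X) : 0 <= prob A.
Proof. by rewrite fine_ge0. Qed.

Lemma probU (A B : set X) : measurable A -> measurable B -> prob (A `|` B) <= prob A + prob B.
Proof.
move=> mA mB; rewrite -lee_fin EFinD !probE//; last exact: measurableU.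
exact: measureU2.
Qed.

Lemma prob_setC (A : set X) : measurable A -> prob A + prob (~` A) = 1.
Proof.
move=> mA; apply: EFin_inj; rewrite EFinD !probE//; last exact: measurableC.
have -> : mu (~` A) = (1 - mu A)%E by exact: probability_setC.
by rewrite addeC subeK// fin_num_measure.
Qed.

Lemma prob_exists (F : nat -> set X) (e : R) N : (forall i, measurable (F i)) ->
  (forall i, (i < N)%N -> prob (F i) <= e) ->
  measurable [set x | exists i : nat, (i < N)%N /\ F i x] /\
  prob [set x | exists i : nat, (i < N)%N /\ F i x] <= N%:R * e.
Proof.
move=> mF; elim: N => [|N IH] Fe.
  rewrite (_ : [set x | _] = set0) ?mul0r ?/prob ?measure0//.
  by apply/seteqP; split=> x // [i []].
have [mI pI] := IH (fun i iN => Fe i (ltnW iN)).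
rewrite (_ : [set x | _] = [set x | exists i : nat, (i < N)%N /\ F i x] `|` F N).
  split; first exact: measurableU.
  apply: le_trans (probU mI (mF N)) _.
  by rewrite -[N.+1%:R]natr1 mulrDl mul1r lerD// Fe.
apply/seteqP; split=> x.
  move=> [i [+ Fi]]; rewrite ltnS leq_eqVlt => /predU1P[iN|iN]; first by right; rewrite -iN.
  by left; exists i.
by case=> [[i [iN Fi]]|FN]; [exists i; split=> //; exact: ltnW|exists N].
Qed.

Lemma prob_to0 (A : nat -> set X) (e : R) : (forall n, measurable (A n)) ->
  (forall n m, (n <= m)%N -> A m `<=` A n) -> mu (\bigcap_n A n) = 0%E -> 0 < e ->
  exists N, forall n, (N <= n)%N -> prob (A n) <= e.
Proof.
move=> mA dA A0 e0; have [N H] := probability_to0 mA dA A0 e0.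
by exists N => n /H; rewrite -probE// lee_fin.
Qed.

Definition bsum (T : X -> X) (u : X -> R) (n : nat) (x : X) : R := \sum_(i < n) u (iter i T x).

Definition visits (A : set X) (n : nat) (x : X) : nat := \sum_(i < n) `[< A (iter i S x) >].

Lemma preimage_iter A i : measurable A ->
  measurable (iter i S @^-1` A) /\ mu (iter i S @^-1` A) = mu A.
Proof. exact: (zit_preimage (Posz i)). Qed.

Lemma dmeas_visits A n : measurable A -> dmeas (visits A n).
Proof.
move=> mA; elim: n => [|n IH].
  by rewrite (_ : visits A 0 = fun=> 0%N); [exact: dmeas_cst|apply/funext => x; rewrite /visits big_ord0].
rewrite (_ : visits A n.+1 = fun x => (visits A n x + `[< A (iter n S x) >])%N).
  apply: (dmeas_comp2 (fun (i : nat) (c : bool) => (i + c)%N)) => //.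
  by apply: dmeas_bool; exact: (preimage_iter n mA).1.
by apply/funext => x; rewrite /visits big_ord_recr.
Qed.

Lemma visits_homo A n m x : (n <= m)%N -> (visits A n x <= visits A m x)%N.
Proof.
move=> /subnKC <-; elim: (m - n)%N => [|k IH]; first by rewrite addn0.
by rewrite addnS {2}/visits big_ord_recr /=; apply: leq_trans IH _; exact: leq_addr.
Qed.

Lemma visits_many A L (e : R) : measurable A -> (0 < mu A)%E -> 0 < e ->
  exists N, forall n, (N <= n)%N -> prob [set x | (visits A n x < L)%N] <= e.
Proof.
move=> mA A0 e0; have [M [mM M0 iM vis]] := ergodic_visit mA A0.
have mV n : measurable [set x | (visits A n x < L)%N].
  exact: (dmeas_preimage [set k : nat | (k < L)%N] (dmeas_visits n mA)).
apply: prob_to0 => //.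
  by move=> n m nm x /=; apply: leq_ltn_trans; exact: visits_homo.
apply/eqP; rewrite eq_le measure_ge0 andbT -M0; apply: probability_le => //.
  exact: bigcapT_measurable.
move=> x H; apply: contrapT => nM.
have [n] : exists n, (L <= visits A n x)%N; last by rewrite leqNgt => /negP; apply; exact: H.
elim: L {H mV} => [|L [n Ln]]; first by exists 0%N.
have [[k Ak] _] := vis x nM (Posz n).
exists (n + k).+1; rewrite /visits big_ord_recr /= asboolT; last exact: Ak.
by rewrite addn1 ltnS; apply: leq_trans Ln _; apply: visits_homo; exact: leq_addr.
Qed.

(** The union of the first [m] preimages of a small set [D] grows by at most the measure of [D] at
    each step and eventually exceeds 1/2, so it can be stopped just after 1/3; under one shift only
    its first and its next preimage matter. With 1/3, both [G] and its complement keep measure above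
    1/4 for small [e]. *)
Lemma almost_invariant (e : R) : 0 < e -> exists G, [/\ measurable G, 3^-1 <= prob G,
  prob G <= 3^-1 + e & measurable [set x | ~ (G x <-> G (S x))] /\
    prob [set x | ~ (G x <-> G (S x))] <= e].
Proof.
move=> e0.
have [||Ds [mD _ D0 Dd Dc]] := @shrinking_sets setT; rewrite ?probability_setT ?lte01//.
have [n Dn] : exists n, prob (Ds n) <= e / 2.
  have [||N H] := @prob_to0 Ds (e / 2) mD Dd; last by exists N; exact: H.
    rewrite (_ : \bigcap_n Ds n = set0) ?measure0//.
    by apply/seteqP; split=> // x Hx; have [k] := Dc x; apply; exact: Hx.
  by rewrite divr_gt0.
move: (Ds n) (mD n) (D0 n) Dn => D {}mD {}D0 {}Dn {Ds Dd Dc}.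
pose G m := [set x | exists k : nat, (k < m)%N /\ (iter k S @^-1` D) x].
have mDk k : measurable (iter k S @^-1` D) by exact: (preimage_iter k mD).1.
have pDk k : prob (iter k S @^-1` D) = prob D by rewrite /prob (preimage_iter k mD).2.
have mG m : measurable (G m) by have [] := @prob_exists _ (prob D) m mDk (fun k _ => eq_ind_r (fun r => r <= prob D) (lexx _) (pDk k)).
have [m0 Hm0] : exists m, 3^-1 <= prob (G m).
  have [N H] := @visits_many D 1 (1 / 2) mD D0 ltac:(by rewrite divr_gt0).
  exists N; have := H N (leqnn N).
  have -> : [set x | (visits D N x < 1)%N] = ~` G N.
    apply/seteqP; split=> x /=; rewrite ltnS leqn0.
      move=> /eqP v0 [k [kN Dk]]; move: v0; rewrite /visits (bigD1 (Ordinal kN))//=.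
      by rewrite asboolT.
    move=> nG; apply/eqP; rewrite /visits big1// => i _; rewrite asboolF// => Di.
    by apply: nG; exists i.
  by have := prob_setC (mG N); lra.
have ex : exists m, 3^-1 <= prob (G m) by exists m0.
case: (ex_minnP ex) => [[|m] Hm mm].
  move: Hm; rewrite (_ : G 0%N = set0); last by apply/seteqP; split=> x // [k []].
  by rewrite /prob measure0 /=; lra.
have lt : prob (G m) < 3^-1.
  by rewrite ltNge; apply/negP => /mm; rewrite ltnn.
exists (G m.+1); split=> //.
  have : prob (G m.+1) <= prob (G m `|` iter m S @^-1` D).
    apply: prob_le => //; first exact: measurableU.
    move=> x [k [+ Dk]]; rewrite ltnS leq_eqVlt => /predU1P[<-|km]; first by right.
    by left; exists k.
  have := probU (mG m) (mDk m); rewrite pDk; lra.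
have mS : measurable (S @^-1` G m.+1) := (preimage_iter 1 (mG m.+1)).1.
have mX : measurable [set x | ~ (G m.+1 x <-> G m.+1 (S x))].
  rewrite (_ : [set x | _] = (G m.+1 `\` S @^-1` G m.+1) `|` (S @^-1` G m.+1 `\` G m.+1)).
    by apply: measurableU; exact: measurableD.
  by apply/seteqP; split=> x /=; have [g|g] := pselect (G m.+1 x); have [g'|g'] := pselect (G m.+1 (S x)); tauto.
split=> //; have : prob [set x | ~ (G m.+1 x <-> G m.+1 (S x))] <= prob (D `|` iter m.+1 S @^-1` D).
  apply: prob_le => //; first exact: measurableU.
  move=> x /= nG; apply: contrapT => nD; apply: nG; split=> -[k [km Dk]].
    case: k km Dk => [_ Dx|k km Dk]; first by case: nD; left.
    by exists k; split; [exact: ltnW|rewrite /= -iterSr].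
  have [km'|km'] := ltnP k.+1 m.+1; first by exists k.+1; split=> //; rewrite /preimage /= -iterS iterSr.
  by case: nD; right; rewrite /preimage /= -iterS iterSr (_ : m = k)//; lia.
have := probU mD (mDk m.+1); rewrite pDk; lra.
Qed.

(** A point of [H] that stays in [H] for [N] steps, avoids the null set [Q] and visits [A0] at least
    [L] times has a sum of at least [L%:R * kap]. The exceptions cost 1/100 twice, and 1/4 - 2/100
    exceeds 1/8. *)
Lemma one_sided_sums u (H A0 Q : set X) (kap C e : R) (N L : nat) :
  measurable_fun setT u -> measurable H -> measurable A0 -> measurable Q -> mu Q = 0%E ->
  measurable [set x | ~ (H x <-> H (S x))] -> prob [set x | ~ (H x <-> H (S x))] <= e ->
  (forall x, H x -> 0 <= u x) -> (forall x, H x -> A0 x -> ~ Q x -> kap <= u x) ->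
  0 <= kap -> C < L%:R * kap ->
  prob [set x | (visits A0 N x < L)%N] <= 100^-1 -> N%:R * e <= 100^-1 -> 4^-1 <= prob H ->
  8^-1 < prob [set x | C < `|bsum S u N x| ].
Proof.
move=> mu' mH mA0 mQ Q0 mI pI u0 uk k0 CL pV Ne pH.
pose I := [set x | ~ (H x <-> H (S x))].
pose bad := [set x | exists i : nat, (i < N)%N /\ (iter i S @^-1` I) x].
have [mbad pbad] : measurable bad /\ prob bad <= N%:R * e.
  apply: prob_exists => i; first exact: (preimage_iter i mI).1.
  by rewrite /prob (preimage_iter i mI).2.
pose qad := [set x | exists i : nat, (i < N)%N /\ (iter i S @^-1` Q) x].
have [mqad pqad] : measurable qad /\ prob qad <= N%:R * 0.
  apply: prob_exists => i; first exact: (preimage_iter i mQ).1.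
  by rewrite /prob (preimage_iter i mQ).2 Q0.
have mV : measurable [set x | (visits A0 N x < L)%N].
  exact: (dmeas_preimage [set k : nat | (k < L)%N] (dmeas_visits N mA0)).
have mL : measurable [set x | C < `|bsum S u N x| ].
  apply: measurable_set_lt => //; apply: measurableT_comp => //.
  apply: measurable_sum => i; exact: (measurableT_comp mu' (PW_fun (PW_zit (Posz i)))).
have sub : H `<=` ((bad `|` qad) `|` [set x | (visits A0 N x < L)%N]) `|` [set x | C < `|bsum S u N x| ].
  move=> x Hx; apply: contrapT => nx.
  have nb : ~ bad x by move=> h; apply: nx; left; left; left.
  have nq : ~ qad x by move=> h; apply: nx; left; left; right.
  have nv : ~ (visits A0 N x < L)%N by move=> h; apply: nx; left; right.
  apply: nx; right => /=; apply: lt_le_trans (ler_norm _); apply: lt_le_trans CL _.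
  have Hi i : (i <= N)%N -> H (iter i S x).
    elim: i => [//|i IH] iN; have Hi := IH (ltnW iN).
    apply: contrapT => nH; apply: nb; exists i; split=> // -[h _]; exact/nH/h.
  apply: (@le_trans _ _ ((visits A0 N x)%:R * kap)).
    by apply: ler_wpM2r => //; rewrite ler_nat leqNgt; apply/negP.
  rewrite /visits /bsum natr_sum mulr_suml; apply: ler_sum => i _.
  case: asboolP => [Ai|_]; last by rewrite mul0r; exact/u0/Hi/ltnW/ltn_ord.
  rewrite mul1r; apply: uk => //; first exact/Hi/ltnW/ltn_ord.
  by move=> Qi; apply: nq; exists i.
have m1 : measurable (bad `|` qad) by exact: measurableU.
have m2 : measurable ((bad `|` qad) `|` [set x | (visits A0 N x < L)%N]) by exact: measurableU.
have := prob_le mH (measurableU _ _ m2 mL) sub.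
have := probU m2 mL; have := probU m1 mV; have := probU mbad mqad.
clear -pH pV Ne pbad pqad; move: pqad; rewrite mulr0.
move: (prob H) (prob bad) (prob qad) (prob _) (prob _) (prob _) (prob _) pH pV pbad Ne => *; lra.
Qed.

(* Swapping part of [A0] inside an almost invariant set [G] with part of [B0]
   outside [G] makes the sums of [f \o V - f] drift in [G] or off [G]. *)
Lemma unstable_swap (f : X -> R) (a b C : R) (A0 B0 : set X) : measurable_fun setT f -> a < b ->
  measurable A0 -> measurable B0 -> (0 < mu A0)%E -> (0 < mu B0)%E ->
  (forall x, A0 x -> f x <= a) -> (forall x, B0 x -> b <= f x) ->
  exists V N, [/\ FG V, forall x, V (V x) = x,
    exists2 W, measurable W & prob W <= prob A0 + prob A0 /\ forall x, V x <> x -> W x &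
    8^-1 < prob [set x | C < `|bsum S (fun x => f (V x) - f x) N x| ] ].
Proof.
move=> mf ab mA0 mB0 A0p B0p fA fB.
have kap0 : 0 < b - a by rewrite subr_gt0.
have [L HL] : exists L : nat, C < L%:R * (b - a).
  have [n n1] := @inv_nat_le ((b - a) / (`|C| + 1)) ltac:(by rewrite divr_gt0// ltr_wpDl).
  exists n.+1; rewrite -ltr_pdivrMr// ; apply: (@lt_le_trans _ _ ((`|C| + 1) / (b - a))).
    by rewrite ltr_pM2r ?invr_gt0// (le_lt_trans (ler_norm _))// ltrDl.
  by rewrite -[X in X <= _]invrK -[X in _ <= X]invrK invf_div lef_pV2// posrE ?invr_gt0// divr_gt0// ltr_wpDl.
have h100 : (0 : R) < 100^-1 by rewrite invr_gt0.
have [N1 HN1] := visits_many L mA0 A0p h100.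
have [N2 HN2] := visits_many L mB0 B0p h100.
(* With this [e], crossing the boundary of [G] within [N] steps has probability at most 1/100. *)
pose N := maxn N1 N2; pose e : R := 100^-1 / N.+1%:R.
have e0 : 0 < e by rewrite divr_gt0.
have Ne : N%:R * e <= 100^-1.
  rewrite /e mulrCA ler_piMr ?(ltW h100)// ler_pdivrMr// mul1r ler_nat//.
have e1 : e <= 100^-1 by rewrite /e ler_pdivrMr// ler_peMr ?(ltW h100)// ler1n.
have [G [mG G1 G2 [mI pI]]] := almost_invariant e0.
have mA : measurable (A0 `&` G) by exact: measurableI.
have mB : measurable (B0 `\` G) by exact: measurableD.
have AB : (A0 `&` G) `&` (B0 `\` G) = set0.
  by apply/seteqP; split=> x // [[_ Gx] [_]].
have [V [A' [B' [FV VV [mA' mB' A'A B'B] [VA VB Vid] exh]]]] := swap_exists mA mB AB.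
exists V, N; split=> //.
  exists (A' `|` B'); first exact: measurableU.
  split; last by move=> x Vx; apply: contrapT => nW; apply: Vx; apply: Vid => h; apply: nW; [left|right].
  apply: le_trans (probU mA' mB') _; apply: lerD.
    by apply: prob_le => // x /A'A[].
  rewrite (_ : prob B' = prob A'); first by apply: prob_le => // x /A'A[].
  rewrite /prob -(FG_preimage FV mA').2; congr (fine (mu _)); apply/seteqP; split=> x; first exact: VB.
  by move=> /= Ax; rewrite -(VV x); exact: VA.
pose h x := f (V x) - f x.
have mfV : measurable_fun setT (fun x => f (V x)) := measurableT_comp mf (PW_fun FV.2).
have mh : measurable_fun setT h by exact: measurable_funB.
have hA x : A' x -> b - a <= h x.
  move=> Ax; have [A0x _] := A'A x Ax; have [B0x _] := B'B _ (VA x Ax).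
  by apply: lerB; [exact: fB|exact: fA].
have hB x : B' x -> b - a <= - h x.
  move=> Bx; have [A0x _] := A'A _ (VB x Bx); have [B0x _] := B'B x Bx.
  by rewrite opprB; apply: lerB; [exact: fB|exact: fA].
have h0 x : ~ A' x -> ~ B' x -> h x = 0 by move=> nA nB; rewrite /h Vid// subrr.
(* On [G] the increment [h] is zero or at least [b - a], off [G] it is zero or at most [- (b - a)].
   The drift is visible on the side whose set was exhausted, as there almost every visit to [A0] or
   [B0] counts. *)
case: exh => Q0.
  apply: (one_sided_sums (u := h) (H := G) (A0 := A0) (Q := (A0 `&` G) `\` A') (kap := b - a) (e := e) (L := L)) => //.
  - exact: measurableD.
  - move=> x Gx; have [Ax|nA] := pselect (A' x); first exact: le_trans (ltW kap0) (hA x Ax).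
    by rewrite h0// => /B'B[].
  - by move=> x Gx A0x nQ; apply: hA; apply: contrapT => nA; apply: nQ.
  - exact: ltW.
  - by apply: HN1; exact: leq_maxl.
  - by lra.
have -> : [set x | C < `|bsum S h N x| ] = [set x | C < `|bsum S (\- h) N x| ].
  apply/funext => x; rewrite /mkset (_ : bsum S (\- h) N x = - bsum S h N x) ?normrN//.
  by rewrite /bsum sumrN.
have EI : [set x | ~ ((~` G) x <-> (~` G) (S x))] = [set x | ~ (G x <-> G (S x))].
  by apply/seteqP; split=> x /=; have [g|g] := pselect (G x); have [g'|g'] := pselect (G (S x)); tauto.
apply: (one_sided_sums (u := \- h) (H := ~` G) (A0 := B0) (Q := (B0 `\` G) `\` B') (kap := b - a) (e := e) (L := L)) => //.
- exact: measurableT_comp.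
- exact: measurableC.
- exact: measurableD.
- by rewrite EI.
- by rewrite EI.
- move=> x Gx /=; have [Bx|nB] := pselect (B' x); first exact: le_trans (ltW kap0) (hB x Bx).
  by rewrite h0 ?oppr0// => /A'A[].
- by move=> x Gx B0x nQ; apply: hB; apply: contrapT => nA; apply: nQ.
- exact: ltW.
- by apply: HN2; exact: leq_maxr.
- by have := prob_setC mG; move: G2 e1; clear; move: (prob _) (prob _) => *; lra.
Qed.

(** If no two levels are separated, then of any [a < b] either the lower or the upper set is null,
    and the supremum of the levels with null lower set is the value of [f] almost everywhere. *)
Lemma separated_levels (f : X -> R) : measurable_fun setT f ->
  (exists r : R, {ae mu, forall x, f x = r}) \/
  exists a b : R, [/\ a < b, (0 < mu [set x | (f x <= a)%R])%E & (0 < mu [set x | (b <= f x)%R])%E].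
Proof.
move=> mf; apply: contrapT => H.
have mlow (t : R) : measurable [set x | f x <= t] by exact: measurable_set_le.
have mhigh (t : R) : measurable [set x | t <= f x] by exact: measurable_set_le.
have pos A : measurable A -> ~ (0 < mu A)%E -> mu A = 0%E.
  by move=> mA /negP; rewrite -leNgt => h; apply/eqP; rewrite eq_le h measure_ge0.
have sep a b : a < b -> mu [set x | f x <= a] = 0%E \/ mu [set x | b <= f x] = 0%E.
  move=> ab; apply: contrapT => /not_orP[h1 h2]; apply: H; right; exists a, b; split=> //.
    by apply: contrapT => /(pos _ (mlow a)).
  by apply: contrapT => /(pos _ (mhigh b)).
have cover (F : nat -> set X) : (forall n, measurable (F n)) -> (forall x, exists n, F n x) ->
    exists n, (0 < mu (F n))%E.
  move=> mF cF; apply: contrapT => nF.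
  have : mu.-negligible (\bigcup_n F n).
    apply: negligible_bigcup => n; exists (F n); split=> //; apply: pos => // h; apply: nF; by exists n.
  move=> [N [mN N0 FN]]; suff NT : N = setT.
    by move: N0; rewrite NT probability_setT => /eqP; rewrite onee_eq0.
  by apply/seteqP; split=> // x _; apply: FN; have [n Fn] := cF x; exists n.
pose E := [set t : R | mu [set x | f x <= t] = 0%E].
have nb (r : R) : exists n : nat, r <= n%:R.
  by exists (Num.bound `|r|); apply: le_trans (ler_norm _) _; exact/ltW/archi_boundP.
have [n nlow] : exists n : nat, (0 < mu [set x | (f x <= n%:R)%R])%E.
  apply: (cover (fun n => [set x | f x <= n%:R])) => // x.
  exact: nb.
have [m mhig] : exists m : nat, (0 < mu [set x | (- m%:R <= f x)%R])%E.
  apply: (cover (fun m => [set x | - m%:R <= f x])) => // x.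
  by have [k fk] := nb (- f x); exists k; rewrite /= lerNl.
have hE : has_sup E.
  split.
    exists (- m%:R - 1); have [//|h] := sep (- m%:R - 1) (- m%:R) ltac:(lra).
    by move: mhig; rewrite h ltxx.
  exists n%:R => t Et; rewrite leNgt; apply/negP => nt; move: nlow; rewrite ltNge => /negP; apply.
  rewrite -[X in (_ <= X)%E]Et; apply: probability_le => // x /= fx; exact: le_trans fx (ltW nt).
apply: H; left; exists (sup E).
have low k : mu [set x | f x <= sup E - k.+1%:R^-1] = 0%E.
  have k0 : (0 : R) < k.+1%:R^-1 by rewrite invr_gt0.
  have [u Eu ut] := sup_adherent k0 hE.
  apply/eqP; rewrite eq_le measure_ge0 andbT -[X in (_ <= X)%E]Eu.
  by apply: probability_le => // x /= fx; exact: le_trans fx (ltW ut).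
have high k : mu [set x | sup E + k.+1%:R^-1 <= f x] = 0%E.
  have k0 : (0 : R) < k.+1%:R^-1 by rewrite invr_gt0.
  have [h|//] := sep (sup E + k.+1%:R^-1 / 2) (sup E + k.+1%:R^-1) ltac:(move: k0; move: (_^-1) => q; lra).
  have : sup E + k.+1%:R^-1 / 2 <= sup E by apply: (sup_ubound hE.2).
  by rewrite gerDl leNgt divr_gt0.
apply: (@negligibleS _ _ _ mu (\bigcup_k ([set x | f x <= sup E - k.+1%:R^-1] `|` [set x | sup E + k.+1%:R^-1 <= f x]))).
  move=> x /= /eqP; rewrite neq_lt => /orP[lt|lt].
    have [k k1] := @inv_nat_le (sup E - f x) ltac:(by rewrite subr_gt0).
    by exists k => //; left => /=; rewrite lerBrDr -lerBrDl.
  have [k k1] := @inv_nat_le (f x - sup E) ltac:(by rewrite subr_gt0).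
  by exists k => //; right => /=; rewrite addrC -lerBrDr.
apply: negligible_bigcup => k; apply: negligibleU; eexists; split; [|exact: low|by []| |exact: high|by []] => //.
Qed.

End full_group.

(** * Tight Birkhoff sums and meagerness *)

Section meager_part.
Context {R : realType} {d : measure_display} {X : measurableType d}.
Variable mu : probability X R.
Implicit Types (T : X -> X) (A : set X).

Lemma ei_iter T i A : ergodic_invertible mu T -> measurable A ->
  measurable (iter i T @^-1` A) /\ prob mu (iter i T @^-1` A) = prob mu A.
Proof.
move=> eT mA; have [T' K K'] := ei_bij eT.
by have [mI I] := preimage_iter K K' eT i mA; rewrite /prob I.
Qed.

Lemma ei_ae_iter T (P : X -> Prop) : ergodic_invertible mu T -> {ae mu, forall x, P x} ->
  {ae mu, forall x, forall i, P (iter i T x)}.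
Proof.
move=> eT aP; have [T' K K'] := ei_bij eT.
by apply: ae_foralln => i; exact: (ae_PW K K' eT (PW_zit T T' (Posz i)) aP).
Qed.

Lemma measurable_bsum T (u : X -> R) n : ergodic_invertible mu T -> measurable_fun setT u ->
  measurable_fun setT (bsum T u n).
Proof.
move=> eT mu'; apply: measurable_sum => i.
apply: (measurableT_comp mu') => _ B mB.
by rewrite setTI; exact: (ei_iter i eT mB).1.
Qed.

Lemma measurable_norm_gt (C : R) (u : X -> R) : measurable_fun setT u ->
  measurable [set x | C < `|u x|].
Proof. by move=> mu'; apply: measurable_set_lt => //; exact: measurableT_comp. Qed.

Lemma tails_small (u : X -> R) (e : R) : measurable_fun setT u -> 0 < e ->
  exists K : nat, prob mu [set x | K%:R < `|u x|] <= e.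
Proof.
move=> mu' e0.
have [||||K HK] := @prob_to0 _ _ _ mu (fun K : nat => [set x | K%:R < `|u x|]) e.
- by move=> K; exact: measurable_norm_gt.
- by move=> n m nm x /=; apply: le_lt_trans; rewrite ler_nat.
- rewrite (_ : \bigcap_n _ = set0) ?measure0//; apply/seteqP; split=> // x Hx.
  have /= := Hx (Num.bound `|u x|) I; rewrite ltNge => /negP; apply.
  exact/ltW/archi_boundP.
- by [].
by exists K; exact: HK.
Qed.

Variable f : X -> R.
Hypothesis mf : measurable_fun setT f.

Definition tight (M e : R) (T : X -> X) := forall n, prob mu [set x | M < `|bsum T f n x| ] <= e.

(** The sum telescopes to [g x - g (iter n T x)], and both terms have the distribution of [g]: one
    tail of 1/128 is spent on each, whatever [n] is. *)
Lemma coboundary_tight T : ergodic_invertible mu T -> coboundary mu f T ->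
  exists M : nat, tight M%:R 64^-1 T.
Proof.
move=> eT [g [mg fg]].
have e0 : (0 : R) < 128^-1 by rewrite invr_gt0.
have [K HK] := tails_small mg e0; exists (2 * K)%N => n.
have [M [mM M0 MP]] : exists M, [/\ measurable M, prob mu M = 0 &
    forall x, ~ M x -> bsum T f n x = g x - g (iter n T x)].
  have [M [mM M0 HM]] := ei_ae_iter eT fg; exists M; split=> //; first by rewrite /prob M0.
  move=> x nM; have H i : f (iter i T x) = g (iter i T x) - g (iter i.+1 T x).
    have : forall i, f (iter i T x) = g (iter i T x) - g (T (iter i T x)).
      by apply: contrapT => h; exact/nM/HM.
    exact.
  rewrite /bsum (eq_bigr (fun i : 'I_n => g (iter i T x) - g (iter i.+1 T x))); last by move=> i _; exact: H.
  rewrite -(big_mkord xpredT (fun i => g (iter i T x) - g (iter i.+1 T x))).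
  rewrite -opprB -(telescope_sumr (fun i => g (iter i T x)) (leq0n n)) -sumrN.
  by apply: eq_bigr => i _; rewrite opprB.
pose A := [set x | K%:R < `|g x|].
have mA : measurable A by exact: measurable_norm_gt.
have [mAn pAn] := ei_iter n eT mA.
have mAA : measurable (A `|` iter n T @^-1` A) by exact: measurableU.
have := probU mu mAA mM; have := probU mu mA mAn.
have : prob mu [set x | (2 * K)%:R < `|bsum T f n x| ] <= prob mu ((A `|` iter n T @^-1` A) `|` M).
  apply: prob_le.
  - by apply: measurable_norm_gt; exact: measurable_bsum.
  - exact: measurableU.
  move=> x /= lt; apply: contrapT => nx; move: lt; rewrite ltNge => /negP; apply.
  rewrite MP => [|h]; last by apply: nx; right.
  have nA : ~ A x by move=> h; apply: nx; left; left.
  have nAn : ~ A (iter n T x) by move=> h; apply: nx; left; right.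
  rewrite natrM mulr_natl mulr2n; apply: le_trans (ler_normB _ _) _; apply: lerD; rewrite leNgt; exact/negP.
rewrite M0 pAn; move: HK; rewrite -/A; move: (prob mu _) (prob mu _) (prob mu _) (prob mu _) => *; lra.
Qed.

(* The images under [T1] enter through [weak_dev] of the sets [T1^-i A]. *)
Lemma weak_dev_iterates (T T1 : ergodic_class mu) A (e : R) n : measurable A ->
  (forall i, (i < n)%N -> (weak_dev (iter i (repr T1) @^-1` A) T T1 < e%:E)%E) ->
  forall i, (i < n)%N ->
    measurable [set x | ~ (A (iter i (repr T) x) <-> A (iter i (repr T1) x))] /\
    prob mu [set x | ~ (A (iter i (repr T) x) <-> A (iter i (repr T1) x))] <= i%:R * e.
Proof.
move=> mA wd.
have eT := etfunP (repr T); have eT1 := etfunP (repr T1).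
set t := etfun (repr T) in eT *; set t1 := etfun (repr T1) in eT1 *.
have mX i : measurable [set x | ~ (A (iter i t x) <-> A (iter i t1 x))].
  have [m1 _] := ei_iter i eT mA; have [m2 _] := ei_iter i eT1 mA.
  rewrite (_ : [set x | _] = (iter i t @^-1` A `\` iter i t1 @^-1` A) `|` (iter i t1 @^-1` A `\` iter i t @^-1` A)).
    by apply: measurableU; exact: measurableD.
  apply/seteqP; split=> x /=; have [g|g] := pselect (A (iter i t x));
    have [g'|g'] := pselect (A (iter i t1 x)); tauto.
elim=> [|i IH] iN; split=> //.
  rewrite (_ : [set x | _] = set0); first by rewrite /prob measure0 mul0r.
  by apply/seteqP; split=> x //=; tauto.
have [_ {}IH] := IH (ltnW iN).
pose C := iter i.+1 t1 @^-1` A.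
have mC : measurable C by exact: (ei_iter i.+1 eT1 mA).1.
pose Y := (t @` C) `+` (t1 @` C).
have mY : measurable Y.
  by apply: measurableU; apply: measurableD; exact: measurable_image_transf.
have pY : prob mu Y <= e.
  by apply: ltW; rewrite -lte_fin probE//; exact: wd.
pose Q := [set x | ~ (A (iter i t x) <-> A (iter i t1 x))].
have [mQ pQ] := ei_iter 1 eT (mX i); have [mtY ptY] := ei_iter 1 eT mY.
have ti : injective t by exact: bij_inj (ei_bij eT).
have t1i : injective t1 by exact: bij_inj (ei_bij eT1).
have [t1' t1K' t1K] := ei_bij eT1.
have : prob mu [set x | ~ (A (iter i.+1 t x) <-> A (iter i.+1 t1 x))] <= prob mu ((t @^-1` Q) `|` (t @^-1` Y)).
  apply: prob_le; [exact: mX|exact: measurableU|] => x /= nA; apply: contrapT => nx.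
  apply: nA; rewrite -[t (iter i t x)]iterS iterSr.
  have nQ : A (iter i t (t x)) <-> A (iter i t1 (t x)).
    by apply: contrapT => h; apply: nx; left.
  rewrite nQ.
  have nY : ~ Y (t x) by move=> h; apply: nx; right.
  have E1 : (t @` C) (t x) <-> C x by split=> [[y Cy /ti <-]//|Cx]; exists x.
  have E2 : (t1 @` C) (t x) <-> A (iter i t1 (t x)).
    rewrite -{2}[t x]t1K -iterSr; split=> [[y Cy <-]|Cx]; first by rewrite t1K'.
    by exists (t1' (t x)).
  rewrite -E2 -[A (t1 (iter i t1 x))]/(C x) -E1; split=> h; apply: contrapT => h'; apply: nY; [right|left]; by split.
have := probU mu mQ mtY; rewrite [prob mu (t @^-1` Q)]pQ [prob mu (t @^-1` Y)]ptY.
rewrite -[i.+1%:R]natr1 mulrDl mul1r; move: IH pY; rewrite -/Q.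
move: (prob mu _) (prob mu _) (prob mu _) (prob mu _) (i%:R * e) => *; lra.
Qed.

Lemma int_shift (z : int) (m : nat) : - Posz m <= z -> z <= Posz m ->
  exists2 j : nat, (j < (2 * m).+1)%N & z = Posz j - Posz m.
Proof. by move=> h1 h2; exists `|(z + Posz m)%R|%N; lia. Qed.

(* Off a small set the values of [f] along the two orbits lie between the same
   consecutive multiples of [n.+1^-1]. *)
Lemma bsum_near (T1 : ergodic_class mu) n (dl : R) : 0 < dl ->
  \forall U \near T1, prob mu [set x | 1 < `|bsum (repr (U : ergodic_class mu)) f n x -
    bsum (repr T1) f n x| ] <= dl.
Proof.
move=> dl0; have eT1 := etfunP (repr T1).
pose N : R := n.+1%:R; have N0 : 0 < N by rewrite ltr0n.
have dN0 : 0 < dl / 2 / N by rewrite !divr_gt0.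
have nN : n%:R <= N by rewrite ler_nat.
have [K HK] := tails_small mf dN0.
(* The [J] levels cover all integer parts of [N * f] where the absolute value of [f] is at most [K];
   the successor of [K] absorbs the rounding. *)
pose m := (n.+1 * K.+1)%N; pose J := (2 * m).+1.
pose lev (j : nat) := [set x | Num.floor (N * f x) = Posz j - Posz m].
have mlev j : measurable (lev j).
  have mg : measurable_fun setT (fun x => N * f x) by apply: measurable_funM.
  rewrite (_ : lev j = [set x | (Posz j - Posz m)%:~R <= N * f x] `&`
      [set x | N * f x < (Posz j - Posz m + 1)%:~R]).
    by apply: measurableI; [exact: measurable_set_le|exact: measurable_set_lt].
  apply/seteqP; split=> x; rewrite /lev /=.
    by move=> <-; have /andP[] := floor_itv (N * f x).
  by move=> [h1 h2]; apply: floor_def; rewrite h1.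
(* Summed over [J] levels and [n] times, errors of at most [N * e] add up to at most [dl / 2]; the
   other half is for large values of [f]. *)
pose e : R := dl / 2 / N / (J%:R * N).
have J0 : (0 : R) < J%:R by rewrite ltr0n.
have e0 : 0 < e by rewrite !divr_gt0// mulr_gt0.
have nearC : \forall U \near T1, forall ij : 'I_n * 'I_J,
    (@weak_dev R d X mu (iter ij.1 (repr T1) @^-1` lev ij.2) U T1 < e%:E)%E.
  apply: (@filter_forall _ ('I_n * 'I_J)%type (fun ij (U : ergodic_class mu) =>
    (weak_dev (iter ij.1 (repr T1) @^-1` lev ij.2) U T1 < e%:E)%E : Prop) (nbhs T1)) => -[i j] /=; set C := iter i _ @^-1` _.
  have mC : measurable C by exact: (ei_iter i eT1 (mlev j)).1.
  have : nbhs T1 [set S | (weak_dev C S T1 < e%:E)%E]; last by [].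
  rewrite nbhsE; exists [set S | (weak_dev C S T1 < e%:E)%E] => //; split; last first.
    by rewrite /= /weak_dev setYK measure0 lte_fin.
  exists [set [set S | (weak_dev C S T1 < e%:E)%E]]; last by rewrite bigcup_set1.
  move=> _ ->; exists [fset [set S | (weak_dev C S T1 < e%:E)%E]]%fset.
    by move=> U /fset1P ->; rewrite inE; exists T1, C, e.
  by apply/seteqP; split=> [S /(_ _ (fset11 _))//|S dS U /= /fset1P ->].
apply: filterS nearC => U wd.
have eU := etfunP (repr U).
set t := etfun (repr U) in eU *; set t1 := etfun (repr T1) in eT1 *.
pose differ j i := if (i < n)%N && (j < J)%N then [set x | ~ (lev j (iter i t x) <-> lev j (iter i t1 x))] else set0.
have Hd j i : measurable (differ j i) /\ prob mu (differ j i) <= N * e.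
  rewrite /differ; case: ifPn => [/andP[iN jJ]|_]; last first.
    by split=> //; rewrite /prob measure0 mulr_ge0// ltW.
  have [|mD pD] := weak_dev_iterates (T := U) (T1 := T1) (mlev j) (e := e) (n := n) _ iN.
    by move=> k kn; exact: (wd (Ordinal kn, Ordinal jJ)).
  split=> //; apply: le_trans pD _; apply: ler_wpM2r; first exact: ltW.
  by apply: le_trans nN; rewrite ler_nat ltnW.
pose bad1 := [set x | exists i : nat, (i < n)%N /\ (iter i t1 @^-1` [set x | K%:R < `|f x|]) x].
have [mb1 pb1] : measurable bad1 /\ prob mu bad1 <= n%:R * (dl / 2 / N).
  apply: prob_exists => i; first exact: (ei_iter i eT1 (measurable_norm_gt _ mf)).1.
  by rewrite (ei_iter i eT1 (measurable_norm_gt _ mf)).2.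
pose bad2 := [set x | exists j : nat, (j < J)%N /\ [set x | exists i : nat, (i < n)%N /\ differ j i x] x].
have [mb2 pb2] : measurable bad2 /\ prob mu bad2 <= J%:R * (n%:R * (N * e)).
  have Hj j : measurable [set x | exists i : nat, (i < n)%N /\ differ j i x] /\
      prob mu [set x | exists i : nat, (i < n)%N /\ differ j i x] <= n%:R * (N * e).
    by apply: prob_exists => i; [exact: (Hd j i).1|move=> _; exact: (Hd j i).2].
  by apply: prob_exists => j; [exact: (Hj j).1|move=> _; exact: (Hj j).2].
have md : measurable [set x | 1 < `|bsum t f n x - bsum t1 f n x| ].
  by apply: measurable_norm_gt; apply: measurable_funB; exact: measurable_bsum.
have key : prob mu [set x | 1 < `|bsum t f n x - bsum t1 f n x| ] <= prob mu (bad1 `|` bad2).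
  apply: prob_le => //; first exact: measurableU.
  move=> x /= lt; apply: contrapT => nx; move: lt; rewrite ltNge => /negP; apply.
  rewrite /bsum -sumrB; apply: le_trans (ler_norm_sum _ _ _) _.
  apply: (@le_trans _ _ (\sum_(i < n) N^-1)); last first.
    by rewrite sumr_const card_ord -mulr_natl ler_pdivrMr// mul1r.
  apply: ler_sum => i _.
  pose y := iter i t1 x.
  have fy : `|f y| <= K%:R.
    by rewrite leNgt; apply/negP => h; apply: nx; left; exists i.
  have /andP[fl1 fl2] := floor_itv (N * f y).
  have mE : m%:R = N * K%:R + N :> R by rewrite /m natrM -[K.+1%:R]natr1 mulrDr mulr1.
  have [f1 f2] : - (N * K%:R) <= N * f y /\ N * f y <= N * K%:R.
    by move: fy; rewrite ler_norml => /andP[h1 h2]; split; rewrite -?mulrN ler_pM2l.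
  have flo : - Posz m <= Num.floor (N * f y).
    rewrite -ltzD1 -(ltr_int R); apply: le_lt_trans fl2.
    have -> : (- Posz m)%:~R = - m%:R :> R by rewrite mulrNz.
    by apply: le_trans f1; rewrite mE lerN2 lerDl ltW.
  have fhi : Num.floor (N * f y) <= Posz m.
    rewrite -(ler_int R); apply: le_trans fl1 _; apply: le_trans f2 _.
    by rewrite [(Posz m)%:~R]mE lerDl ltW.
  have [j jJ ly] := int_shift flo fhi.
  have lx : lev j (iter i t x).
    apply: contrapT => nl; apply: nx; right; exists j; split=> //; exists i; split=> //.
    by rewrite /differ ltn_ord jJ /= => -[_ /(_ ly)].
  have /andP[fl3 fl4] := floor_itv (N * f (iter i t x)).
  have EF : Num.floor (N * f (iter i t x)) = Num.floor (N * f y) by rewrite lx ly.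
  rewrite EF in fl3 fl4; rewrite -/y.
  have : `|N * f (iter i t x) - N * f y| <= 1.
    move: fl1 fl2 fl3 fl4; rewrite intrD mulr1z; set F := (Num.floor _)%:~R; clearbody F.
    by move=> *; rewrite ler_distl; apply/andP; split; lra.
  by rewrite -mulrBr normrM gtr0_norm// mulrC -ler_pdivlMr// div1r.
have := probU mu mb1 mb2.
have E1 : n%:R * (dl / 2 / N) <= dl / 2 by rewrite mulrCA ler_piMr ?divr_ge0 ?(ltW dl0)// ler_pdivrMr// mul1r.
have E2 : J%:R * (n%:R * (N * e)) <= dl / 2.
  rewrite (_ : _ * _ = n%:R * (dl / 2 / N)) // /e; field.
  by rewrite !gt_eqF.
move: pb1 pb2 key E1 E2; clear.
move: (prob mu _) (prob mu _) (prob mu _) (prob mu _) (n%:R * _) (J%:R * _) => *; lra.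
Qed.

(** The time [n] is fixed before the approximating class is chosen, so closeness of the sums at that
    single time suffices; it costs 1 in the bound and another 1/64 in probability. *)
Lemma closure_tight (M : R) : closure [set U : ergodic_class mu | tight M 64^-1 (repr U)] `<=`
  [set U : ergodic_class mu | tight (M + 1) 32^-1 (repr U)].
Proof.
move=> T1 cl n; have eT1 := etfunP (repr T1).
have e0 : (0 : R) < 64^-1 by rewrite invr_gt0.
have [U [tU pU]] := cl _ (bsum_near T1 n e0); have eU := etfunP (repr U).
have m1 := measurable_norm_gt M (measurable_bsum n eU mf).
have m2 := measurable_norm_gt 1 (measurable_funB (measurable_bsum n eU mf) (measurable_bsum n eT1 mf)).
have : prob mu [set x | M + 1 < `|bsum (repr T1) f n x| ] <= prob mu
    ([set x | M < `|bsum (repr U) f n x| ] `|` [set x | 1 < `|bsum (repr U) f n x - bsum (repr T1) f n x| ]).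
  apply: prob_le; [exact: measurable_norm_gt (measurable_bsum n eT1 mf)|exact: measurableU|].
  move=> x /= lt; have [h1|h1] := ltP M `|bsum (repr U) f n x|; first by left.
  right => /=; rewrite ltNge; apply/negP => h2; move: lt; rewrite ltNge => /negP; apply.
  rewrite -[bsum (repr T1) f n x](subKr (bsum (repr U) f n x)).
  by apply: le_trans (ler_normB _ _) _; exact: lerD.
have := probU mu m1 m2; move: (tU n) pU.
move: (prob mu _) (prob mu _) (prob mu _) (prob mu _) => *; lra.
Qed.

Lemma conj_ergodic (S Sinv V : X -> X) : cancel S Sinv -> cancel Sinv S ->
  ergodic_invertible mu S -> FG S Sinv V -> (forall x, V (V x) = x) ->
  ergodic_invertible mu (V \o S \o V).
Proof.
move=> K K' eS FV VV.
have FS : FG S Sinv S by split; [exact: ei_bij eS|exact: (PW_zit S Sinv 1)].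
have F := FG_comp K K' eS (FG_comp K K' eS FV FS) FV.
split.
- exact: F.1.
- exact: (PW_fun K K' eS F.2).
- by move=> A mA; exact: (FG_image K K' eS F mA).1.
- by move=> A mA; exact: (FG_preimage K K' eS F mA).2.
move=> A mA iA; have [mVA VA] := FG_preimage K K' eS FV mA.
rewrite -VA; apply: (ei_ergodic eS mVA).
rewrite -[in RHS]iA; apply/seteqP; split=> x /=; by rewrite VV.
Qed.

(** A bound [dl] valid for all [V] is obtained by contradiction: counterexamples with supports of
    measure at most [n.+1%:R^-1] would give conjugates converging weakly to [T0]. *)
Lemma near_conj (T0 : ergodic_class mu) (O : set (ergodic_class mu)) (Sinv : X -> X) :
  nbhs T0 O -> cancel (repr T0) Sinv -> cancel Sinv (repr T0) ->
  exists2 dl : R, 0 < dl & forall (V : X -> X) (W : set X) (t : ergodic_transf mu),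
    FG (repr T0) Sinv V -> (forall x, V (V x) = x) -> measurable W -> prob mu W <= dl ->
    (forall x, V x <> x -> W x) -> (t : X -> X) = V \o repr T0 \o V ->
    O (\pi_(ergodic_class mu) t)%qT.
Proof.
set S := etfun (repr T0) => nO K K'; apply: contrapT => H.
have eS : ergodic_invertible mu S := etfunP (repr T0).
have /choice[F HF] n : exists p : (X -> X) * set X * ergodic_transf mu,
    [/\ FG S Sinv p.1.1, forall x, p.1.1 (p.1.1 x) = x,
      measurable p.1.2 /\ prob mu p.1.2 <= n.+1%:R^-1 /\ (forall x, p.1.1 x <> x -> p.1.2 x),
      (p.2 : X -> X) = p.1.1 \o S \o p.1.1 & ~ O (\pi_(ergodic_class mu) p.2)%qT].
  apply: contrapT => nH; apply: H; exists n.+1%:R^-1; first by rewrite invr_gt0.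
  move=> V W t FV VV mW pW VW tE; apply: contrapT => nO'; apply: nH.
  by exists (V, W, t).
have : (\pi_(ergodic_class mu) (F n).2)%qT @[n --> \oo] --> T0.
  apply/weak_cvgP => A mA.
  have key n : (weak_dev A (\pi_(ergodic_class mu) (F n).2)%qT T0 <= (n.+1%:R^-1 + n.+1%:R^-1)%:E)%E.
    have [FV VV [mW [pW VW]] tE _] := HF n; case: (F n) FV VV mW pW VW tE => -[V W] t /=.
    move=> FV VV mW pW VW tE.
    rewrite -[T0]reprK (weak_dev_pi _ _ mA) tE -/S.
    have mVm B : measurable B -> measurable (V @` B) := fun mB => (FG_image K K' eS FV mB).1.
    have mSm B : measurable B -> measurable (S @` B) by exact: (ei_image_measurable eS).
    (* The map [V] changes any set only within [W]. It occurs twice in the conjugate, which accounts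
       for the two terms of the bound. *)
    have Vdiff B : measurable B -> (mu ((V @` B) `+` B) <= (n.+1%:R^-1)%:E)%E.
      move=> mB; apply: (@le_trans _ _ (mu W)); last by rewrite -probE// lee_fin.
      apply: probability_le => //.
        by apply: measurableU; apply: measurableD => //; exact: mVm.
      move=> x [[[y By Vy] nB]|[Bx nV]]; apply: VW => Vx.
        by apply: nB; rewrite -Vx -Vy VV.
      by apply: nV; exists x.
    have -> : [set (V \o S \o V) x | x in A] = V @` (S @` (V @` A)).
      apply/seteqP; split=> x; first by move=> [y Ay <-]; exists (S (V y)) => //; exists (V y) => //; exists y.
      by move=> [_ [_ [y Ay <-] <-] <-]; exists y.
    have m1 : measurable (V @` A) by exact: mVm.
    have m2 : measurable (S @` (V @` A)) by exact: mSm.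
    have m3 : measurable (S @` A) by exact: mSm.
    apply: le_trans (measure_setY_triangle mu (mVm _ m2) m2 m3) _; rewrite EFinD.
    apply: leeD; first exact: Vdiff.
    have -> : (S @` (V @` A)) `+` (S @` A) = S @` ((V @` A) `+` A).
      have Si : injective S := can_inj K.
      apply/seteqP; split=> x.
        move=> [[[y Vy <-] nS]|[[y Ay <-] nS]]; exists y => //; [left|right]; split=> // h; apply: nS; by exists y.
      move=> [y [[Vy nA]|[Ay nV]] <-]; [left|right]; split; try (by exists y); move=> [z hz /Si E]; subst z; by [].
    rewrite (_ : mu (S @` _) = mu ((V @` A) `+` A)); first exact: Vdiff.
    apply: (measure_image_transf (repr T0)).
    by apply: measurableU; exact: measurableD.
  have cv0 : ((n.+1%:R^-1 + n.+1%:R^-1 : R)%:E) @[n --> \oo] --> 0%E.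
    apply: cvg_EFin; first by near=> n.
    rewrite -[X in _ --> X]addr0; apply: cvgD; exact: cvg_harmonic.
  apply: (squeeze_cvge _ (cvg_cst 0%E) cv0).
  by near=> n; rewrite key andbT; exact: measure_ge0.
move=> /(_ _ nO) [N _ HN]; have [_ _ _ _] := HF N; apply; exact: HN (leqnn N).
Unshelve. all: by end_near. Qed.

Variables (phi : X -> R).
Hypotheses (mphi : measurable_fun setT phi) (phi01 : forall x, 0 <= phi x <= 1).
Hypothesis phi_atomless : forall t, mu (phi @^-1` [set t]) = 0%E.
Hypothesis f0 : (0 < mu [set x | f x != 0%R])%E.

(** The case left by [separated_levels]: [r] is nonzero by [f0], and the sums [n * r] leave every
    bound. *)
Lemma constant_not_tight (r M : R) (T : X -> X) : ergodic_invertible mu T ->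
  {ae mu, forall x, f x = r} -> ~ tight M 32^-1 T.
Proof.
move=> eT fr tM.
have r0 : r != 0.
  apply/eqP => r0; move: f0; rewrite lt_neqAle => /andP[/eqP + _]; apply; apply/esym.
  have mN : measurable [set x | f x != 0].
    rewrite (_ : [set x | f x != 0] = ~` (f @^-1` [set 0])).
      by apply: measurableC; rewrite -[X in measurable X]setTI; exact: mf.
    by apply/seteqP; split=> x /= => [/eqP|h]; last exact/eqP.
  apply/negligibleP => //; apply: negligibleS fr => x /= fx fr'.
  by rewrite fr' r0 eqxx in fx.
have rp : 0 < `|r| by rewrite normr_gt0.
have [n nM] : exists n : nat, M < n%:R * `|r|.
  have h : 0 <= `|M| / `|r| by rewrite divr_ge0.
  exists (Num.bound (`|M| / `|r|)); rewrite -ltr_pdivrMr//.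
  by apply: le_lt_trans (archi_boundP h); rewrite ler_pM2r ?invr_gt0// ler_norm.
have [N [mN N0 HN]] := ei_ae_iter eT fr.
have mB := measurable_norm_gt M (measurable_bsum n eT mf).
have sub : ~` N `<=` [set x | M < `|bsum T f n x| ].
  move=> x nN /=; have H : forall i, f (iter i T x) = r by apply: contrapT => h; exact/nN/HN.
  by rewrite /bsum (eq_bigr (fun=> r)) => [|i _]; rewrite ?H// sumr_const card_ord -mulr_natl normrM normr_nat.
have := tM n; have := prob_le mu (measurableC mN) mB sub; have := prob_setC mu mN.
rewrite [prob mu N](_ : _ = 0); last by rewrite /prob N0.
move: (prob mu _) (prob mu _) => *; lra.
Qed.

(** Tightness of [S] and of its conjugate bounds both sums by [M + 1] up to 1/32 each, hence their
    difference by [2 * (M + 1)] up to 1/16; [unstable_swap] makes it larger with probability above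
    1/8. *)
Lemma tight_nowhere_dense (M : R) :
  nowhere_dense [set U : ergodic_class mu | tight M 64^-1 (repr U)].
Proof.
apply/seteqP; split=> // T0 iT0.
have t0 : tight (M + 1) 32^-1 (repr T0) by apply: closure_tight; exact: interior_subset iT0.
have eS := etfunP (repr T0); set S := etfun (repr T0) in t0 eS.
have [Sinv K K'] := ei_bij eS.
have [[r fr]|[a [b [ab pa pb]]]] := separated_levels mu mf.
  exact: constant_not_tight eS fr t0.
have [dl dl0 Hdl] := near_conj iT0 K K'.
have ma : measurable [set x | f x <= a] by exact: measurable_set_le.
have mb : measurable [set x | b <= f x] by exact: measurable_set_le.
have [D [mD Da D0 Dd Dc]] := shrinking_sets mphi phi01 phi_atomless ma pa.
have [||n Dn] := @prob_to0 _ _ _ mu D (dl / 2) mD Dd.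
- rewrite (_ : \bigcap_n D n = set0) ?measure0//; apply/seteqP; split=> // x Hx.
  by have [n] := Dc x; apply; exact: Hx.
- by rewrite divr_gt0.
have [V [N [FV VV [W mW [pW VW]] drift]]] := unstable_swap K K' eS mphi phi01 phi_atomless
  (2 * (M + 1)) mf ab (mD n) mb (D0 n) pb (Da n) (fun x h => h).
have eT1 := conj_ergodic K K' eS FV VV.
pose t := ErgodicTransf eT1.
have pWd : prob mu W <= dl.
  by apply: le_trans pW _; have := Dn n (leqnn n); move: (prob mu _) => *; lra.
have /closure_tight t1 : closure [set U : ergodic_class mu | tight M 64^-1 (repr U)] (\pi_(ergodic_class mu) t)%qT.
  exact: (Hdl V W t).
have [Q [mQ Q0 HQ]] := ei_ae_iter eT1 (repr_pi_ae t).
have mfV : measurable_fun setT (f \o V) := measurableT_comp mf (PW_fun K K' eS FV.2).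
have m1 := measurable_norm_gt (M + 1) (measurable_bsum N eS mf).
have m2 := measurable_norm_gt (M + 1) (measurable_bsum N eS mfV).
have m3 := measurable_norm_gt (M + 1) (measurable_bsum N (etfunP (repr (\pi_(ergodic_class mu) t)%qT)) mf).
have Q00 : prob mu Q = 0 by rewrite /prob Q0.
(* The sums of [f] along the conjugate from [x] are those of [f \o V] along [S] from [V x], and [V]
   preserves [mu]. The set [Q] accounts for the change of representative. *)
have p2 : prob mu [set x | M + 1 < `|bsum S (f \o V) N x| ] <= 32^-1.
  have [mV2 V2] := FG_preimage K K' eS FV m2.
  rewrite (_ : prob mu _ = prob mu (V @^-1` [set x | M + 1 < `|bsum S (f \o V) N x| ])); last first.
    by rewrite /prob V2.
  have : prob mu (V @^-1` [set x | M + 1 < `|bsum S (f \o V) N x| ]) <= prob mu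
      ([set x | M + 1 < `|bsum (repr (\pi_(ergodic_class mu) t)%qT) f N x| ] `|` Q).
    apply: prob_le => //; first exact: measurableU.
    move=> x /= lt; have [Qx|nQ] := pselect (Q x); [by right|left => /=].
    have Ht : forall i, repr (\pi_(ergodic_class mu) t)%qT (iter i t x) = t (iter i t x).
      by apply: contrapT => h; exact/nQ/HQ.
    have Et i : iter i (repr (\pi_(ergodic_class mu) t)%qT) x = V (iter i S (V x)).
      have -> : iter i (repr (\pi_(ergodic_class mu) t)%qT) x = iter i t x.
        by elim: i => //= i ->; exact: Ht.
      by elim: i => /= [|i ->]; rewrite VV.
    by rewrite /bsum (eq_bigr (fun i : 'I_N => (f \o V) (iter i S (V x)))) // => i _; rewrite Et.
  have := probU mu m3 mQ; move: (t1 N) => /=; rewrite Q00.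
  by move: (prob mu _) (prob mu _) (prob mu _) => *; lra.
have mh : measurable_fun setT (fun x => f (V x) - f x) by exact: measurable_funB.
have m4 := measurable_norm_gt (2 * (M + 1)) (measurable_bsum N eS mh).
have : prob mu [set x | 2 * (M + 1) < `|bsum S (fun x => f (V x) - f x) N x| ] <= prob mu
    ([set x | M + 1 < `|bsum S f N x| ] `|` [set x | M + 1 < `|bsum S (f \o V) N x| ]).
  apply: prob_le => //; first exact: measurableU.
  move=> x /= lt; apply: contrapT => nx; move: lt; rewrite ltNge => /negP; apply.
  have n1 : ~ M + 1 < `|bsum S f N x| by move=> h; apply: nx; left.
  have n2 : ~ M + 1 < `|bsum S (f \o V) N x| by move=> h; apply: nx; right.
  rewrite /bsum sumrB mulr_natl mulr2n; apply: le_trans (ler_normB _ _) _.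
  by apply: lerD; rewrite leNgt; exact/negP.
have := probU mu m1 m2; move: p2 drift (t0 N).
by move: (prob mu _) (prob mu _) (prob mu _) (prob mu _) => *; lra.
Qed.

Lemma coboundary_meager : meager [set U : ergodic_class mu | coboundary mu f (repr U)].
Proof.
exists (fun M : nat => [set U : ergodic_class mu | tight M%:R 64^-1 (repr U)]); split.
  by move=> M; exact: tight_nowhere_dense.
by move=> U /(coboundary_tight (etfunP (repr U)))[M tM]; exists M.
Qed.

End meager_part.

(** * An irrational rotation on a standard space *)

Section rotation.
Variable R : realType.
Notation leb := (@lebesgue_measure R).
Implicit Types (t a b : R) (B : set R).

Lemma lebesgue_translate a B : measurable B -> measurable [set t | B (t + a)] /\ leb [set t | B (t + a)] = leb B.
Proof.
move=> mB.
have mt : measurable_fun setT (fun t : measurableTypeR R => (t + a : measurableTypeR R)).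
  exact: measurable_funD.
split; first by rewrite -[X in measurable X]setTI; exact: mt.
pose nu := pushforward leb (fun t : measurableTypeR R => (t + a : measurableTypeR R)).
rewrite -[LHS]/(nu B); apply/esym.
apply: (lebesgue_measure_unique (mu := nu)) => //.
move=> _ [[c e] /= ce <-].
rewrite lebesgue_measure_itv /nu /pushforward.
rewrite (_ : _ @^-1` _ = [set` `]c - a, e - a]]).
  rewrite lebesgue_measure_itv /= !lte_fin ltrD2r; case: ifPn => // _.
  by rewrite -!EFinD; congr EFin; ring.
by apply/seteqP; split=> t; rewrite /= !in_itv /= ltrBlDr lerBrDr.
Qed.

(** A quadratic unit: by [alpha_sq] its powers are integer combinations of 1 and [alpha], and they
    tend to 0, which replaces Fourier series in the proof of ergodicity. *)
Definition alpha : R := Num.sqrt 2 - 1.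

Lemma alpha_sq : alpha ^+ 2 = 1 - 2 * alpha.
Proof.
have h : Num.sqrt 2 ^+ 2 = 2 :> R by apply: sqr_sqrtr.
by rewrite /alpha sqrrB h; ring.
Qed.

Lemma alpha01 : 0 < alpha < 1.
Proof.
rewrite /alpha subr_gt0 -{1}[1]sqrtr1 ltr_sqrt// ltr1n /= ltrBlDr.
have -> : 1 + 1 = Num.sqrt (2 ^+ 2) :> R by rewrite sqrtr_sqr ger0_norm.
by rewrite ltr_sqrt ?exprn_gt0// expr2 ltr_pMr// ltr1n.
Qed.

Definition rot t : R := if (0 <= t < 1) then (if t < 1 - alpha then t + alpha else t + alpha - 1) else t.
Definition unrot t : R := if (0 <= t < 1) then (if t < alpha then t - alpha + 1 else t - alpha) else t.

Lemma rot01 t : (0 <= rot t < 1) = (0 <= t < 1).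
Proof.
have /andP[a0 a1] := alpha01; rewrite /rot.
have [/andP[t0 t1]|t01] := boolP (0 <= t < 1); last exact/negbTE.
by case: ltP => h; apply/andP; split; lra.
Qed.

Lemma unrot01 t : (0 <= unrot t < 1) = (0 <= t < 1).
Proof.
have /andP[a0 a1] := alpha01; rewrite /unrot.
have [/andP[t0 t1]|t01] := boolP (0 <= t < 1); last exact/negbTE.
by case: ltP => h; apply/andP; split; lra.
Qed.

Lemma rotK : cancel rot unrot.
Proof.
move=> t; rewrite /unrot rot01 /rot; have /andP[a0 a1] := alpha01.
have [/andP[t0 t1]|//] := boolP (0 <= t < 1); have [h|h] := ltP t (1 - alpha).
  by case: ltP => h'; lra.
by case: ltP => h'; lra.
Qed.

Lemma unrotK : cancel unrot rot.
Proof.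
move=> t; rewrite /rot unrot01 /unrot; have /andP[a0 a1] := alpha01.
have [/andP[t0 t1]|//] := boolP (0 <= t < 1); have [h|h] := ltP t alpha.
  by case: ltP => h'; lra.
by case: ltP => h'; lra.
Qed.

Lemma measurable_two_pieces (c : R) (u v w : R -> R) : measurable_fun setT u -> measurable_fun setT v ->
  measurable_fun setT w ->
  measurable_fun setT (fun t => if (0 <= t < 1) then (if t < c then u t else v t) else w t).
Proof.
move=> mu mv mw; apply: measurable_fun_ifT => //.
  by apply: measurable_and; [exact: measurable_fun_ler|exact: measurable_fun_ltr].
by apply: measurable_fun_ifT => //; exact: measurable_fun_ltr.
Qed.

Lemma measurable_rot : measurable_fun setT rot.
Proof.
apply: measurable_two_pieces => //; last by apply: measurable_funB => //; exact: measurable_funD.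
exact: measurable_funD.
Qed.

Lemma measurable_unrot : measurable_fun setT unrot.
Proof.
apply: measurable_two_pieces => //; last exact: measurable_funB.
by apply: measurable_funD => //; exact: measurable_funB.
Qed.

Definition unit_ico : set R := [set t | 0 <= t < 1].

Definition ico a b : set R := [set t | a <= t < b].

Lemma icoE a b : ico a b = [set` `[a, b[].
Proof. by apply/seteqP; split=> t; rewrite /= in_itv. Qed.

Lemma measurable_ico a b : measurable (ico a b).
Proof. by rewrite icoE. Qed.

Lemma ico_cat a b c : a <= b -> b <= c -> ico a c = ico a b `|` ico b c /\ ico a b `&` ico b c = set0.
Proof.
move=> ab bc; split; apply/seteqP; split=> t //.
- by move=> /andP[h1 h2]; have [h|h] := ltP t b; [left|right]; apply/andP; split.
- case=> /andP[h1 h2]; apply/andP; split=> //; [exact: lt_le_trans h2 bc|exact: le_trans ab h1].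
- by move=> [/andP[_ h2] /andP[h3 _]]; move: (lt_le_trans h2 h3); rewrite ltxx.
Qed.

Lemma rot_ico_low t u : 0 <= t <= 1 - alpha -> unit_ico u ->
  ico alpha (t + alpha) (rot u) <-> ico 0 t u.
Proof.
have /andP[a0 a1] := alpha01; rewrite /unit_ico /ico /= /rot => /andP[t0 t1] u01.
rewrite u01; have /andP[u0 u1] := u01.
by case: ltP => h; split=> /andP[h1 h2]; apply/andP; split; lra.
Qed.

Lemma rot_ico_high t u : 1 - alpha <= t <= 1 -> unit_ico u ->
  ico 0 (t + alpha - 1) (rot u) <-> ico (1 - alpha) t u.
Proof.
have /andP[a0 a1] := alpha01; rewrite /unit_ico /ico /= /rot => /andP[t0 t1] u01.
rewrite u01; have /andP[u0 u1] := u01.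
by case: ltP => h; split=> /andP[h1 h2]; apply/andP; split; lra.
Qed.

(** An exchange of two intervals: [[0, c)] is translated by [a] onto [[1 - c, 1)] and [[c, 1)] by
    [b] onto [[0, 1 - c)]. In this generality it covers the rotation and its inverse. *)
Lemma measure_two_pieces (r : R -> R) (c a b : R) B : measurable B -> 0 <= c <= 1 ->
  (forall t, 0 <= t < c -> r t = t + a) -> (forall t, c <= t < 1 -> r t = t + b) ->
  (forall t, 0 <= t < c -> 1 - c <= t + a < 1) -> (forall t, 1 - c <= t < 1 -> 0 <= t - a < c) ->
  (forall t, c <= t < 1 -> 0 <= t + b < 1 - c) -> (forall t, 0 <= t < 1 - c -> c <= t - b < 1) ->
  leb (r @^-1` B `&` unit_ico) = leb (B `&` unit_ico).
Proof.
move=> mB /andP[c0 c1] ra rb ia ja ib jb.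
pose B1 := B `&` ico (1 - c) 1; pose B2 := B `&` ico 0 (1 - c).
have mB1 : measurable B1 by apply: measurableI => //; exact: measurable_ico.
have mB2 : measurable B2 by apply: measurableI => //; exact: measurable_ico.
have [m1 l1] := lebesgue_translate a mB1; have [m2 l2] := lebesgue_translate b mB2.
have E1 : r @^-1` B `&` unit_ico = [set t | B1 (t + a)] `|` [set t | B2 (t + b)].
  apply/seteqP; split=> t.
    move=> [Bt /andP[t0 t1]]; have [h|h] := ltP t c.
      have tc : 0 <= t < c by rewrite t0.
      by left; split; [rewrite -ra|exact: ia].
    have tc : c <= t < 1 by rewrite h.
    by right; split; [rewrite -rb|exact: ib].
  case=> -[Bt it].
    have /= := ja _ it; rewrite addrK => tc; have /andP[t0 tc'] := tc.
    by split; [rewrite /preimage /= ra|rewrite /unit_ico /= t0 (lt_le_trans tc')].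
  have /= := jb _ it; rewrite addrK => tc; have /andP[t0 tc'] := tc.
  by split; [rewrite /preimage /= rb|rewrite /unit_ico /= tc' (le_trans c0)].
have E2 : B `&` unit_ico = B1 `|` B2.
  apply/seteqP; split=> t.
    move=> [Bt /andP[t0 t1]]; have [h|h] := ltP t (1 - c); first by right; split=> //; rewrite /ico /= t0.
    by left; split=> //; rewrite /ico /= h.
  by case=> -[Bt /andP[t0 t1]]; split=> //; rewrite /unit_ico /=; apply/andP; split; lra.
have lebU A A' : measurable A -> measurable A' -> A `&` A' = set0 ->
    leb (A `|` A') = (leb A + leb A')%E by exact: measureU.
rewrite E1 E2 !lebU// ?l1 ?l2//.
  by apply/seteqP; split=> t // [[_ /andP[h1 h2]] [_ /andP[h3 h4]]]; lra.
apply/seteqP; split=> t // [[_ /ja +] [_ /jb]]; rewrite /= !addrK => /andP[h1 h2] /andP[h3 h4]; lra.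
Qed.

Lemma rot_preserving B : measurable B -> leb (rot @^-1` B `&` unit_ico) = leb (B `&` unit_ico).
Proof.
move=> mB; have /andP[a0 a1] := alpha01.
apply: (@measure_two_pieces _ (1 - alpha) alpha (alpha - 1)) => //.
- by apply/andP; split; lra.
- move=> t /andP[t0 t1]; rewrite /rot t1 t0 (_ : t < 1)//; lra.
- move=> t /andP[t0 t1]; rewrite /rot t1 ltNge t0 (_ : 0 <= t) /= ?addrA//; lra.
- by move=> t /andP[t0 t1]; apply/andP; split; lra.
- by move=> t /andP[t0 t1]; apply/andP; split; lra.
- by move=> t /andP[t0 t1]; apply/andP; split; lra.
- by move=> t /andP[t0 t1]; apply/andP; split; lra.
Qed.

Lemma unrot_preserving B : measurable B -> leb (unrot @^-1` B `&` unit_ico) = leb (B `&` unit_ico).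
Proof.
move=> mB; have /andP[a0 a1] := alpha01.
apply: (@measure_two_pieces _ alpha (1 - alpha) (- alpha)) => //.
- by apply/andP; split; lra.
- move=> t /andP[t0 t1]; rewrite /unrot t1 t0 (lt_trans t1 a1) /=; ring.
- move=> t /andP[t0 t1]; by rewrite /unrot t1 ltNge t0 (le_trans (ltW a0) t0).
- by move=> t /andP[t0 t1]; apply/andP; split; lra.
- by move=> t /andP[t0 t1]; apply/andP; split; lra.
- by move=> t /andP[t0 t1]; apply/andP; split; lra.
- by move=> t /andP[t0 t1]; apply/andP; split; lra.
Qed.

(* [D t = F t - t F 1] extends to a function with periods [1] and [alpha], hence,
   as [alpha ^ 2 = 1 - 2 alpha], with all periods [alpha ^ n]. *)
Lemma rotation_linear (F : R -> R) : (forall t, 0 <= t <= 1 -> 0 <= F t <= t) ->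
  F 1 <= 1 ->
  (forall t, 0 <= t < 1 - alpha -> F (t + alpha) = F t + F alpha) ->
  (forall t, 1 - alpha <= t < 1 -> F (t + alpha - 1) = F t - F 1 + F alpha) ->
  forall t, 0 <= t <= 1 -> F t = t * F 1.
Proof.
move=> F0 F1 Fa Fb; have /andP[a0 a1] := alpha01.
pose D0 t := F t - t * F 1.
have F1p : 0 <= F 1 by have /andP[] := F0 1 ltac:(by rewrite ler01 lexx).
have D0b t : 0 <= t <= 1 -> - t <= D0 t <= t.
  move=> t01; have /andP[f0 f1] := F0 t t01; have /andP[t0 _] := t01.
  have : 0 <= t * F 1 <= t by rewrite mulr_ge0//= ler_piMr.
  by move=> /andP[h1 h2]; rewrite /D0; apply/andP; split; lra.
have D0rot t : 0 <= t < 1 -> D0 (rot t) = D0 t + D0 alpha.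
  move=> t01; rewrite /rot t01; have /andP[t0 t1] := t01; case: ltP => h.
    by rewrite /D0 Fa ?t0//; ring.
  by rewrite /D0 Fb ?h//; ring.
(* Along the rotation orbit of 0 the bounded function [D0] would grow by [D0 alpha] at each step. *)
have Da : D0 alpha = 0.
  have it n : 0 <= iter n rot 0 < 1 /\ D0 (iter n rot 0) = D0 0 + n%:R * D0 alpha.
    elim: n => [|n [IH1 IH2]]; first by rewrite /= lexx ltr01 mul0r addr0.
    split; first by rewrite iterS rot01.
    by rewrite iterS D0rot// IH2 -[n.+1%:R]natr1; ring.
  have D00 : D0 0 = 0.
    have := D0b 0; rewrite lexx ler01 oppr0 => /(_ isT) h; apply/eqP; rewrite eq_le andbC; exact: h.
  have bd n : n%:R * `|D0 alpha| <= 1.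
    have [/andP[i0 i1] E] := it n; have := D0b _ (_ : 0 <= iter n rot 0 <= 1).
    rewrite i0 (ltW i1) => /(_ isT); rewrite E D00 add0r -ler_norml normrM normr_nat.
    by move=> /le_trans; apply; exact: ltW.
  apply/eqP; rewrite -normr_le0 leNgt; apply/negP => p.
  have h : 0 <= 1 / `|D0 alpha| by rewrite divr_ge0.
  have := archi_boundP h; rewrite ltr_pdivrMr// ltNge => /negP; apply; exact: bd.
pose fr t := t - (Num.floor t)%:~R.
have fr01 t : 0 <= fr t < 1.
  by have /andP[h1 h2] := floor_itv t; rewrite /fr subr_ge0 h1 ltrBlDl -[1]/(1%:~R) -intrD.
have fr_unique t (k : int) : 0 <= t - k%:~R < 1 -> fr t = t - k%:~R.
  move=> /andP[h1 h2]; rewrite /fr (floor_def (m := k))//.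
  by rewrite -subr_ge0 h1 intrD -ltrBlDl.
pose D t := D0 (fr t).
pose per p := forall t, D (t + p) = D t.
have perB p q : per p -> per q -> per (p - q).
  by move=> hp hq t; rewrite -(hq (t + (p - q))) addrA subrK hp.
have per0 : per 0 by move=> t; rewrite addr0.
have perN p : per p -> per (- p) by move=> hp; rewrite -sub0r; exact: perB.
have perD p q : per p -> per q -> per (p + q).
  by move=> hp hq; rewrite -[q]opprK; apply: perB => //; exact: perN.
have per1 : per 1.
  move=> t; rewrite /D; congr D0.
  rewrite (@fr_unique _ (Num.floor t + 1)) intrD; first by rewrite /fr; ring.
  by have := fr01 t; rewrite /fr => h; rewrite (_ : _ - _ = t - (Num.floor t)%:~R)//; ring.
have pera : per alpha.
  move=> t; rewrite /D -[RHS]addr0 -Da -D0rot//; congr D0.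
  rewrite /rot fr01; have /andP[h1 h2] := fr01 t; case: ltP => h.
    rewrite (@fr_unique _ (Num.floor t)); first by rewrite /fr; ring.
    by move: h1 h2 h; rewrite /fr => *; apply/andP; split; lra.
  rewrite (@fr_unique _ (Num.floor t + 1)) intrD; first by rewrite /fr; ring.
  by move: h1 h2 h; rewrite /fr => *; apply/andP; split; lra.
have peran n : per (alpha ^+ n) /\ per (alpha ^+ n.+1).
  elim: n => [|n [IH1 IH2]]; first by rewrite expr0 expr1.
  split=> //; rewrite -[n.+2]addn2 exprD alpha_sq.
  rewrite (_ : _ * _ = alpha ^+ n - alpha ^+ n.+1 - alpha ^+ n.+1); last by rewrite exprS; ring.
  by apply: (perB) => //; exact: perB.
have perk p (k : int) : per p -> per (k%:~R * p).
  move=> hp; have nat_ (n : nat) : per (n%:R * p).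
    by elim: n => [|n IH]; rewrite ?mul0r// -[n.+1%:R]natr1 mulrDl mul1r; exact: perD.
  case: k => n; first exact: nat_.
  by rewrite NegzE mulrNz mulNr; apply: perN; exact: nat_.
(* Subtracting a multiple of the period [alpha ^+ n] brings [t] into [[0, alpha ^+ n)], where [D0]
   is at most [alpha ^+ n] in absolute value. *)
have Dt t : D t = 0.
  apply/eqP; rewrite -normr_le0 leNgt; apply/negP => p.
  have : alpha ^+ n @[n --> \oo] --> (0 : R) by apply: cvg_expr; rewrite gtr0_norm.
  move=> /cvgrPdist_lt /(_ _ p)[n _ /(_ n (leqnn n))]; rewrite sub0r normrN gtr0_norm ?exprn_gt0//.
  rewrite ltNge => /negP; apply.
  have an0 : 0 < alpha ^+ n by rewrite exprn_gt0.
  pose k := Num.floor (t / alpha ^+ n).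
  have [pn _] := peran n.
  have /andP[k1 k2] := floor_itv (t / alpha ^+ n).
  have u0 : 0 <= t - k%:~R * alpha ^+ n by rewrite subr_ge0 -ler_pdivlMr.
  have u1 : t - k%:~R * alpha ^+ n < alpha ^+ n.
    by rewrite ltrBlDl -{2}[alpha ^+ n]mul1r -mulrDl -ltr_pdivrMr// -[1]/(1%:~R) -intrD.
  have an1 : alpha ^+ n <= 1 by rewrite exprn_ile1// ltW.
  rewrite -(perN _ (perk _ k pn) t); set u := _ - _ in u0 u1 *.
  have -> : D u = D0 u by rewrite /D (@fr_unique _ 0) subr0// u0 (lt_le_trans u1).
  have := D0b u; rewrite u0 (le_trans (ltW u1)) ?(ltW an1)// => /(_ isT).
  by rewrite -ler_norml => /le_trans; apply; exact: ltW.
move=> t /andP[t0]; rewrite le_eqVlt => /predU1P[->|t1]; first by rewrite mul1r.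
have := Dt t; rewrite /D (@fr_unique _ 0) subr0; last by rewrite t0.
by move=> /eqP; rewrite subr_eq0 => /eqP.
Qed.

End rotation.

(** * Transporting the rotation to the probability space *)

Section transport.
Context {R : realType} {d : measure_display} {X : measurableType d}.
Variable mu : probability X R.
Notation leb := (@lebesgue_measure R).
Notation unit_ico := (@unit_ico R).
Implicit Types (B N : set R) (A E : set X).

Definition leb_null N := leb (N `&` unit_ico) = 0%E.

(* [comp] holds for the completed structure, in which all subsets of null sets
   are measurable. *)
Definition coded (X1 : set X) (phi : X -> R) (comp : Prop) A B N :=
  [/\ measurable B, measurable N, leb_null N,
    forall x, X1 x -> ~ N (phi x) -> (A x <-> B (phi x)) & comp \/ N = set0].

Variables (X1 : set X) (phi : X -> R) (comp : Prop) (P0 : set R).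
Hypotheses (mX1 : measurable X1) (X1c : mu (~` X1) = 0%E).
Hypothesis phi_inj : forall x y, X1 x -> X1 y -> phi x = phi y -> x = y.
Hypothesis phi_bound : forall x, X1 x -> 0 <= phi x <= 1.
Let pre B : set X := X1 `&` phi @^-1` B.
Hypothesis law : forall B, measurable B -> measurable (pre B) /\ mu (pre B) = leb (B `&` unit_ico).
Hypotheses (mP0 : measurable P0) (nullP0 : leb_null P0).
Hypothesis surj : forall t, unit_ico t -> ~ P0 t -> exists x, X1 x /\ phi x = t.
Hypothesis codedP : forall A, A `<=` X1 -> measurable A <-> exists B N, coded X1 phi comp A B N.

Let mpre B (mB : measurable B) : measurable (pre B) := (law mB).1.

Lemma mu_eq_off A A' (Q : set X) : measurable A -> measurable A' -> measurable Q -> mu Q = 0%E ->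
  (forall x, ~ Q x -> (A x <-> A' x)) -> mu A = mu A'.
Proof.
move=> mA mA' mQ Q0 H.
rewrite -(probability_setD0 mA mQ Q0) -(probability_setD0 mA' mQ Q0); congr (mu _).
by apply/seteqP; split=> x [Ax nQ]; split=> //; apply/H.
Qed.

Lemma coded_measure A B N : A `<=` X1 -> measurable A -> coded X1 phi comp A B N ->
  mu A = leb (B `&` unit_ico).
Proof.
move=> AX mA [mB mN N0 H _]; rewrite -(law mB).2.
apply: (mu_eq_off mA (mpre mB) (mpre mN)); first by rewrite (law mN).2.
move=> x nN; split=> [Ax|[X1x Bx]].
  have X1x := AX x Ax; split=> //; apply/(H x X1x) => // Nx; exact: nN.
by apply/(H x X1x) => // Nx; exact: nN.
Qed.

(** Points outside [P0] have a preimage under [phi]. Keeping those whose whole orbit stays outside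
    [P0] leaves a conull set, invariant in both directions, on which the rotation lifts
    pointwise. *)
Let orbits_avoid (t : R) := forall n : nat, ~ P0 (iter n (@rot R) t) /\ ~ P0 (iter n (@unrot R) t).

Let G : set R := unit_ico `&` orbits_avoid.

Let rotG t : G t -> G (rot t).
Proof.
move=> [t01 av]; split; first by rewrite /unit_ico /= rot01.
move=> n; split; first by rewrite -iterSr; exact: (av n.+1).1.
case: n => [|n]; first exact: (av 1%N).1.
by rewrite iterSr rotK; exact: (av n).2.
Qed.

Let unrotG t : G t -> G (unrot t).
Proof.
move=> [t01 av]; split; first by rewrite /unit_ico /= unrot01.
move=> n; split; last by rewrite -iterSr; exact: (av n.+1).2.
case: n => [|n]; first exact: (av 1%N).2.
by rewrite iterSr unrotK; exact: (av n).1.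
Qed.

Let measurable_preimage_real (r : R -> R) B : measurable_fun setT r -> measurable B -> measurable (r @^-1` B).
Proof. by move=> mr mB; rewrite -[X in measurable X]setTI; exact: mr. Qed.

Let iter_null (r : R -> R) n : measurable_fun setT r ->
  (forall B, measurable B -> leb (r @^-1` B `&` unit_ico) = leb (B `&` unit_ico)) ->
  measurable (iter n r @^-1` P0) /\ leb_null (iter n r @^-1` P0).
Proof.
move=> mr rp; elim: n => [|n [mI nI]]; first by split.
rewrite (_ : iter n.+1 r @^-1` P0 = r @^-1` (iter n r @^-1` P0)).
  by split; [exact: measurable_preimage_real|rewrite /leb_null rp].
by apply/seteqP; split=> t; rewrite /preimage /= -iterSr.
Qed.

Let munit : measurable unit_ico.
Proof. exact: (measurable_ico 0 1). Qed.

Let mG : measurable G.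
Proof.
apply: measurableI => //.
have -> : orbits_avoid = \bigcap_n (~` (iter n (@rot R) @^-1` P0) `&` ~` (iter n (@unrot R) @^-1` P0)).
  by apply/seteqP; split=> [t H n _|t H n]; [exact: H|exact: (H n I)].
apply: bigcapT_measurable => n; apply: measurableI; apply: measurableC.
  exact: (iter_null n (@measurable_rot R) (@rot_preserving R)).1.
exact: (iter_null n (@measurable_unrot R) (@unrot_preserving R)).1.
Qed.

Let nullG : leb_null (~` G).
Proof.
apply/negligibleP; first by apply: measurableI => //; exact: measurableC.
apply: (@negligibleS _ _ _ leb (\bigcup_n ((iter n (@rot R) @^-1` P0 `&` unit_ico) `|`
    (iter n (@unrot R) @^-1` P0 `&` unit_ico)))).
  move=> t [nG t01]; apply: contrapT => nb; apply: nG; split=> // n.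
  by split=> Pn; apply: nb; exists n => //; [left|right].
apply: negligible_bigcup => n; apply: negligibleU; apply/negligibleP.
- by apply: measurableI => //; exact: (iter_null n (@measurable_rot R) (@rot_preserving R)).1.
- exact: (iter_null n (@measurable_rot R) (@rot_preserving R)).2.
- by apply: measurableI => //; exact: (iter_null n (@measurable_unrot R) (@unrot_preserving R)).1.
- exact: (iter_null n (@measurable_unrot R) (@unrot_preserving R)).2.
Qed.

Let Y := pre G.
Let mY : measurable Y := mpre mG.

Let Yc : mu (~` Y) = 0%E.
Proof.
apply/negligibleP; first exact: measurableC.
apply: (@negligibleS _ _ _ mu (~` X1 `|` pre (~` G))).
  by move=> x nY; have [X1x|nX] := pselect (X1 x); [right; split=> // Gx; apply: nY|left].
apply: negligibleU; apply/negligibleP => //; first exact: measurableC.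
- exact/mpre/measurableC.
- exact: etrans (law (measurableC mG)).2 nullG.
Qed.

Let mYc : measurable (~` Y) := measurableC mY.

(** If a Borel set codes [A] up to a null set, its preimage under [r] codes the preimage of [A]
    under the lift [U], and the null set is pulled back to a null set; measurability and measure are
    then read off the code. *)
Let transported (r : R -> R) (U : X -> X) : measurable_fun setT r ->
  (forall B, measurable B -> leb (r @^-1` B `&` unit_ico) = leb (B `&` unit_ico)) ->
  (forall x, Y x -> Y (U x) /\ phi (U x) = r (phi x)) -> (forall x, ~ Y x -> U x = x) ->
  forall A, measurable A -> measurable (U @^-1` A) /\ mu (U @^-1` A) = mu A.
Proof.
move=> mr rp UY Uid A mA.
have AX : A `&` X1 `<=` X1 by move=> x [].
have mAX : measurable (A `&` X1) by exact: measurableI.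
have [B [N cBN]] := (codedP AX).1 mAX; have [mB mN N0 H cN] := cBN.
pose C := Y `&` U @^-1` A.
have CX : C `<=` X1 by move=> x [[]].
have mrB := measurable_preimage_real mr mB; have mrN := measurable_preimage_real mr mN.
have cC : coded X1 phi comp C (G `&` r @^-1` B) (r @^-1` N).
  split=> //; first exact: measurableI.
  - by rewrite /leb_null rp.
  - move=> x X1x nN; split.
      move=> [Yx AU]; have [YU EU] := UY x Yx; split; first by case: Yx.
      by rewrite /preimage /= -EU; apply/H; rewrite ?EU//; case: YU.
    move=> [Gx Bx]; have Yx : Y x by [].
    have [YU EU] := UY x Yx; split=> //.
    have : (A `&` X1) (U x) by apply/H; rewrite ?EU//; case: YU.
    by case.
  - by case: cN => [|->]; [left|right].
have mC : measurable C by apply/(codedP CX); eexists; eexists; exact: cC.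
have mAY : measurable (A `\` Y) by exact: measurableD.
have E : U @^-1` A = C `|` (A `\` Y).
  apply/seteqP; split=> x.
    move=> AU; have [Yx|nY] := pselect (Y x); first by left.
    by right; split=> //; rewrite -(Uid x nY).
  by case=> [[]//|[Ax nY]]; rewrite /preimage /= Uid.
have mU : measurable (U @^-1` A) by rewrite E; exact: measurableU.
split=> //; transitivity (mu C).
  apply: (mu_eq_off mU mC mYc Yc) => x nnY; rewrite E.
  have Yx : Y x by exact: contrapT.
  by split=> [[//|[_ /(_ Yx)]]|Cx]//; left.
rewrite (coded_measure CX mC cC).
transitivity (leb (r @^-1` B `&` unit_ico)).
  have m1 : measurable (G `&` r @^-1` B `&` unit_ico) by apply: measurableI => //; exact: measurableI.
  have m2 : measurable (r @^-1` B `&` unit_ico) by exact: measurableI.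
  have m3 : measurable (~` G `&` unit_ico) by apply: measurableI => //; exact: measurableC.
  have lebU0 (D D' : set R) : measurable D -> measurable D' -> leb D' = 0%E -> leb (D `|` D') = leb D.
    by move=> mD mD' D0; exact: measureU0.
  rewrite -(lebU0 _ _ m1 m3 nullG) -(lebU0 _ _ m2 m3 nullG); congr (leb _).
  apply/seteqP; split=> t.
    by case=> [[[Gt rt] ut]|h]; [left|right].
  case=> [[rt ut]|h]; last by right.
  by have [Gt|nG] := pselect (G t); [left|right].
rewrite rp// -(coded_measure AX mAX cBN).
apply: (mu_eq_off mAX mA (measurableC mX1) X1c) => x nX.
by split=> [[]//|Ax]; split=> //; exact: contrapT.
Qed.

Lemma transported_rotation : exists S Sinv, [/\ cancel S Sinv, cancel Sinv S,
  forall A, measurable A -> measurable (S @^-1` A) /\ mu (S @^-1` A) = mu A,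
  forall A, measurable A -> measurable (Sinv @^-1` A) &
  forall x, Y x -> Y (S x) /\ phi (S x) = rot (phi x)].
Proof.
have [x0 X1x0] : exists x, X1 x.
  apply: contrapT => nX; move: X1c; rewrite (_ : ~` X1 = setT).
    by rewrite probability_setT => /eqP; rewrite onee_eq0.
  by apply/seteqP; split=> // x _ Xx; apply: nX; exists x.
have /choice[psi Hpsi] (t : R) : exists x, G t -> X1 x /\ phi x = t.
  have [[t01 av]|nG] := pselect (G t); last by exists x0.
  by have [x Hx] := surj t01 (av 0%N).1; exists x.
pose S x := if `[< Y x >] then psi (rot (phi x)) else x.
pose Sinv x := if `[< Y x >] then psi (unrot (phi x)) else x.
have SY x : Y x -> Y (S x) /\ phi (S x) = rot (phi x).
  move=> Yx; rewrite /S asboolT//; have Gr : G (rot (phi x)) by apply: rotG; case: Yx.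
  by have [X1p E] := Hpsi _ Gr; split=> //; split=> //; rewrite /preimage /= E.
have SY' x : Y x -> Y (Sinv x) /\ phi (Sinv x) = unrot (phi x).
  move=> Yx; rewrite /Sinv asboolT//; have Gr : G (unrot (phi x)) by apply: unrotG; case: Yx.
  by have [X1p E] := Hpsi _ Gr; split=> //; split=> //; rewrite /preimage /= E.
have Sid x : ~ Y x -> S x = x by move=> nY; rewrite /S asboolF.
have Sid' x : ~ Y x -> Sinv x = x by move=> nY; rewrite /Sinv asboolF.
exists S, Sinv; split=> //.
- move=> x; have [Yx|nY] := pselect (Y x); last by rewrite Sid// Sid'.
  have [YS ES] := SY x Yx; have [YS' ES'] := SY' _ YS.
  apply: phi_inj; [by case: YS'|by case: Yx|by rewrite ES' ES rotK].
- move=> x; have [Yx|nY] := pselect (Y x); last by rewrite Sid'// Sid.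
  have [YS ES] := SY' x Yx; have [YS' ES'] := SY _ YS.
  apply: phi_inj; [by case: YS'|by case: Yx|by rewrite ES' ES unrotK].
- exact: (transported (@measurable_rot R) (@rot_preserving R)).
- by move=> A mA; have [] := transported (@measurable_unrot R) (@unrot_preserving R) SY' Sid' mA.
Qed.

(** For an invariant [E], the function [F t], the measure of the part of [E] over [[0, t)],
    satisfies the equations of [rotation_linear] and is linear. Hence [E] is independent of every
    Borel set, in particular of the one that codes [E], and its measure equals its own square. *)
Lemma transported_ergodic S : (forall A, measurable A -> measurable (S @^-1` A) /\ mu (S @^-1` A) = mu A) ->
  (forall x, Y x -> Y (S x) /\ phi (S x) = rot (phi x)) ->
  forall E, measurable E -> S @^-1` E = E -> mu E = 0%E \/ mu E = 1%E.
Proof.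
move=> mpS SY E mE iE; have /andP[a0 a1] := @alpha01 R.
have mEp B : measurable B -> measurable (E `&` pre B) by move=> mB; apply: measurableI => //; exact: mpre.
pose nu B := prob mu (E `&` pre B).
have nu_eq B B' : measurable B -> measurable B' -> (forall t, unit_ico t -> (B t <-> B' t)) -> nu B = nu B'.
  move=> mB mB' BB; rewrite /nu /prob (mu_eq_off (mEp B mB) (mEp B' mB') mYc Yc)// => x nnY.
  have [X1x [u01 _]] : Y x by exact: contrapT.
  by split=> -[Ex [_ Bx]]; split=> //; split=> //; exact/BB.
have nu_rot B : measurable B -> nu (@rot R @^-1` B) = nu B.
  move=> mB; have mrB := measurable_preimage_real (@measurable_rot R) mB.
  have [mSE SE] := mpS _ (mEp B mB).
  rewrite /nu /prob -SE (mu_eq_off (mEp _ mrB) mSE mYc Yc)// => x nnY.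
  have Yx : Y x by exact: contrapT.
  have [[X1S GS] ES] := SY x Yx; have [X1x _] := Yx.
  rewrite -[in X in X <-> _]iE; split=> -[Ex [_ Bx]]; split=> //; split=> //.
    by rewrite /preimage /= ES.
  by rewrite /preimage /= -ES.
have nuD B B' : measurable B -> measurable B' -> B `&` B' = set0 -> nu (B `|` B') = nu B + nu B'.
  move=> mB mB' BB; apply: EFin_inj; rewrite EFinD !probE//; try exact: mEp.
    have -> : E `&` pre (B `|` B') = (E `&` pre B) `|` (E `&` pre B').
      by apply/seteqP; split=> x; [move=> [Ex [X1x [Bx|Bx]]]; [left|right]|move=> [[Ex [X1x Bx]]|[Ex [X1x Bx]]]; split=> //; split=> //; [left|right]].
    apply: measureU; [exact: mEp|exact: mEp|].
    apply/seteqP; split=> x // [[_ [_ Bx]] [_ [_ Bx']]].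
    by have : (B `&` B') (phi x) by []; rewrite BB.
  by apply: mEp; exact: measurableU.
have mico a b : measurable (@ico R a b) := measurable_ico a b.
have nu_ico a b c : a <= b -> b <= c -> nu (ico a c) = nu (ico a b) + nu (ico b c).
  by move=> ab bc; have [-> h0] := ico_cat ab bc; exact: nuD.
pose F t := nu (ico 0 t).
have lebico t : 0 <= t <= 1 -> leb (ico 0 t `&` unit_ico) = t%:E.
  move=> /andP[t0 t1]; rewrite (_ : _ `&` _ = ico 0 t).
    rewrite icoE lebesgue_measure_itv /= lte_fin sube0; case: ltP => // h.
    by congr EFin; apply/eqP; rewrite eq_le t0.
  apply/seteqP; split=> u; first by case.
  by move=> ut; split=> //; have /andP[u0 ut'] := ut; apply/andP; split=> //; exact: lt_le_trans ut' t1.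
have F0 t : 0 <= t <= 1 -> 0 <= F t <= t.
  move=> t01; rewrite /F /nu prob_ge0 /=.
  have : prob mu (E `&` pre (ico 0 t)) <= prob mu (pre (ico 0 t)).
    by apply: prob_le; [exact: mEp|exact: mpre|move=> x []].
  by rewrite [X in _ <= X]/prob (law (mico 0 t)).2 lebico.
have F1 : F 1 = prob mu E.
  rewrite /F /nu /prob (mu_eq_off (mEp _ (mico 0 1)) mE mYc Yc)// => x nnY.
  have [X1x [u01 _]] : Y x by exact: contrapT.
  by split=> [[]//|Ex]; split.
have FE : forall t, 0 <= t <= 1 -> F t = t * F 1.
  (* Invariance of [E] makes [nu] rotation invariant; splitting [[0, t)] at [alpha] or at
     [1 - alpha] turns this into the functional equations for [F]. *)
  have rotico t : 0 <= t <= 1 - alpha R -> nu (ico (alpha R) (t + alpha R)) = F t.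
    move=> /andP[t0 t1]; rewrite -nu_rot//; apply: nu_eq => //.
      exact: (measurable_preimage_real (@measurable_rot R)).
    by move=> u u01; apply: (rot_ico_low _ u01); rewrite t0.
  apply: rotation_linear => //.
  - by have /andP[] := F0 1 ltac:(by rewrite ler01 lexx).
  - move=> t /andP[t0 t1]; rewrite /F (nu_ico 0 (alpha R)) ?(ltW a0)//; last by lra.
    by rewrite rotico ?t0 ?ltW// addrC.
  - move=> t /andP[t0 t1]; rewrite {2}/F (nu_ico 0 (1 - alpha R)) //; last by lra.
    have -> : nu (ico 0 (1 - alpha R)) = F 1 - F (alpha R).
      rewrite -[LHS]rotico; last by apply/andP; split; lra.
      by rewrite subrK /F [in RHS](nu_ico 0 (alpha R) 1) ?ltW//; ring.
    have -> : nu (ico (1 - alpha R) t) = F (t + alpha R - 1); last by ring.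
    rewrite /F -(nu_rot (ico 0 _))//; apply: nu_eq => //.
      exact: (measurable_preimage_real (@measurable_rot R)).
    by move=> u u01; apply: iff_sym; apply: (rot_ico_high _ u01); rewrite t0 ltW.
have key B : measurable B -> mu (E `&` pre B) = ((prob mu E)%:E * mu (pre B))%E.
  have GE : @measurable _ (measurableTypeR R) = <<s @RGenInftyO.G R >> by exact: RGenInftyO.measurableE.
  move=> mB; apply: (dynkin_induction (T := measurableTypeR R) (G := @RGenInftyO.G R)
    (P := [set B | mu (E `&` pre B) = ((prob mu E)%:E * mu (pre B))%E])) => //.
  - move=> _ _ [x ->] [y ->]; exists (Num.min x y); apply/seteqP; split=> t /=; rewrite !in_itv /= lt_min.
      by move=> [-> ->].
    by move=> /andP[].
  - rewrite /= [mu (pre setT)](law measurableT).2 (_ : leb (setT `&` unit_ico) = 1%E); last first.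
      by rewrite setTI (_ : unit_ico = ico 0 1 `&` unit_ico) ?lebico ?setIid// ler01 lexx.
    rewrite mule1 probE//; apply: (mu_eq_off (mEp _ measurableT) mE (measurableC mX1) X1c) => x nX.
    by split=> [[]//|Ex]; split=> //; split=> //; exact: contrapT.
  - move=> _ [x ->] /=; pose c : R := Num.max 0 (Num.min x 1).
    have c01 : 0 <= c <= 1 by rewrite /c le_max lexx ge_max ler01 ge_min lexx orbT.
    have ray t : unit_ico t -> (`]-oo, x[%classic t <-> ico 0 c t).
      move=> /andP[t0 t1]; rewrite /ico /= in_itv /= t0 lt_max lt_min t1 andbT.
      by rewrite ltNge t0.
    have mx : measurable `]-oo, x[%classic by [].
    rewrite (law mx).2 -(probE mu (mEp _ mx)) -/(nu _) (nu_eq _ _ mx (mico 0 c) ray) -/(F c) FE// F1.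
    have -> : `]-oo, x[%classic `&` unit_ico = ico 0 c `&` unit_ico.
      by apply/seteqP; split=> t [h u01]; split=> //; apply/(ray t u01).
    by rewrite lebico// -EFinM mulrC.
  - move=> B' mB' /= IH; have mC := measurableC mB'.
    have E1 : nu B' + nu (~` B') = prob mu E.
      rewrite -nuD ?setICr// setUv /nu /prob; congr fine.
      apply: (mu_eq_off (mEp _ measurableT) mE (measurableC mX1) X1c) => x nX.
      by split=> [[]//|Ex]; split=> //; split=> //; exact: contrapT.
    have E2 : prob mu (pre B') + prob mu (pre (~` B')) = 1.
      rewrite -(prob_setC mu (mpre mB')); congr (_ + _); rewrite /prob; congr fine.
      apply: (mu_eq_off (mpre mC) (measurableC (mpre mB')) (measurableC mX1) X1c) => x nX.
      have X1x : X1 x by exact: contrapT.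
      by split=> [[_ nB] [_ /nB]|nB]//; split=> // Bx; apply: nB.
    move: IH; rewrite -!probE; try exact: mpre; try exact: mEp.
    rewrite -!EFinM -!/(nu _) => -[IH]; congr EFin.
    rewrite -[LHS](addKr (nu B')) E1 IH -[prob mu (pre (~` B'))](addKr (prob mu (pre B'))) E2; ring.
  - move=> F' mF' tF' /= IH.
    have cap (D : set X) : D `&` pre (\bigcup_k F' k) = \bigcup_k (D `&` pre (F' k)).
      apply/seteqP; split=> [x [Dx [X1x [k _ Fx]]]|x [k _ [Dx [X1x Fx]]]]; first by exists k.
      by split=> //; split=> //; exists k.
    have tr (D : set X) : trivIset setT (fun k => D `&` pre (F' k)).
      move=> i j _ _ [x [[_ [_ Fi]] [_ [_ Fj]]]]; apply: (tF' i j) => //.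
      by exists (phi x).
    have sigma (D : set X) : measurable D ->
        mu (D `&` pre (\bigcup_k F' k)) = (\sum_(0 <= k <oo) mu (D `&` pre (F' k)))%E.
      move=> mD; rewrite cap; apply: measure_semi_bigcup => //.
        by move=> k; apply: measurableI => //; exact: (mpre (mF' k)).
      by apply: bigcupT_measurable => k; apply: measurableI => //; exact: (mpre (mF' k)).
    have := sigma setT measurableT; rewrite setTI => ->.
    rewrite sigma// -nneseriesZl//; apply: eq_eseriesr => k _.
    by rewrite setTI; exact: IH.
  - by rewrite -GE.
have EX : E `&` X1 `<=` X1 by move=> x [].
have mEX : measurable (E `&` X1) by exact: measurableI.
have [B [N cBN]] := (codedP EX).1 mEX; have [mB mN N0 H _] := cBN.
have EB : mu E = mu (pre B).
  rewrite (law mB).2 -(coded_measure EX mEX cBN).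
  by apply: (mu_eq_off mE mEX (measurableC mX1) X1c) => x nX; split=> [Ex|[]//]; split=> //; exact: contrapT.
have EEB : mu (E `&` pre B) = mu E.
  apply: (mu_eq_off (mEp B mB) mE (measurableU _ _ (measurableC mX1) (mpre mN))).
    have pN0 : mu (pre N) = 0%E by rewrite (law mN).2.
    by rewrite (probability_setU0 (measurableC mX1) (mpre mN) pN0).
  move=> x nQ; split=> [[]//|Ex].
  have X1x : X1 x by apply: contrapT => h; apply: nQ; left.
  have nN : ~ N (phi x) by move=> h; apply: nQ; right.
  by split=> //; split=> //; have := (H x X1x nN).1; apply; split.
have := key B mB; rewrite EEB -EB -(probE mu mE) -EFinM => -[] /eqP.
rewrite -subr_eq0 -{1}[prob mu E]mulr1 -mulrBr mulf_eq0 subr_eq0 => /orP[/eqP->|/eqP<-]; by [left|right].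
Qed.

Lemma transported_system : exists S Sinv (psi : X -> R), [/\ cancel S Sinv, cancel Sinv S,
  ergodic_invertible mu S, measurable_fun setT psi &
  (forall x, 0 <= psi x <= 1) /\ forall t, mu (psi @^-1` [set t]) = 0%E].
Proof.
have [S [Sinv [K K' mpS mSinv SY]]] := transported_rotation.
(* The value 0 may be repeated off [X1], but only on a null set, so no atom arises. *)
pose psi x := if `[< X1 x >] then phi x else 0.
have mpsi B : measurable B -> measurable (psi @^-1` B).
  move=> mB; have [B0|nB0] := pselect (B 0).
    rewrite (_ : _ @^-1` _ = pre B `|` ~` X1).
      by apply: measurableU; [exact: mpre|exact: measurableC].
    apply/seteqP; split=> x; rewrite /preimage /psi /=; case: asboolP => Xx.
    - by left.
    - by right.
    - by case=> [[]|/(_ Xx)].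
    - by [].
  rewrite (_ : _ @^-1` _ = pre B); first exact: mpre.
  by apply/seteqP; split=> x; rewrite /preimage /psi /=; case: asboolP => Xx // -[].
exists S, Sinv, psi; split=> //.
- split.
  + by exists Sinv.
  + by move=> _ A mA; rewrite setTI; exact: (mpS A mA).1.
  + move=> A mA; rewrite (_ : S @` A = Sinv @^-1` A); first exact: mSinv.
    apply/seteqP; split=> [_ [x Ax <-]|x Ax]; first by rewrite /preimage /= K.
    by exists (Sinv x).
  + by move=> A mA; exact: (mpS A mA).2.
  + exact: transported_ergodic.
- by move=> _ B mB; rewrite setTI; exact: mpsi.
split; first by move=> x; rewrite /psi; case: asboolP => [|_]; [exact: phi_bound|rewrite lexx ler01].
move=> t; have mt : measurable [set t] by exact: measurable_set1.
rewrite (mu_eq_off (mpsi _ mt) (mpre mt) (measurableC mX1) X1c) => [|x nX].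
  rewrite (law mt).2; apply/negligibleP; first exact: measurableI.
  apply: (@negligibleS _ _ _ leb [set t]); first by move=> u [].
  by apply/negligibleP => //; exact: lebesgue_measure_set1.
have X1x : X1 x by exact: contrapT.
by rewrite /preimage /psi /= asboolT//; split=> [|[]].
Qed.

End transport.

Section standard.
Context {R : realType} {d : measure_display} {X : measurableType d}.
Variable mu : probability X R.
Notation leb := (@lebesgue_measure R).
Implicit Types (B N : set R) (A : set X) (D : set R).

Lemma leb_eq_off B B' N : measurable B -> measurable B' -> measurable N -> leb N = 0%E ->
  (forall t, ~ N t -> (B t <-> B' t)) -> leb B = leb B'.
Proof.
move=> mB mB' mN N0 H.
have lebU0 D D' : measurable D -> measurable D' -> leb D' = 0%E -> leb (D `|` D') = leb D.
  by move=> mD mD' D0; exact: measureU0.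
rewrite -(lebU0 _ _ mB mN N0) -(lebU0 _ _ mB' mN N0); congr (leb _).
by apply/seteqP; split=> t; have [Nt _|nN [Bt|//]] := pselect (N t); [right|left; exact/(H t nN)|
  right|left; exact/(H t nN)].
Qed.

(* A common description of the Borel ([comp = False]) and of the Lebesgue
   measurable sets of the line. *)
Lemma standard_system_gen (M2 : set R -> Prop) (m2 : set R -> \bar R) (comp : Prop)
    (X1 : set X) (X2 : set R) (phi : X -> R) :
  (forall D, M2 D <-> exists B N, [/\ measurable B, measurable N, leb N = 0%E,
     forall t, ~ N t -> (D t <-> B t) & comp \/ N = set0]) ->
  (forall D B N, M2 D -> measurable B -> measurable N -> leb N = 0%E ->
     (forall t, ~ N t -> (D t <-> B t)) -> m2 D = leb B) ->
  measurable X1 -> mu (~` X1) = 0%E -> M2 X2 -> X2 `<=` `[0, 1] -> m2 (`[0, 1] `\` X2) = 0%E ->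
  set_bij X1 X2 phi -> (forall A, A `<=` X1 -> measurable A <-> M2 (phi @` A)) ->
  (forall A, A `<=` X1 -> measurable A -> m2 (phi @` A) = mu A) ->
  exists S Sinv (psi : X -> R), [/\ cancel S Sinv, cancel Sinv S,
  ergodic_invertible mu S, measurable_fun setT psi &
  (forall x, 0 <= psi x <= 1) /\ forall t, mu (psi @^-1` [set t]) = 0%E].
Proof.
move=> M2P m2P mX1 X1c M2X2 X2I X20 [fX iX sX] mimg muimg.
have phi_inj x y : X1 x -> X1 y -> phi x = phi y -> x = y.
  by move=> Xx Xy; apply: iX; rewrite inE.
have [B2 [N2 [mB2 mN2 N20 H2 c2]]] := (M2P X2).1 M2X2.
have mI : measurable (`[0, 1]%classic : set R) by exact: measurable_itv.
have lebU D D' : measurable D -> measurable D' -> leb D = 0%E -> leb D' = 0%E -> leb (D `|` D') = 0%E.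
  by move=> mD mD' D0 D0'; rewrite measureU0.
have M2c : M2 (`[0, 1] `\` X2).
  apply/M2P; exists (`[0, 1] `\` B2), N2; split=> //; first exact: measurableD.
  by move=> t nN; split=> -[It nX]; split=> // h; apply: nX; apply/H2.
have null2 : leb (`[0, 1] `\` B2) = 0%E.
  rewrite -X20; apply/esym; apply: (m2P _ _ N2) => //; first exact: measurableD.
  by move=> t nN; split=> -[It nX]; split=> // h; apply: nX; apply/H2.
(* A Borel null set that contains every point of the unit interval outside [X2]: [X2] itself is only
   known through its code [B2]. *)
pose P0 := (`[0, 1] `\` B2) `|` N2.
have mP0 : measurable P0 by apply: measurableU => //; exact: measurableD.
have P00 : leb P0 = 0%E by apply: lebU => //; exact: measurableD.
have null1 : leb [set 1] = 0%E by exact: lebesgue_measure_set1.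
have mu_ico := measurable_ico (0 : R) 1.
have sub_null B N : measurable B -> measurable N -> leb N = 0%E -> B `<=` N -> leb B = 0%E.
  by move=> mB mN N0 BN; exact: (@subset_measure0 _ _ _ leb B N).
have unitI t : unit_ico t -> `[0, 1]%classic t.
  by move=> /andP[t0 t1]; rewrite /= in_itv /= t0 ltW.
have Iunit t : `[0, 1]%classic t -> t != 1 -> unit_ico t.
  by rewrite /= in_itv /= => /andP[t0 t1] n1; rewrite /unit_ico /= t0 lt_neqAle n1.
have surj t : unit_ico t -> ~ P0 t -> exists x, X1 x /\ phi x = t.
  move=> ut nP; have X2t : X2 t.
    apply/H2; first by move=> h; apply: nP; right.
    by apply: contrapT => nB; apply: nP; left; split=> //; exact: unitI.
  by have [x Xx <-] := sX t X2t; exists x.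
have img A x : A `<=` X1 -> X1 x -> (phi @` A) (phi x) <-> A x.
  move=> AX Xx; split=> [[y Ay E]|Ax]; last by exists x.
  by rewrite -(phi_inj y x (AX y Ay) Xx E).
have imgpre B : phi @` (X1 `&` phi @^-1` B) = X2 `&` B.
  apply/seteqP; split=> [_ [x [Xx Bx] <-]|t [X2t Bt]]; first by split=> //; exact: fX.
  by have [x Xx E] := sX t X2t; exists x => //; split=> //; rewrite /preimage /= E.
have law B : measurable B -> measurable (X1 `&` phi @^-1` B) /\
    mu (X1 `&` phi @^-1` B) = leb (B `&` @unit_ico R).
  move=> mB; have sX1 : X1 `&` phi @^-1` B `<=` X1 by move=> x [].
  have H t : ~ N2 t -> (X2 `&` B) t <-> (B2 `&` B) t.
    by move=> nN; split=> -[h Bt]; split=> //; apply/H2.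
  have mBB : measurable (B2 `&` B) by exact: measurableI.
  have M2B : M2 (X2 `&` B) by apply/M2P; exists (B2 `&` B), N2.
  have mp : measurable (X1 `&` phi @^-1` B) by apply/mimg => //; rewrite imgpre.
  split=> //; rewrite -muimg// imgpre (m2P _ (B2 `&` B) N2)//.
  (* The point 1 is discarded to pass from the closed interval of the isomorphism to the half-open
     one of the rotation. *)
  have mQ : measurable (P0 `|` [set 1]) by apply: measurableU => //; exact: measurable_set1.
  apply: (leb_eq_off (N := P0 `|` [set 1])) => //.
  - exact: measurableI.
  - by apply: lebU => //; exact: measurable_set1.
  move=> t nQ; have nN : ~ N2 t by move=> h; apply: nQ; left; right.
  have n1 : t != 1 by apply/eqP => h; apply: nQ; right.
  split=> -[h1 h2]; split=> //.
    by apply: Iunit => //; apply: X2I; exact/H2.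
  by apply: contrapT => nB; apply: nQ; left; left; split=> //; exact: unitI.
apply: (@transported_system R d X mu X1 phi comp P0) => //.
- by move=> x Xx; have := X2I _ (fX _ Xx); rewrite /= in_itv.
- by apply: (sub_null _ P0) => //; exact: measurableI.
move=> A AX; rewrite (mimg A AX) M2P; split=> -[B [N]].
  move=> [mB mN N0 H c]; exists B, N; split=> //.
    by apply: (sub_null _ N) => //; exact: measurableI.
  by move=> x Xx nN; rewrite -(img A x AX Xx); exact: H.
move=> [mB mN N0 H c]; exists (B2 `&` B), ((N `&` `[0, 1]) `|` N2).
have mNI : measurable (N `&` `[0, 1]%classic) by exact: measurableI.
split=> //.
- exact: measurableI.
- exact: measurableU.
- apply: (lebU) => //; apply: (sub_null _ ((N `&` @unit_ico R) `|` [set 1])) => //.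
  + by apply: measurableU; [exact: measurableI|exact: measurable_set1].
  + by apply: lebU => //; exact: measurableI.
  + move=> t [Nt It]; have [->|n1] := eqVneq t 1; first by right.
    by left; split=> //; exact: Iunit.
- move=> t nQ; have nN2 : ~ N2 t by move=> h; apply: nQ; right.
  split.
    move=> [x Ax E]; have Xx := AX x Ax; rewrite -E in nQ nN2 *.
    have X2t := fX _ Xx; split; first exact/H2.
    by apply/H => // h; apply: nQ; left; split=> //; exact: X2I.
  move=> [/(H2 t nN2) X2t Bt]; have [x Xx E] := sX t X2t; exists x => //.
  apply/H => //; rewrite E// => h; apply: nQ; left; split=> //; exact: X2I.
- case: c => [|->]; first by left.
  by case: c2 => [|->]; [left|right]; rewrite ?set0I ?setU0.
Qed.

(** The Carathéodory sets form the completion of the Borel sets: a Borel set joined with a subset of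
    a null set. Conversely [D] is the union of the Borel set [B] minus [N] and of its own part in
    [N]. *)
Lemma caratheodory_codedP D :
  measurable (D : set (caratheodory_type (@wlength R idfun)^*%mu)) <->
  exists B N, [/\ measurable B, measurable N, leb N = 0%E,
     forall t, ~ N t -> (D t <-> B t) & True \/ N = set0].
Proof.
have E : @measurable _ (caratheodory_type (@wlength R idfun)^*%mu) = completed_algebra_gen leb.
  rewrite -g_sigma_completed_algebra_genE; apply/esym; exact: completed_caratheodory_measurable.
rewrite E; split.
  move=> [B mB [N' [N [mN N0 NN]] <-]]; exists B, N; split=> //; last by left.
  by move=> t nN; split=> [[//|/NN]|Bt]//; left.
move=> [B [N [mB mN N0 H _]]]; exists (B `\` N); first exact: measurableD.
exists (D `&` N); first by exists N; split=> // t [].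
apply/seteqP; split=> t.
  by case=> [[Bt nN]|[//]]; exact/H.
by move=> Dt; have [Nt|nN] := pselect (N t); [right|left; split=> //; exact/H].
Qed.

Lemma standard_system : standard_probability mu ->
  exists S Sinv (psi : X -> R), [/\ cancel S Sinv, cancel Sinv S,
  ergodic_invertible mu S, measurable_fun setT psi &
  (forall x, 0 <= psi x <= 1) /\ forall t, mu (psi @^-1` [set t]) = 0%E].
Proof.
case=> -[X1 [X2 [phi [[mX1 _ X1c] [mX2 X2I X20] bij mimg muimg]]]].
  apply: (@standard_system_gen (fun D => measurable D) leb False X1 X2 phi) => //; last by rewrite -setTD.
    move=> D; split=> [mD|[B [N [mB mN N0 H [//|NE]]]]].
      by exists D, set0; split=> //; right.
    by rewrite (_ : D = B)//; apply/seteqP; split=> t; have := H t; rewrite NE => /(_ id)[].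
  by move=> D B N mD mB mN N0 H; exact: (leb_eq_off mD mB mN N0 H).
apply: (@standard_system_gen (fun D => measurable (D : set (caratheodory_type (@wlength R idfun)^*%mu)))
  completed_lebesgue_measure True X1 X2 phi) => //; last by rewrite -setTD.
  exact: caratheodory_codedP.
move=> D B N mD mB mN N0 H.
have cB : measurable (B : set (caratheodory_type (@wlength R idfun)^*%mu)) by exact: sub_caratheodory.
have cN : measurable (N : set (caratheodory_type (@wlength R idfun)^*%mu)) by exact: sub_caratheodory.
have U0 (A A' : set (caratheodory_type (@wlength R idfun)^*%mu)) : measurable A -> measurable A' ->
    completed_lebesgue_measure A' = 0%E -> completed_lebesgue_measure (A `|` A') = completed_lebesgue_measure A.
  by move=> mA mA' A0; exact: measureU0.
transitivity (completed_lebesgue_measure B) => //.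
rewrite -(U0 _ _ mD cN N0) -(U0 _ _ cB cN N0); congr completed_lebesgue_measure.
by apply/seteqP; split=> t; have [Nt _|nN [Bt|//]] := pselect (N t); [right|left; exact/(H t nN)|
  right|left; exact/(H t nN)].
Qed.

Lemma integrals_balanced (f : X -> R) : measurable_fun setT f ->
  (\int[mu]_(x in [set x | (0 < f x)%R]) (f x)%:E =
    - \int[mu]_(x in [set x | (f x < 0)%R]) (f x)%:E)%E <-> balanced mu f.
Proof.
move=> mf; rewrite /balanced /ipos.
have -> : (\int[mu]_(x in [set x | (0 < f x)%R]) (f x)%:E = \int[mu]_x (Num.max (f x) 0)%:E)%E.
  rewrite integral_mkcond; apply: eq_integral => x _; rewrite patchE.
  case: ifPn; rewrite ?inE ?notin_setE /=; first by move=> h; rewrite max_l// ltW.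
  by move=> /negP; rewrite -leNgt => h; rewrite max_r.
suff -> : (\int[mu]_(x in [set x | (f x < 0)%R]) (f x)%:E = - \int[mu]_x (Num.max (- f x) 0)%:E)%E.
  by rewrite oppeK.
rewrite integral_mkcond -integral_ge0N; last by move=> x _; rewrite lee_fin le_max lexx orbT.
apply: eq_integral => x _; rewrite patchE.
case: ifPn; rewrite ?inE ?notin_setE /=.
  by move=> h; rewrite max_l ?EFinN ?oppeK// oppr_ge0 ltW.
by move=> /negP; rewrite -leNgt => h; rewrite max_r ?oppr_le0// oppr0.
Qed.

End standard.

Theorem theorem1p3 (R : realType) (d : measure_display) (X : measurableType d)
    (mu : probability X R) (f : X -> R) :
  standard_probability mu ->
  measurable_fun [set: X] f ->
  (0 < mu [set x | f x != 0%R])%E ->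
  meager [set T : ergodic_class mu | coboundary mu f (repr T)] /\
  ((exists T : ergodic_class mu, coboundary mu f (repr T)) <->
   (\int[mu]_(x in [set x | (0 < f x)%R]) (f x)%:E =
    - \int[mu]_(x in [set x | (f x < 0)%R]) (f x)%:E)%E).
Proof.
move=> /standard_system[S [Sinv [phi [K K' eS mphi [phi01 phi0]]]]] mf f0.
split; first exact: (coboundary_meager mf mphi phi01 phi0 f0).
rewrite integrals_balanced//; split.
  move=> [T [g [mg fg]]]; have eT := etfunP (repr T).
  have mT := ei_measurable eT.
  have := coboundary_balanced mT (ei_preserving eT) mg.
  have mh : measurable_fun setT (fun x => g x - g (repr T x)).
    by apply: measurable_funB => //; exact: (measurableT_comp mg mT).
  rewrite /balanced (ipos_ae mf mh fg) => ->; apply: ipos_ae.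
  - exact: measurableT_comp.
  - exact: measurableT_comp.
  - by apply: filterS fg => x /= ->.
move=> bf; have [T [eT cT]] := balanced_coboundary K K' eS mphi phi01 phi0 mf bf.
by exists (\pi_(ergodic_class mu) (ErgodicTransf eT))%qT; apply/coboundary_pi.
Qed.
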